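(* Consider the interconnected system described in the context, with a partition $\{1,\dots,n\}=I_\Sigma\cup I_{\max}$, and assume each subsystem $i$ has an ISS Lyapunov function $V_i$ (in the mixed sense defined in the context) with gains $\gamma_{ij}\in\mathcal{K}_\infty\cup\{0\}$, $\gamma_i\in\mathcal{K}$. Let $\Gamma$ and $\overline\Gamma$ be the associated operators. If there exists $\alpha\in\mathcal{K}_\infty$ such that $\Gamma\circ D_\alpha(s)\not\ge s$ for all $s\in\mathbb{R}^n_+\setminus\{0\}$, then the whole system $\dot x=f(x,u)$ is ISS; moreover there exist an $\Omega$-path $\sigma$ and $\phi\in\mathcal{K}_\infty$ such that $\overline\Gamma(\sigma(r),\phi(r))<\sigma(r)$ for all $r>0$, and $V(x)=\max_{i=1,\dots,n}\sigma_i^{-1}(V_i(x_i))$ is an ISS Lyapunov function for the whole system.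
   Context: The interconnection is $\dot x_i=f_i(x_1,\dots,x_n,u_i)$, $i=1,\dots,n$, $x_i\in\mathbb{R}^{N_i}$, $u_i\in\mathbb{R}^{m_i}$, each $f_i$ continuous and, for every $r$, locally Lipschitz in $x=(x_1^T,\dots,x_n^T)^T$ uniformly in $|u_i|\le r$; written as $\dot x=f(x,u)$. $\mathcal{K}$: continuous strictly increasing functions $\mathbb{R}_+\to\mathbb{R}_+$ vanishing at $0$; $\mathcal{K}_\infty$: unbounded ones. A continuous $\rho:\mathbb{R}_+\to\mathbb{R}_+$ is positive definite if $\rho(r)=0\iff r=0$. $V:\mathbb{R}^N\to\mathbb{R}_+$ is proper and positive definite if $\psi_1(\|x\|)\le V(x)\le\psi_2(\|x\|)$ for some $\psi_1,\psi_2\in\mathcal{K}_\infty$. An ISS Lyapunov function for $\dot x=f(x,u)$ is a continuous $V$, proper, positive definite, locally Lipschitz on $\mathbb{R}^N\setminus\{0\}$, such that for some $\gamma\in\mathcal{K}$ and positive definite $\alpha$, at all points of differentiability, $V(x)\ge\gamma(\|u\|)\Rightarrow\nabla V(x)f(x,u)\le-\alpha(\|x\|)$. $V_i:\mathbb{R}^{N_i}\to\mathbb{R}_+$ is an ISS Lyapunov function for subsystem $i$ if it is continuous, proper, positive definite, locally Lipschitz on $\mathbb{R}^{N_i}\setminus\{0\}$, and there are $\gamma_{ij}\in\mathcal{K}_\infty\cup\{0\}$ ($\gamma_{ii}\equiv0$), $\gamma_i\in\mathcal{K}$ and positive definite $\alpha_i$ such that at all points of differentiability of $V_i$: for $i\in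 I_\Sigma$, $V_i(x_i)\ge\sum_j\gamma_{ij}(V_j(x_j))+\gamma_i(\|u\|)\Rightarrow\nabla V_i(x_i)f_i(x,u)\le-\alpha_i(\|x_i\|)$; for $i\in I_{\max}$, $V_i(x_i)\ge\max\{\max_j\gamma_{ij}(V_j(x_j)),\gamma_i(\|u\|)\}\Rightarrow\nabla V_i(x_i)f_i(x,u)\le-\alpha_i(\|x_i\|)$. $\Gamma(s)=(\Gamma_i(s))_i$ with $\Gamma_i(s)=\sum_j\gamma_{ij}(s_j)$ ($i\in I_\Sigma$), $\Gamma_i(s)=\max_j\gamma_{ij}(s_j)$ ($i\in I_{\max}$). $\overline\Gamma:\mathbb{R}^n_+\times\mathbb{R}_+\to\mathbb{R}^n_+$ is $\overline\Gamma_i(s,r)=\sum_j\gamma_{ij}(s_j)+\gamma_i(r)$ for $i\in I_\Sigma$ and $\overline\Gamma_i(s,r)=\max\{\max_j\gamma_{ij}(s_j),\gamma_i(r)\}$ for $i\in I_{\max}$. $D_\alpha(s)=(D_i(s_i))_i$ with $D_i=\mathrm{id}+\alpha$ for $i\in I_\Sigma$, $D_i=\mathrm{id}$ for $i\in I_{\max}$. For $x,y\in\mathbb{R}^n$: $x<y$ iff $x_i<y_i$ for all $i$; $x\not\ge y$ iff $x_i<y_i$ for some $i$. A continuous $\sigma=(\sigma_1,\dots,\sigma_n)$ with $\sigma_i\in\mathcal{K}_\infty$ is an $\Omega$-path (with respect to $\Gamma$) if (i) each $\sigma_i^{-1}$ is locally Lipschitz on $(0,\infty)$; (ii) for every compact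 $P\subset(0,\infty)$ there are constants $0<c\le C$ with $c\le(\sigma_i^{-1})'(r)\le C$ for all $r\in P$ at which $\sigma_i^{-1}$ is differentiable; (iii) $\Gamma(\sigma(r))<\sigma(r)$ for all $r>0$. *)

(* Defs.v *)
From HB Require Import structures.
From mathcomp Require Import all_boot all_order all_algebra.
From mathcomp Require Import all_classical all_reals all_analysis.
From mathcomp Require Import ess_sup_inf.
Set Implicit Arguments. Unset Strict Implicit. Unset Printing Implicit Defensive.
Import Order.TTheory GRing.Theory Num.Theory.
Import numFieldNormedType.Exports.
Local Open Scope classical_set_scope.
Local Open Scope ring_scope.

Section Defs.
Variable R : realType.

Definition Rnn : set R := [set r | 0 <= r].

Definition enorm k (v : 'rV[R]_k) : R := Num.sqrt (\sum_(j < k) v 0 j ^+ 2).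

Definition isK (g : R -> R) : Prop :=
  [/\ g 0 = 0, {within Rnn, continuous g},
      (forall r, 0 <= r -> 0 <= g r) &
      (forall a b, 0 <= a -> a < b -> g a < g b)].

Definition isKinf (g : R -> R) : Prop :=
  isK g /\ (forall M, exists2 r, 0 <= r & M <= g r).

Definition isKinf0 (g : R -> R) : Prop :=
  isKinf g \/ (forall r, 0 <= r -> g r = 0).

Definition isPD (rho : R -> R) : Prop :=
  {within Rnn, continuous rho} /\
  (forall r, 0 <= r -> 0 <= rho r /\ (rho r = 0 <-> r = 0)).

Definition isKL (beta : R -> R -> R) : Prop :=
  (forall t, 0 <= t -> isK (fun r => beta r t)) /\
  (forall r, 0 <= r ->
     (forall t1 t2, 0 <= t1 -> t1 <= t2 -> beta r t2 <= beta r t1) /\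
     beta r t @[t --> +oo] --> 0).

Definition proper_pd k (V : 'rV[R]_k -> R) : Prop :=
  exists psi1 psi2, [/\ isKinf psi1, isKinf psi2 &
    forall x, psi1 (enorm x) <= V x /\ V x <= psi2 (enorm x)].

Definition loclip_nz k (V : 'rV[R]_k -> R) : Prop :=
  forall x0, x0 != 0 -> exists d, exists L, 0 < d /\
    forall x y, enorm (x - x0) < d -> enorm (y - x0) < d ->
      `|V x - V y| <= L * enorm (x - y).

Definition loclip_unif k m p (g : 'rV[R]_k -> 'rV[R]_m -> 'rV[R]_p) : Prop :=
  forall r x0, exists d, exists L, 0 < d /\
    forall x y u, enorm (x - x0) < d -> enorm (y - x0) < d -> enorm u <= r ->
      enorm (g x u - g y u) <= L * enorm (x - y).

Definition ISS_Lyapunov k m (F : 'rV[R]_k -> 'rV[R]_m -> 'rV[R]_k)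
    (V : 'rV[R]_k -> R) : Prop :=
  [/\ continuous V, proper_pd V, loclip_nz V &
    exists gam alpha, [/\ isK gam, isPD alpha &
      forall x u, differentiable V x -> gam (enorm u) <= V x ->
        'd V x (F x u) <= - alpha (enorm x)]].

(* operators Gamma, Gamma-bar and D_alpha; isSum i <-> i \in I_Sigma,
   ~~ isSum i <-> i \in I_max *)
Definition Gam n (isSum : pred 'I_n) (g : 'I_n -> 'I_n -> R -> R)
    (s : 'I_n -> R) (i : 'I_n) : R :=
  if isSum i then \sum_(j < n) g i j (s j)
  else \big[Num.max/0]_(j < n) g i j (s j).

Definition Gambar n (isSum : pred 'I_n) (g : 'I_n -> 'I_n -> R -> R)
    (gi : 'I_n -> R -> R) (s : 'I_n -> R) (r : R) (i : 'I_n) : R :=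
  if isSum i then \sum_(j < n) g i j (s j) + gi i r
  else Num.max (\big[Num.max/0]_(j < n) g i j (s j)) (gi i r).

Definition Dalpha n (isSum : pred 'I_n) (alpha : R -> R) (s : 'I_n -> R)
    (i : 'I_n) : R :=
  if isSum i then s i + alpha (s i) else s i.

Definition Omega_path n (isSum : pred 'I_n) (g : 'I_n -> 'I_n -> R -> R)
    (sigma sigmainv : 'I_n -> R -> R) : Prop :=
  [/\ (forall i, isKinf (sigma i)),
      (forall i r, 0 <= r -> sigmainv i (sigma i r) = r /\
                              sigma i (sigmainv i r) = r),
      (forall i r0, 0 < r0 -> exists d, exists L, (0 < d <= r0) /\
         forall a b, `|a - r0| < d -> `|b - r0| < d ->
           `|sigmainv i a - sigmainv i b| <= L * `|a - b|),
      (forall i (P : set R), compact P -> P `<=` [set r | 0 < r] ->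
         exists c, exists C, (0 < c <= C) /\
           forall r, P r -> derivable (sigmainv i) r 1 ->
             c <= derive1 (sigmainv i) r <= C) &
      (forall r, 0 < r -> forall i,
         Gam isSum g (fun j => sigma j r) i < sigma i r)].

Definition Linf_norm m (u : R -> 'rV[R]_m) : \bar R :=
  ess_sup (@lebesgue_measure R)
    (fun t => if 0 <= t then ((enorm (u t))%:E)%E else 0%E).

Definition admissible m (u : R -> 'rV[R]_m) : Prop :=
  (forall k, measurable_fun [set t : R | 0 <= t] (fun t => u t 0 k)) /\
  (Linf_norm u < +oo)%E.

Definition is_solution k m (F : 'rV[R]_k -> 'rV[R]_m -> 'rV[R]_k)
    (u : R -> 'rV[R]_m) (x : R -> 'rV[R]_k) (T : R) : Prop :=
  forall j : 'I_k,
    (@lebesgue_measure R).-integrable `[0, T]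
       (fun s => ((F (x s) (u s)) 0 j)%:E) /\
    forall t, 0 <= t <= T ->
      x t 0 j = x 0 0 j + \int[@lebesgue_measure R]_(s in `[0, t]) (F (x s) (u s)) 0 j.

Definition ISS k m (F : 'rV[R]_k -> 'rV[R]_m -> 'rV[R]_k) : Prop :=
  exists beta gam, [/\ isKL beta, isK gam &
    forall x0 u, admissible u ->
      (exists x, x 0 = x0 /\ forall T, 0 <= T -> is_solution F u x T) /\
      (forall x T, 0 <= T -> x 0 = x0 -> is_solution F u x T ->
         forall t, 0 <= t <= T ->
           enorm (x t) <= beta (enorm x0) t + gam (fine (Linf_norm u)))].

Definition interconnect n (N m : 'I_n -> nat)
    (f : forall i, 'rV[R]_(\sum_(j < n) N j) -> 'rV[R]_(m i) -> 'rV[R]_(N i))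
    (x : 'rV[R]_(\sum_(j < n) N j)) (u : 'rV[R]_(\sum_(j < n) m j))
    : 'rV[R]_(\sum_(j < n) N j) :=
  mxrow (fun i => f i x (submxrow u i)).

End Defs.

(* Main.v *)
(** A path in the decay set of [Gam] is obtained without a topological fixed point theorem.  Staged
    elimination of indices shows that [z <= max (A z) c] forces [z <= C c] for some [C] in
    K-infinity, where [A] is [Gam] enlarged on the summation rows.  Hence [T z = max (A z)
    (eps (vmax z))] has arbitrarily large decay points, and a compactness argument on the
    backward orbits of [z |-> (z + T z) / 2] gives a chain of decay points [c k], [k] in Z,
    from [0] to infinity with [T (c (k + 1)) <= c k]; the path [sigma] interpolates it
    linearly.

    For the max-type function, differentiability of [V] at a point says nothing about the
    active [V i], so the decrease of [V i] at its points of differentiability is integrated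
    into a decrease of increments: a locally Lipschitz function whose directional derivative
    is at most [a] wherever it is differentiable grows at most with slope [a] in that direction
    (Rademacher and Fubini).

    The same mean value inequality, in the averaged direction of a Caratheodory solution, gives
    a Dini inequality for [V] along solutions for merely measurable inputs; comparison yields
    the KL estimate, and Picard iteration for a cut-off system the existence. *)
Require Import Defs.
From HB Require Import structures.
From mathcomp Require Import all_boot all_order all_algebra.
From mathcomp Require Import all_classical all_reals all_analysis.
From mathcomp Require Import measurable_realfun ess_sup_inf.
From mathcomp Require Import ring lra zify.
Set Implicit Arguments. Unset Strict Implicit. Unset Printing Implicit Defensive.
Import Order.TTheory GRing.Theory Num.Theory.
Import numFieldNormedType.Exports.
Local Open Scope classical_set_scope.
Local Open Scope ring_scope.

(** * Comparison functions *)

(** Gains may vanish, so [Gam] can decouple the coordinates, and decay points for it alone may stay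
    bounded, or collapse to [0], in some of them. The term [eps (vmax z)] in every row bounds all
    coordinates below in terms of the largest one; calibrated by [C (eps r) = r / 2], it is too weak
    to create a nonzero fixed point. The margin [alpha] is lowered to a 1-Lipschitz function, which
    preserves the small-gain condition and puts a linear price on shifting its argument; this price
    is what the elimination of indices can pay. The half of [alpha] kept inside [Amap] survives
    along the path and becomes room for inputs, that is [phi]. Rademacher's theorem is proved over
    an abstract parameter space, an iterated product with the line, in place of Lebesgue measure on
    row vectors, so that Fubini adds one coordinate at a time. Along trajectories the input enters
    only through a bound [r], thanks to the Lipschitz constant of the right-hand side that is
    uniform over inputs bounded by [r]. *)

Section Comparison.
Variable R : realType.
Implicit Types (g h : R -> R) (a b c d e r s t u x y : R).

(** [Num.max x 0] retracts the line onto the half-line, so continuity for the subspace topology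
    becomes plain continuity of a composite, to which the usual rules apply. *)
Lemma within_RnnP g : {within @Rnn R, continuous g} <->
  continuous (fun x : R => g (Num.max x 0)).
Proof.
split=> [cg|cg].
- have cm : continuous (fun x : R => Num.max x 0).
    by move=> x; apply: continuous_max; [exact: cvg_id|exact: cvg_cst].
  move=> x; apply: (@cvg_comp _ _ _ (fun x : R => Num.max x 0) g _
     (within (@Rnn R) (nbhs (Num.max x 0)))).
  + move=> B wB.
    have H : nbhs x [set y : R | Rnn (Num.max y 0) -> B (Num.max y 0)] := cm x _ wB.
    by apply: filterS H => y; apply; rewrite /Rnn /= le_max lexx orbT.
  + move/subspace_continuousP: cg; apply.
    by rewrite /Rnn /= le_max lexx orbT.
- apply: (@subspace_eq_continuous _ _ _ (fun x : R => g (Num.max x 0))).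
    by move=> x; rewrite inE /Rnn /= => x0; rewrite max_l.
  exact: continuous_subspaceT.
Qed.

Lemma isK_le g a b : isK g -> 0 <= a -> a <= b -> g a <= g b.
Proof.
move=> [_ _ _ gi] a0; rewrite le_eqVlt => /predU1P[->//|ab].
by apply: ltW; exact: gi.
Qed.

Lemma isK_ge0 g r : isK g -> 0 <= r -> 0 <= g r.
Proof. by case=> _ _ + _; exact. Qed.

Lemma isK_gt0 g r : isK g -> 0 < r -> 0 < g r.
Proof. by move=> [g0 _ _ gi] r0; rewrite -g0; apply: gi. Qed.

Lemma isK_lt g a b : isK g -> 0 <= a -> 0 <= b -> (g a < g b) = (a < b).
Proof.
move=> Kg a0 b0; apply/idP/idP => [|ab]; last by case: Kg => _ _ _; apply.
by apply: contraTT; rewrite -!leNgt => ba; exact: isK_le.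
Qed.

Lemma isK_leE g a b : isK g -> 0 <= a -> 0 <= b -> (g a <= g b) = (a <= b).
Proof. by move=> Kg a0 b0; rewrite !leNgt (isK_lt Kg). Qed.

Lemma isK_continuous_max g : isK g -> continuous (fun x : R => g (Num.max x 0)).
Proof. by case=> _ /within_RnnP. Qed.

Lemma isK_delta g r e : isK g -> 0 <= r -> 0 < e -> exists2 d, 0 < d &
  forall y, 0 <= y -> `|y - r| < d -> `|g y - g r| < e.
Proof.
move=> Kg r0 e0; have /cvgrPdist_lt/(_ _ e0) := @isK_continuous_max _ Kg r.
rewrite (max_l r0) => /nbhs_ballP[d /= d0 H]; exists d => // y y0 yr.
by have := H y; rewrite (max_l y0) distrC; apply; rewrite /ball/= distrC.
Qed.

Lemma isKinf_surj g y : isKinf g -> 0 <= y -> exists2 x, 0 <= x & g x = y.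
Proof.
move=> [Kg gM] y0; have [b b0 yb] := gM y.
have := @IVT R (fun x : R => g (Num.max x 0)) 0 b y b0.
case.
- by apply: continuous_subspaceT; exact: isK_continuous_max.
- rewrite maxxx (max_l b0); case: Kg => -> _ gp _.
  by rewrite ge_min y0 /= le_max yb orbT.
- move=> c; rewrite in_itv /= => /andP[c0 _] <-; exists c => //.
  by rewrite (max_l c0).
Qed.

(** A monotone function that omits no value has no jump. Inverses, scalings and piecewise linear
    functions enter K-infinity through this criterion. *)
Lemma isKinf_of_surj g : (forall r, 0 <= r -> 0 <= g r) ->
  (forall a b, 0 <= a -> a < b -> g a < g b) ->
  (forall y, 0 <= y -> exists2 x, 0 <= x & g x = y) -> isKinf g.
Proof.
move=> gp gi gs.
have gle a b : 0 <= a -> a <= b -> g a <= g b.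
  by move=> a0; rewrite le_eqVlt => /predU1P[->//|ab]; exact/ltW/gi.
have gltE a b : 0 <= a -> 0 <= b -> g a < g b -> a < b.
  by move=> a0 b0; apply: contraTT; rewrite -!leNgt; exact: gle.
have g0 : g 0 = 0.
  have [x x0 gx] := gs 0 (lexx _).
  by apply/le_anti; rewrite gp// andbT -{2}gx gle.
split; last first.
  move=> M; have [x x0 gx] := gs (Num.max M 0) ltac:(by rewrite le_max lexx orbT).
  by exists x => //; rewrite gx le_max lexx.
split => //; apply/within_RnnP => x.
apply/cvgrPdist_lt => e e0; set m := Num.max x 0.
have m0 : 0 <= m by rewrite le_max lexx orbT.
have gm0 := gp _ m0.
have [u u0 gu] := gs (g m + e / 2) ltac:(by rewrite addr_ge0// divr_ge0// ltW).
have mu : m < u by apply: gltE => //; rewrite gu ltrDl divr_gt0.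
(* If [e <= g m], the preimage of [g m - e / 2] is a left neighbour of [m]. Otherwise [g m - e] is
   negative and [l = 0] serves, which leaves the boundary case [m = 0]. *)
have [l l0 [lm H]] : exists2 l, 0 <= l & (l < m \/ m = 0) /\
   forall y, l <= y -> 0 <= y -> g m - e < g y.
  have [em|em] := leP e (g m).
    have [l l0 gl] := gs (g m - e / 2) ltac:(lra).
    exists l => //; split.
      by left; apply: gltE => //; rewrite gl ltrBlDr ltrDl divr_gt0.
    move=> y ly y0; apply: (@lt_le_trans _ _ (g l)); first by rewrite gl; lra.
    exact: gle.
  exists 0 => //; split.
    move: m0; rewrite le_eqVlt => /predU1P[<-|]; by [right|left].
  by move=> y _ y0; apply: (@lt_le_trans _ _ 0); [lra|exact: gp].
have key : \forall y \near x, (m = 0 \/ l < Num.max y 0) /\ Num.max y 0 < u.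
  have xu : x < u by apply: le_lt_trans mu; rewrite le_max lexx.
  have u0' : 0 < u by exact: le_lt_trans mu.
  case: lm => [lm|m00].
    have lx : l < x.
      by move: lm; rewrite lt_max => /orP[//|/(le_lt_trans l0)]; rewrite ltxx.
    near=> y; split; first right.
      by rewrite lt_max; apply/orP; left; near: y; exact: lt_nbhsr.
    by rewrite gt_max u0' andbT; near: y; exact: lt_nbhsl.
  near=> y; split; first by left.
  by rewrite gt_max u0' andbT; near: y; exact: lt_nbhsl.
near=> y; have [|ly yu] := near key y; first by [].
have y0 : 0 <= Num.max y 0 by rewrite le_max lexx orbT.
have gyu : g (Num.max y 0) < g m + e by apply: (lt_trans (gi _ _ y0 yu)); rewrite gu; lra.
rewrite ltr_distlC; apply/andP; split; last by [].
case: ly => [m00|ly]; last by apply: H => //; exact: ltW.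
rewrite m00 g0; apply: (@lt_le_trans _ _ 0); [lra|exact: gp].
Unshelve. all: by end_near. Qed.

Lemma isKinf_inv g : isKinf g -> exists2 gv, isKinf gv &
  forall r, 0 <= r -> gv (g r) = r /\ g (gv r) = r.
Proof.
move=> Ig; have Kg := Ig.1.
have /choice[gv gvP] : forall y, exists x, 0 <= y -> 0 <= x /\ g x = y.
  move=> y; have [y0|] := boolP (0 <= y); last by exists 0.
  by have [x x0 gx] := isKinf_surj Ig y0; exists x.
have g0 r : 0 <= r -> 0 <= g r by case: Kg => _ _ + _; exact.
have gvK r : 0 <= r -> gv (g r) = r.
  move=> r0; have [v0 gvr] := gvP _ (g0 _ r0).
  by apply/le_anti; rewrite -(isK_leE Kg v0 r0) -(isK_leE Kg r0 v0) gvr lexx.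
exists gv; last by move=> r r0; split; [exact: gvK|exact: (gvP _ r0).2].
apply: isKinf_of_surj => [r r0|a b a0 ab|y y0]; first exact: (gvP _ r0).1.
  have b0 := le_trans a0 (ltW ab); have [? ga] := gvP _ a0; have [? gb] := gvP _ b0.
  by rewrite -(isK_lt Kg)// ga gb.
by exists (g y); [exact: g0|exact: gvK].
Qed.

Lemma isKinf_id : isKinf (@id R).
Proof.
by apply: isKinf_of_surj => // y y0; exists y.
Qed.

Lemma isK_comp g h : isK g -> isK h -> isK (g \o h).
Proof.
move=> Kg Kh; have cg := isK_continuous_max Kg; have ch := isK_continuous_max Kh.
have [g0 _ gp gi] := Kg; have [h0 _ hp hi] := Kh.
split => /=; [by rewrite h0| |by move=> r r0; exact/gp/hp| ].
- apply/within_RnnP => x; rewrite /=.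
  have -> : (fun x : R => g (h (Num.max x 0))) =
    (fun x : R => g (Num.max x 0)) \o (fun x : R => h (Num.max x 0)).
    by apply/funext => y /=; rewrite (max_l (hp _ _))// le_max lexx orbT.
  by apply: continuous_comp; [exact: ch|exact: cg].
- by move=> a b a0 ab; apply: gi; [exact: hp|exact: hi].
Qed.

Lemma isKinf_comp g h : isKinf g -> isKinf h -> isKinf (g \o h).
Proof.
move=> Ig Ih; split; first exact: isK_comp Ig.1 Ih.1.
move=> M; have [y y0 My] := Ig.2 M; have [x x0 xy] := isKinf_surj Ih y0.
by exists x => //=; rewrite xy.
Qed.

Lemma isKD g h : isK g -> isK h -> isK (fun r => g r + h r).
Proof.
move=> Kg Kh; have cg := isK_continuous_max Kg; have ch := isK_continuous_max Kh.
have [g0 _ gp gi] := Kg; have [h0 _ hp hi] := Kh.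
split; [by rewrite g0 h0 addr0| |by move=> r r0; rewrite addr_ge0// ?gp ?hp| ].
- by apply/within_RnnP => x; apply: continuousD; [exact: cg|exact: ch].
- by move=> a b a0 ab; rewrite ltrD// ?gi ?hi.
Qed.

Lemma isKinfDl g h : isKinf g -> isK h -> isKinf (fun r => g r + h r).
Proof.
move=> Ig Kh; split; first exact: isKD Ig.1 Kh.
move=> M; have [r r0 Mr] := Ig.2 M; exists r => //.
by rewrite (le_trans Mr)// lerDl (isK_ge0 Kh).
Qed.

Lemma isKinfM_cst g c : isKinf g -> 0 < c -> isKinf (fun r => c * g r).
Proof.
move=> Ig c0; apply: isKinf_of_surj => [r r0|a b a0 ab|y y0].
- by rewrite mulr_ge0 ?(ltW c0) ?(isK_ge0 Ig.1).
- by rewrite ltr_pM2l// (isK_lt Ig.1)// (le_trans a0)// ltW.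
- have [x x0 xy] := isKinf_surj Ig (divr_ge0 y0 (ltW c0)); exists x => //.
  by rewrite xy mulrC divfK// gt_eqF.
Qed.

Lemma isKinf_scale c : 0 < c -> isKinf (fun r : R => c * r).
Proof. exact: (isKinfM_cst isKinf_id). Qed.

Lemma isKinf_min g h : isKinf g -> isKinf h -> isKinf (fun r => Num.min (g r) (h r)).
Proof.
move=> Ig Ih; have cg := isK_continuous_max Ig.1; have ch := isK_continuous_max Ih.1.
have [g0 _ gp gi] := Ig.1; have [h0 _ hp hi] := Ih.1.
split; first split.
- by rewrite g0 h0 minxx.
- by apply/within_RnnP => x; apply: continuous_min; [exact: cg|exact: ch].
- by move=> r r0; rewrite le_min gp ?hp.
- by move=> a b a0 ab; rewrite lt_min !gt_min gi// hi// orbT.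
- move=> M; have [r r0 rM] := Ig.2 M; have [s s0 sM] := Ih.2 M.
  exists (Num.max r s); first by rewrite le_max r0.
  rewrite le_min (le_trans rM) ?(le_trans sM)//.
    by apply: (isK_le Ih.1) => //; rewrite le_max lexx orbT.
  by apply: (isK_le Ig.1) => //; rewrite le_max lexx.
Qed.

Lemma isKinf_max g h : isKinf g -> isKinf h -> isKinf (fun r => Num.max (g r) (h r)).
Proof.
move=> Ig Ih; have cg := isK_continuous_max Ig.1; have ch := isK_continuous_max Ih.1.
have [g0 _ gp gi] := Ig.1; have [h0 _ hp hi] := Ih.1.
split; first split.
- by rewrite g0 h0 maxxx.
- by apply/within_RnnP => x; apply: continuous_max; [exact: cg|exact: ch].
- by move=> r r0; rewrite le_max gp.
- by move=> a b a0 ab; rewrite gt_max !lt_max gi// hi// orbT.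
- move=> M; have [r r0 rM] := Ig.2 M; exists r => //.
  by rewrite le_max rM.
Qed.

(** * Lipschitz regularisation by infimal convolution *)

(** The Pasch-Hausdorff envelope of [m] over the positive half-line, its largest 1-Lipschitz
    minorant there. Leaving out [t = 0] lets [m] be controlled only on compact subsets of the
    positive half-line, while the envelope still has a value at [0]. *)
Definition infconv (m : R -> R) (s : R) : R := inf [set m t + `|s - t| | t in [set t | 0 < t]].

Section Infconv.
Variable m : R -> R.
Hypothesis m0 : forall t, 0 < t -> 0 <= m t.

Let lb s : has_inf [set m t + `|s - t| | t in [set t | 0 < t]].
Proof.
split; first by exists (m 1 + `|s - 1|), 1; rewrite //=.
by exists 0 => _ [t /= t0 <-]; rewrite addr_ge0// m0.
Qed.

Lemma infconv_le s t : 0 < t -> infconv m s <= m t + `|s - t|.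
Proof. by move=> t0; apply: ge_inf; [exact: (lb s).2|exists t]. Qed.

Lemma infconv_ge s c : (forall t, 0 < t -> c <= m t + `|s - t|) -> c <= infconv m s.
Proof.
move=> H; apply: lb_le_inf; first exact: (lb s).1.
by move=> _ [t t0 <-]; exact: H.
Qed.

Lemma infconv_lip s t : `|infconv m s - infconv m t| <= `|s - t|.
Proof.
have H a b : infconv m a - infconv m b <= `|a - b|.
  rewrite lerBlDr addrC -lerBlDr; apply: infconv_ge => u u0.
  rewrite lerBlDr; apply: (le_trans (infconv_le a u0)).
  rewrite -addrA lerD2l addrC (_ : a - u = (a - b) + (b - u)) ?ler_normD//; ring.
by rewrite ler_norml H andbT lerNl opprB distrC H.
Qed.

(** A competitor [t] outside [[s / 2, 2 * s]] pays at least [s / 2] in distance; inside, [m] has a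
    positive lower bound. *)
Lemma infconv_gt0 s : 0 < s ->
  (forall a b, 0 < a -> a <= b -> exists2 c, 0 < c & forall t, a <= t <= b -> c <= m t) ->
  0 < infconv m s.
Proof.
move=> s0 /(_ (s / 2) (2 * s))[||c c0 H]; [lra|lra|].
apply: (@lt_le_trans _ _ (Num.min c (s / 2))); first by rewrite lt_min c0/=; lra.
apply: infconv_ge => t t0; rewrite ge_min.
have [/andP[ht ts]|] := boolP (s / 2 <= t <= 2 * s).
  by rewrite (le_trans (H t _))// ?ht// lerDl.
have h1 := ler_norm (s - t); have h2 := ler_norm (t - s); rewrite distrC in h2.
have h3 := m0 t0.
by rewrite negb_and -!ltNge => /orP[h|h]; apply/orP; right; lra.
Qed.

Lemma infconv_nondecr s t : 0 < s ->
  (forall a b, 0 < a -> a <= b -> m a <= m b) -> s <= t -> infconv m s <= infconv m t.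
Proof.
move=> s0 mm st; apply: infconv_ge => u u0.
have [us|su] := leP u s.
  apply: (le_trans (infconv_le _ u0)); rewrite lerD2l !ger0_norm; lra.
apply: (le_trans (infconv_le s s0)).
by rewrite subrr normr0 addr0 (le_trans (mm _ _ s0 (ltW su)))// lerDl.
Qed.

Lemma infconv_nonincr s t : 0 < t ->
  (forall a b, 0 < a -> a <= b -> m b <= m a) -> s <= t -> infconv m t <= infconv m s.
Proof.
move=> t0 mm st; apply: infconv_ge => u u0.
have [ut|tu] := leP u t.
  apply: (le_trans (infconv_le t t0)).
  by rewrite subrr normr0 addr0 (le_trans (mm _ _ u0 ut))// lerDl.
by apply: (le_trans (infconv_le _ u0)); rewrite lerD2l !ler0_norm; lra.
Qed.

Lemma infconv_continuous : continuous (infconv m).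
Proof.
move=> s; apply/cvgrPdist_lt => e e0; near=> t.
apply: (le_lt_trans (infconv_lip s t)).
by near: t; apply/nbhs_ballP; exists e.
Unshelve. all: by end_near. Qed.

Lemma infconv_ge0 s : 0 <= infconv m s.
Proof. by apply: infconv_ge => t t0; rewrite addr_ge0// m0. Qed.

Lemma infconv0 : (forall e, 0 < e -> exists2 t, 0 < t <= e & m t <= e) ->
  infconv m 0 = 0.
Proof.
move=> H; apply/le_anti; rewrite infconv_ge0 andbT.
apply/ler_addgt0Pr => e e0; rewrite add0r.
have [t /andP[t0 te] mt] := H (e / 2) ltac:(lra).
apply: (le_trans (infconv_le 0 t0)); rewrite sub0r normrN gtr0_norm//; lra.
Qed.

End Infconv.

Lemma continuous_within_Rnn g : continuous g -> {within @Rnn R, continuous g}.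
Proof. exact: continuous_subspaceT. Qed.

(** Meant for the margin [alpha] of the small-gain condition, which remains valid when [alpha]
    decreases. *)
Lemma isKinf_lip1_minorant g : isKinf g -> exists2 h, isKinf h &
  (forall r, 0 <= r -> h r <= g r) /\ forall r s, `|h r - h s| <= `|r - s|.
Proof.
move=> Ig; have Kg := Ig.1.
have gp t : 0 < t -> 0 <= g t by move=> /ltW; exact: isK_ge0.
have gm (a b : R) : 0 < a -> a <= b -> g a <= g b by move=> /ltW; exact: isK_le.
have i0 : infconv g 0 = 0.
  apply: infconv0 => // e e0.
  have [g0 _ _ _] := Kg.
  have [d d0 H] := @isK_delta g 0 e Kg (lexx _) e0.
  exists (Num.min (d / 2) e); first by rewrite lt_min e0 ge_min lexx orbT !andbT; lra.
  have m0 : 0 < Num.min (d / 2) e by rewrite lt_min e0 andbT; lra.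
  have := H (Num.min (d / 2) e) (ltW m0); rewrite subr0 (gtr0_norm m0) g0 subr0.
  have md : Num.min (d / 2) e < d by rewrite gt_min; apply/orP; left; lra.
  by move=> /(_ md)/ltW; exact: le_trans (ler_norm _).
exists (infconv g); last first.
  split; last by move=> r s; exact: infconv_lip.
  move=> r; rewrite le_eqVlt => /predU1P[<-|r0]; first by rewrite i0 (isK_ge0 Kg).
  by apply: (le_trans (infconv_le gp r r0)); rewrite subrr normr0 addr0.
split.
  split => //.
  - by apply/continuous_within_Rnn/infconv_continuous.
  - by move=> r _; exact: infconv_ge0.
  - move=> r r'; rewrite le_eqVlt => /predU1P[<- r'0|r0 rr'].
      rewrite i0; apply: infconv_gt0 => // a b a0 ab.
      by exists (g a); [exact: isK_gt0|move=> t /andP[at_ _]; exact: gm].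
    have ir : infconv g r <= g r.
      by apply: (le_trans (infconv_le gp r r0)); rewrite subrr normr0 addr0.
    pose mid := (r + r') / 2.
    have gmid : g r < g mid by rewrite (isK_lt Kg) /mid; lra.
    (* A competitor [t] is left of [r], hence farther from [r'] than from [r] by [r' - r]; or
       between [r] and [mid], at distance at least [r' - mid] from [r']; or beyond [mid], where [g]
       has grown by [g mid - g r]. *)
    pose gap := Num.min (r' - mid) (g mid - g r).
    have gap0 : 0 < gap by rewrite lt_min /mid; apply/andP; split; lra.
    have [gap1 gap2] : gap <= r' - mid /\ gap <= g mid - g r.
      by split; rewrite ge_min lexx ?orbT.
    apply: (@lt_le_trans _ _ (infconv g r + gap)); first by rewrite ltrDl.
    apply: infconv_ge => // t t0.
    have [tr|rt] := leP t r.
      have e1 : `|r - t| = r - t by rewrite ger0_norm; lra.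
      have e2 : `|r' - t| = r' - t by rewrite ger0_norm; lra.
      by have := infconv_le gp r t0; rewrite e1 e2; move: gap1; rewrite /mid; lra.
    have [tm|mt] := leP t mid.
      have := ler_norm (r' - t); have := gm _ _ r0 (ltW rt).
      by move: gap1 tm; rewrite /mid; lra.
    have mid0 : 0 < mid by rewrite /mid; lra.
    have := gm _ _ mid0 (ltW mt); have := normr_ge0 (r' - t); lra.
- move=> M; have [r r0 Mr] := Ig.2 (Num.max M 0).
  have [M1 M0] : M <= Num.max M 0 /\ 0 <= Num.max M 0 by rewrite !le_max !lexx orbT.
  (* A competitor below half of this point pays the other half, at least [M], in distance; above it
     [g] is at least [g r], hence at least [M]. *)
  exists (2 * (r + Num.max M 1)); first by rewrite mulr_ge0// addr_ge0// le_max ler01 orbT.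
  have M2 : 1 <= Num.max M 1 by rewrite le_max lexx orbT.
  have M3 : M <= Num.max M 1 by rewrite le_max lexx.
  apply: infconv_ge => // t t0.
  have [tr|rt] := leP t (r + Num.max M 1).
    have := gp _ t0; have := ler_norm (2 * (r + Num.max M 1) - t); lra.
  have gr : g r <= g t by apply: (isK_le Kg) => //; lra.
  have := normr_ge0 (2 * (r + Num.max M 1) - t); lra.
Qed.

(** Capping [m] by the identity forces the envelope to vanish at [0]; the lower bounds on compact
    intervals keep it positive elsewhere. *)
Lemma isPD_minorant (m : R -> R) :
  (forall a b, 0 < a -> a <= b -> exists2 c, 0 < c & forall t, a <= t <= b -> c <= m t) ->
  exists2 rho, isPD rho & forall t, 0 < t -> rho t <= m t.
Proof.
move=> mP; pose m' t := Num.min (m t) t.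
have mpos t : 0 < t -> 0 < m t.
  move=> t0; have [c c0 H] := mP t t t0 (lexx _).
  by apply: (lt_le_trans c0); apply: H; rewrite lexx.
have m'p t : 0 < t -> 0 <= m' t by move=> t0; rewrite le_min !ltW// mpos.
have i0 : infconv m' 0 = 0.
  by apply: infconv0 => // e e0; exists e; rewrite ?e0 ?lexx// ge_min lexx orbT.
have ip r : 0 < r -> 0 < infconv m' r.
  move=> r0; apply: infconv_gt0 => // a b a0 ab; have [c c0 H] := mP a b a0 ab.
  exists (Num.min c a); first by rewrite lt_min c0.
  by move=> t /andP[at_ tb]; rewrite le_min !ge_min (H t) ?at_ ?orbT.
exists (infconv m'); last first.
  move=> t t0; apply: (le_trans (infconv_le m'p t t0)).
  by rewrite subrr normr0 addr0 ge_min lexx.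
split; first by apply/continuous_within_Rnn/infconv_continuous.
move=> r r0; split; first exact: infconv_ge0.
split=> [ir|->//]; apply/eqP; apply: contraTT isT => rn0.
by have := ip r; rewrite lt_def rn0 r0 ir ltxx => /(_ isT).
Qed.

(** The envelope is positive and nondecreasing; the factor [t / (1 + t)] makes it strictly
    increasing and zero at [0] without raising it. *)
Lemma isK_minorant (m : R -> R) : (forall t, 0 < t -> 0 < m t) ->
  (forall a b, 0 < a -> a <= b -> m a <= m b) ->
  exists2 kap, isK kap & forall t, 0 < t -> kap t <= m t.
Proof.
move=> mp mm; have mp' t : 0 < t -> 0 <= m t by move=> /mp/ltW.
have ip r : 0 < r -> 0 < infconv m r.
  move=> r0; apply: infconv_gt0 => // a b a0 ab.
  by exists (m a); [exact: mp|move=> t /andP[at_ _]; exact: mm].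
have ile t : 0 < t -> infconv m t <= m t.
  by move=> t0; apply: (le_trans (infconv_le mp' t t0)); rewrite subrr normr0 addr0.
pose k t := infconv m t * (t / (1 + t)).
have k1 t : 0 < t -> 0 < t / (1 + t) < 1.
  by move=> t0; rewrite divr_gt0 ?ltr_pdivrMr ?mul1r//; lra.
have i0 t : 0 <= infconv m t by exact: infconv_ge0.
exists k; last first.
  move=> t t0; have /andP[h1 h2] := k1 t t0; apply: le_trans (ile t t0).
  by rewrite /k ler_piMr// ltW.
split.
- by rewrite /k mul0r mulr0.
- apply/within_RnnP => x; rewrite /k.
  apply: (@continuousM _ _ (fun x : R => infconv m (Num.max x 0))
    (fun x : R => Num.max x 0 / (1 + Num.max x 0))).
    apply: (@continuous_comp _ _ _ (fun x : R => Num.max x 0) (infconv m)).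
      by apply: continuous_max; [exact: cvg_id|exact: cvg_cst].
    exact: infconv_continuous.
  have cm : {for x, continuous (fun x : R => Num.max x 0)}.
    by apply: continuous_max; [exact: cvg_id|exact: cvg_cst].
  apply: (@continuousM _ _ (fun x : R => Num.max x 0)
    (fun x : R => (1 + Num.max x 0)^-1)) => //.
  apply: (@continuousV _ _ (fun x : R => 1 + Num.max x 0)).
    by rewrite gt_eqF// ltr_pwDl// le_max lexx orbT.
  by apply: continuousD; [exact: cvg_cst|exact: cm].
- by move=> r r0; rewrite /k mulr_ge0// divr_ge0// addr_ge0.
- move=> a b; rewrite le_eqVlt => /predU1P[<- b0|a0 ab].
    rewrite /k mul0r mulr0 mulr_gt0 ?ip//.
    by have /andP[] := k1 b b0.
  have b0 := lt_trans a0 ab.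
  rewrite /k; apply: (@le_lt_trans _ _ (infconv m b * (a / (1 + a)))).
    rewrite ler_wpM2r//; first by have /andP[/ltW] := k1 a a0.
    by apply: infconv_nondecr => //; exact: ltW.
  rewrite ltr_pM2l ?ip// ltr_pdivrMr ?ltr_wpDr//; last lra.
  rewrite mulrAC ltr_pdivlMr; lra.
Qed.

End Comparison.

(** * The Euclidean norm *)

Section EuclideanNorm.
Variable R : realType.

Section Basics.
Variable k : nat.
Implicit Types (v w x y : 'rV[R]_k) (a b : R).

Lemma enorm_ge0 v : 0 <= enorm v.
Proof. exact: sqrtr_ge0. Qed.

Lemma enorm_sqr v : enorm v ^+ 2 = \sum_(j < k) v 0 j ^+ 2.
Proof. by rewrite sqr_sqrtr// sumr_ge0// => j _; exact: sqr_ge0. Qed.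

Lemma enorm0 : enorm (0 : 'rV[R]_k) = 0.
Proof. by rewrite /enorm big1 ?sqrtr0// => j _; rewrite mxE expr0n. Qed.

Lemma enormZ a v : enorm (a *: v) = `|a| * enorm v.
Proof.
rewrite /enorm; under eq_bigr do rewrite mxE exprMn.
by rewrite -mulr_sumr sqrtrM ?sqr_ge0// sqrtr_sqr.
Qed.

Lemma enormN v : enorm (- v) = enorm v.
Proof. by rewrite -scaleN1r enormZ normrN1 mul1r. Qed.

Lemma enormBC v w : enorm (v - w) = enorm (w - v).
Proof. by rewrite -enormN opprB. Qed.

Lemma coord_le_enorm v j : `|v 0 j| <= enorm v.
Proof.
rewrite -sqrtr_sqr ler_sqrt ?sumr_ge0// => [|i _]; last exact: sqr_ge0.
by rewrite (bigD1 j)//= lerDl sumr_ge0// => i _; exact: sqr_ge0.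
Qed.

Lemma enorm_eq0 v : enorm v = 0 -> v = 0.
Proof.
move=> v0; apply/rowP => j; rewrite mxE; apply/eqP.
by rewrite -normr_le0 -v0 coord_le_enorm.
Qed.

Lemma enorm_gt0 v : (0 < enorm v) = (v != 0).
Proof.
rewrite lt_def enorm_ge0 andbT; apply/idP/idP; apply: contra => /eqP.
  by move=> ->; rewrite enorm0.
by move=> /enorm_eq0 ->.
Qed.

Lemma cauchy_schwarz v w : `|\sum_(j < k) v 0 j * w 0 j| <= enorm v * enorm w.
Proof.
rewrite -(ler_sqr _ _) ?nnegrE ?normr_ge0 ?mulr_ge0 ?enorm_ge0// real_normK ?num_real//.
rewrite exprMn; have [->|v0] := eqVneq v 0.
  by rewrite enorm0 expr0n/= mul0r big1 ?expr0n// => j _; rewrite mxE mul0r.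
rewrite !enorm_sqr; set A := \sum_j v 0 j ^+ 2; set C := \sum_j w 0 j ^+ 2.
set B := \sum_j _.
have A0 : 0 < A by rewrite /A -enorm_sqr exprn_gt0// enorm_gt0.
(* This sum of squares equals [A * (A * C - B ^+ 2)], and [A] is positive. *)
have H : 0 <= \sum_j (B * v 0 j - A * w 0 j) ^+ 2.
  by apply: sumr_ge0 => j _; exact: sqr_ge0.
have e : \sum_j (B * v 0 j - A * w 0 j) ^+ 2 = B ^+ 2 * A - 2 * A * B * B + A ^+ 2 * C.
  transitivity (\sum_j (B ^+ 2 * v 0 j ^+ 2 - 2 * A * B * (v 0 j * w 0 j)
      + A ^+ 2 * w 0 j ^+ 2)); first by apply: eq_bigr => j _; ring.
  by rewrite big_split /= sumrB -!mulr_sumr.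
by rewrite e in H; rewrite -(ler_pM2l A0); move: H; rewrite !expr2; lra.
Qed.

Lemma enorm_triangle v w : enorm (v + w) <= enorm v + enorm w.
Proof.
rewrite -(ler_sqr _ _) ?nnegrE ?enorm_ge0 ?addr_ge0 ?enorm_ge0//.
rewrite sqrrD !enorm_sqr.
have -> : \sum_j (v + w) 0 j ^+ 2 =
    \sum_j v 0 j ^+ 2 + (\sum_j v 0 j * w 0 j) *+ 2 + \sum_j w 0 j ^+ 2.
  rewrite -sumrMnl -!big_split /=; apply: eq_bigr => j _; rewrite mxE sqrrD; ring.
rewrite lerD2r lerD2l lerMn2r /=.
exact: le_trans (ler_norm _) (cauchy_schwarz v w).
Qed.

Lemma enorm_dist v w x : enorm (v - x) <= enorm (v - w) + enorm (w - x).
Proof. by rewrite -(subrKA w) enorm_triangle. Qed.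

Lemma ler_enormB v w : `|enorm v - enorm w| <= enorm (v - w).
Proof.
have H x y : enorm x - enorm y <= enorm (x - y).
  by rewrite lerBlDr -{1}(subrK y x) enorm_triangle.
by rewrite ler_norml H andbT lerNl opprB enormBC H.
Qed.

Lemma enorm_le_sum v : enorm v <= \sum_(j < k) `|v 0 j|.
Proof.
have S0 : 0 <= \sum_(j < k) `|v 0 j| by apply: sumr_ge0.
rewrite -(ler_sqr _ _) ?nnegrE ?enorm_ge0// enorm_sqr expr2 mulr_suml.
apply: ler_sum => j _; rewrite -real_normK ?num_real// expr2 ler_wpM2l//.
by rewrite (bigD1 j)//= lerDl sumr_ge0.
Qed.

Lemma mx_norm_le_enorm v : `|v| <= enorm v.
Proof.
rewrite [`|v|]mx_normrE; apply/bigmax_leP; split; first exact: enorm_ge0.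
by move=> [i j] _ /=; rewrite ord1 coord_le_enorm.
Qed.

Lemma coord_le_mx_norm v j : `|v 0 j| <= `|v|.
Proof.
by rewrite [leRHS]mx_normrE; apply: (le_bigmax_cond _ (fun ij => `|v ij.1 ij.2|) (j := (0, j))).
Qed.

Lemma enorm_le_mx_norm v : enorm v <= k%:R * `|v|.
Proof.
apply: (le_trans (enorm_le_sum v)).
rewrite mulr_natl -[X in _ *+ X](card_ord k) -sumr_const.
by apply: ler_sum => j _; exact: coord_le_mx_norm.
Qed.

(** The topology of row vectors comes from the maximum norm. The two norms differ by at most a
    factor [k]; [k.+1] in the radius covers [k = 0]. *)
Lemma nbhs_enormP x (P : set 'rV[R]_k) :
  nbhs x P <-> exists2 d, 0 < d & forall y, enorm (y - x) < d -> P y.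
Proof.
split=> [/nbhs_ballP[d /= d0 H]|[d d0 H]].
  exists d => // y yx; apply: H; rewrite -ball_normE /= distrC.
  exact: le_lt_trans (mx_norm_le_enorm _) yx.
apply/nbhs_ballP; exists (d / k.+1%:R) => /=; first by rewrite divr_gt0// ltr0Sn.
move=> y; rewrite -ball_normE /= distrC => yx; apply: H.
apply: (le_lt_trans (enorm_le_mx_norm _)).
apply: (@le_lt_trans _ _ (k.+1%:R * `|y - x|)); first by rewrite ler_wpM2r// ler_nat.
by rewrite mulrC -ltr_pdivlMr// ltr0Sn.
Qed.

Lemma continuous_enorm : continuous (@enorm R k).
Proof.
move=> x; apply/(@cvgrPdist_lt _ _ _ (nbhs x) (nbhs_filter x)) => e e0.
apply/nbhs_enormP; exists e => // y yx.
by apply: (le_lt_trans (ler_enormB _ _)); rewrite enormBC.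
Qed.

Lemma enorm_ball_compact r : compact [set v : 'rV[R]_k | enorm v <= r].
Proof.
apply: bounded_closed_compact.
  exists r; split; first exact: num_real.
  by move=> M rM v /= vr; apply: (le_trans (mx_norm_le_enorm v)); apply: le_trans vr (ltW rM).
rewrite (_ : [set v | _] = @enorm R k @^-1` [set t | t <= r])//.
apply: closed_comp => [v _|]; first exact: continuous_enorm.
exact: closed_le.
Qed.

Definition dotr (p v : 'rV[R]_k) : R := \sum_(j < k) p 0 j * v 0 j.

Lemma dotr_is_linear p : linear (dotr p).
Proof.
move=> a v w; rewrite /dotr [X in _ = X + _]mulr_sumr -big_split /=.
by apply: eq_bigr => j _; rewrite !mxE mulrDr mulrCA.
Qed.

HB.instance Definition _ p :=
  GRing.isLinear.Build R 'rV[R]_k R _ (dotr p) (dotr_is_linear p).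

Lemma dotr_le p v : `|dotr p v| <= enorm p * enorm v.
Proof. exact: cauchy_schwarz. Qed.

Lemma differentiable_enormP (f : 'rV[R]_k -> R) x p :
  (forall e, 0 < e -> exists2 d, 0 < d & forall v, enorm v < d ->
     `|f (x + v) - f x - dotr p v| <= e * enorm v) ->
  differentiable f x.
Proof.
move=> H; apply/diffP; rewrite /diff.
have cp : continuous (dotr p).
  move=> v; apply/(@cvgrPdist_lt _ _ _ (nbhs v) (nbhs_filter v)) => e e0.
  have p1 : 0 < enorm p + 1 by rewrite ltr_wpDl// enorm_ge0.
  apply/nbhs_enormP; exists (e / (enorm p + 1)); first by rewrite divr_gt0.
  move=> w wv; rewrite -raddfB /=; apply: (le_lt_trans (dotr_le _ _)).
  rewrite enormBC; apply: (@le_lt_trans _ _ ((enorm p + 1) * enorm (w - v))).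
    by rewrite ler_wpM2r ?enorm_ge0// lerDl.
  by rewrite mulrC -ltr_pdivlMr.
apply: (getPex (P := fun df : {linear 'rV[R]_k -> R} => continuous df /\
  forall y, f y = f (lim (nbhs x)) + df (y - lim (nbhs x))
     +o_(y \near (nbhs x)) (y - lim (nbhs x)))).
exists (dotr p : {linear 'rV[R]_k -> R}); split => //.
rewrite lim_id //.
suff : f = (fun y => f x + dotr p (y - x)) +o_x (fun y => y - x) by rewrite funeqE.
apply/eqaddoP => e e0; have k0 : (0 : R) < k.+1%:R by rewrite ltr0Sn.
have [d d0 Hd] := H (e / k.+1%:R) (divr_gt0 e0 k0).
apply/nbhs_enormP; exists d => // y yx; have := Hd _ yx.
rewrite subrKC -addrA -opprD => /le_trans; apply.
rewrite mulrAC ler_pdivrMr// -mulrA ler_wpM2l ?(ltW e0)// mulrC.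
apply: (le_trans (enorm_le_mx_norm _)).
by rewrite ler_wpM2r// ler_nat.
Qed.

Lemma diff_quotient_cvg (f : 'rV[R]_k -> R) x v : differentiable f x ->
  h^-1 * (f (x + h *: v) - f x) @[h --> 0^'] --> 'd f x v.
Proof.
move=> dfx; rewrite -deriveE//.
have e : (fun h : R => h^-1 *: (f (h *: v + x) - f x)) =
  (fun h : R => h^-1 * (f (x + h *: v) - f x)) by apply/funext => h; rewrite [x + _]addrC.
by rewrite -e /derive; exact: (@diff_derivable _ _ _ f x v dfx).
Qed.

Lemma diff_enorm_le (f : 'rV[R]_k -> R) x L d v :
  0 < d -> (forall y, enorm (y - x) < d -> `|f y - f x| <= L * enorm (y - x)) ->
  differentiable f x -> `|'d f x v| <= L * enorm v.
Proof.
move=> d0 fL dfx; apply/ler_addgt0Pr => e e0.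
have /cvgrPdist_lt/(_ _ e0) H := diff_quotient_cvg (v := v) dfx.
have v1 : 0 < enorm v + 1 by rewrite ltr_wpDl// enorm_ge0.
have [h [hn0 h1 h2]] : exists h : R, [/\ h != 0, `|h| < d / (enorm v + 1) &
    `|'d f x v - h^-1 * (f (x + h *: v) - f x)| < e].
  near (0 : R)^' => h; exists h; split.
  - by near: h; exact: nbhs_dnbhs_neq.
  - near: h; apply: dnbhs0_lt; exact: divr_gt0.
  - by near: h; exact: H.
have q : `|h^-1 * (f (x + h *: v) - f x)| <= L * enorm v.
  rewrite normrM normfV mulrC ler_pdivrMr ?normr_gt0//.
  apply: le_trans (fL _ _) _; rewrite addrC addKr enormZ.
    apply: (@le_lt_trans _ _ (`|h| * (enorm v + 1))); first by rewrite ler_wpM2l// lerDl.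
    by rewrite -ltr_pdivlMr.
  by rewrite mulrA mulrAC.
rewrite -lerBlDr; apply: le_trans q; rewrite lerBlDr -lerBlDl.
exact: le_trans (lerB_dist _ _) (ltW h2).
Unshelve. all: by end_near. Qed.

End Basics.

Section Blocks.
Variables (n : nat) (N : 'I_n -> nat).
Implicit Types x y : 'rV[R]_(\sum_(j < n) N j).

(** Written as [v *m v^T], the squared norm splits by block matrix multiplication. *)
Lemma enorm_sqr_blocks x : enorm x ^+ 2 = \sum_(i < n) enorm (submxrow x i) ^+ 2.
Proof.
have H m (v : 'rV[R]_m) : enorm v ^+ 2 = (v *m v^T) 0 0.
  by rewrite enorm_sqr mxE; apply: eq_bigr => j _; rewrite mxE.
rewrite H -{1 2}(submxrowK x) tr_mxrow mul_mxrow_mxcol summxE.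
by apply: eq_bigr => i _; rewrite H.
Qed.

Lemma enorm_block_le x i : enorm (submxrow x i) <= enorm x.
Proof.
rewrite -(ler_sqr _ _) ?nnegrE ?enorm_ge0// enorm_sqr_blocks (bigD1 i)//= lerDl.
by apply: sumr_ge0 => j _; exact: sqr_ge0.
Qed.

Lemma enorm_le_blocks x : enorm x <= \sum_(i < n) enorm (submxrow x i).
Proof.
have S0 : 0 <= \sum_(i < n) enorm (submxrow x i) by apply: sumr_ge0 => i _; exact: enorm_ge0.
rewrite -(ler_sqr _ _) ?nnegrE ?enorm_ge0// enorm_sqr_blocks expr2 mulr_suml.
apply: ler_sum => j _; rewrite expr2 ler_wpM2l ?enorm_ge0//.
by rewrite (bigD1 j)//= lerDl sumr_ge0// => i _; exact: enorm_ge0.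
Qed.

End Blocks.
End EuclideanNorm.

(** * Rademacher's theorem and the mean value inequality *)

Lemma ae_le_Rintegral d (T : measurableType d) (R : realType)
    (mu : {measure set T -> \bar R}) (D : set T) (f g : T -> R) :
  measurable D -> mu.-integrable D (EFin \o f) -> mu.-integrable D (EFin \o g) ->
  {ae mu, forall x, D x -> f x <= g x} ->
  \int[mu]_(x in D) f x <= \int[mu]_(x in D) g x.
Proof.
move=> mD fi gi [N [mN N0 HN]].
rewrite /Rintegral fine_le//; try exact: integrable_fin_num.
rewrite (negligible_integral mN mD fi N0) (negligible_integral mN mD gi N0).
apply: le_integral.
- exact: measurableD.
- by apply: (integrableS mD _ _ fi) => //; exact: measurableD.
- by apply: (integrableS mD _ _ gi) => //; exact: measurableD.
- move=> x; rewrite inE => -[Dx Nx]; rewrite lee_fin.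
  by apply: contrapT => H; apply: Nx; apply: HN => /(_ Dx).
Qed.

Lemma lebesgue_measure_cc (R : realType) (a b : R) : a <= b ->
  @lebesgue_measure R `[a, b]%classic = (b - a)%:E.
Proof.
move=> ab; rewrite lebesgue_measure_itv /= lte_fin.
move: ab; rewrite le_eqVlt => /predU1P[->|->]; first by rewrite ltxx subrr.
by rewrite EFinB.
Qed.

(** * Lipschitz functions of one variable: density and derivative almost everywhere *)

Section LipschitzDensity.
Variables (R : realType) (phi : R -> R) (L : R).
Hypothesis phiL : forall s t, `|phi s - phi t| <= L * `|s - t|.
Local Notation mu := (@lebesgue_measure R).

Lemma lipschitz_continuous : continuous phi.
Proof.
have L0 : 0 <= L.
  by have := phiL 1 0; rewrite subr0 normr1 mulr1; exact: le_trans (normr_ge0 _).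
move=> s; apply/cvgrPdist_lt => e e0; near=> t.
apply: (le_lt_trans (phiL s t)); apply: (@le_lt_trans _ _ ((L + 1) * `|s - t|)).
  by rewrite ler_wpM2r// lerDl.
rewrite mulrC -ltr_pdivlMr; last by rewrite ltr_wpDl.
near: t; apply/nbhs_ballP; exists (e / (L + 1)) => //=.
by rewrite divr_gt0// ltr_wpDl.
Unshelve. all: by end_near. Qed.

(** Adding [L * t] turns [phi] into a nondecreasing function, which generates a Stieltjes measure.
    Its increments are at most [2 * L] times the length, so that measure is absolutely
    continuous. *)
Definition lip_cumul (t : R) := phi t + L * t.
Let G := lip_cumul.

Let G_lip s t : s <= t -> 0 <= G t - G s <= 2 * L * (t - s).
Proof.
move=> st; have := phiL t s; rewrite (ger0_norm (_ : 0 <= t - s)) ?subr_ge0//.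
by rewrite ler_norml /G /lip_cumul => /andP[h1 h2]; apply/andP; split; lra.
Qed.

Let G_nd : {homo G : x y / x <= y}.
Proof. by move=> x y xy; have /andP[] := G_lip xy; rewrite subr_ge0. Qed.

Let G_cont : continuous G.
Proof.
move=> x; apply: (@continuousD _ _ _ phi (fun t => L * t)).
  exact: lipschitz_continuous.
by apply: (@continuousM _ _ (cst L) id); [exact: cvg_cst|exact: cvg_id].
Qed.

Let G_rc : right_continuous G.
Proof. exact/right_continuousW/G_cont. Qed.

HB.instance Definition _ := isCumulative.Build R _ R lip_cumul G_nd G_rc.

Let ls := lebesgue_stieltjes_measure lip_cumul.

Let lsE a b : a <= b -> ls `]a, b] = (G b - G a)%:E.
Proof.
move=> ab; rewrite /ls /lebesgue_stieltjes_measure /measure_extension.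
rewrite measurable_mu_extE//=; last exact: is_ocitv.
by rewrite wlength_itv_bnd.
Qed.

Let wlengthG X : ocitv X -> (wlength G X <= (2 * L)%:E * wlength idfun X)%E.
Proof.
move=> /ocitvP[->|[x x12 ->]]; first by rewrite !wlength0 mule0.
rewrite !wlength_itv_bnd ?(ltW x12)// -EFinM lee_fin.
by have /andP[] := G_lip (ltW x12).
Qed.

Let ls_dom A : mu A = 0%E -> ls A = 0%E.
Proof.
move=> mA0; apply/eqP; rewrite eq_le measure_ge0 andbT.
have L0 : 0 <= 2 * L.
  by have := G_lip (@ler01 R) => /andP[h1 h2]; have := le_trans h1 h2; lra.
apply/lee_addgt0Pr => e e0; rewrite add0e.
have Le0 : 0 < e / (2 * L + 1) by rewrite divr_gt0// ltr_wpDl.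
have mA0' : ereal_inf [set (\sum_(0 <= k <oo) wlength idfun (F k))%E |
    F in measurable_cover (A : set (ocitv_type R))] = 0%E :> \bar R := mA0.
have [|_ [F [mF AF] <-] Fe] := @lb_ereal_inf_adherent R
  [set (\sum_(0 <= k <oo) wlength idfun (F k))%E | F in measurable_cover (A : set (ocitv_type R))] _ Le0.
  by rewrite mA0'.
rewrite mA0' add0e in Fe.
apply: (@le_trans _ _ (\sum_(0 <= k <oo) wlength G (F k))%E).
  by apply: ereal_inf_lbound; exists F.
apply: (@le_trans _ _ (\sum_(0 <= k <oo) (2 * L)%:E * wlength idfun (F k))%E).
  apply: lee_nneseries => [k _ _|k _]; first exact: wlength_ge0.
  by apply: wlengthG; exact: mF.
rewrite nneseriesZl; last by move=> k _; exact: wlength_ge0.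
apply: (@le_trans _ _ ((2 * L)%:E * (e / (2 * L + 1))%:E)%E).
  by rewrite lee_wpmul2l ?lee_fin// ltW.
rewrite -EFinM lee_fin mulrCA ler_piMr ?(ltW e0)// ltW// ltr_pdivrMr ?mul1r ?ltrDl//.
by rewrite ltr_wpDl.
Qed.

Variable N : R.
Let D : set (measurableTypeR R) := `]-N, N]%classic.
Let mD : measurable D. Proof. exact: measurable_itv. Qed.

(** Restricting to a bounded interval makes the measure finite, ready for the Radon-Nikodym
    theorem. *)
Definition lip_restr := mrestr ls mD.
HB.instance Definition _ := Measure.on lip_restr.

Let lip_restr_fin : fin_num_fun lip_restr.
Proof.
suff H : (lip_restr setT < +oo)%E by exact: lty_fin_num_fun.
rewrite /lip_restr /mrestr setTI.
have [NN|NN] := leP (- N) N; first by rewrite lsE// ltry.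
have -> : D = set0.
  apply/seteqP; split=> // y.
  by rewrite /D /= in_itv /= => /andP[h1 h2]; lra.
by rewrite /ls measure0.
Qed.

HB.instance Definition _ := Measure_isFinite.Build _ _ _ lip_restr lip_restr_fin.

(** The density [h] is the Radon-Nikodym derivative of the Stieltjes measure minus [L]; Lebesgue
    differentiation identifies it with the derivative of [phi]. *)
Lemma lipschitz_density : exists h : R -> R,
  [/\ (forall a b, mu.-integrable `[a, b] (EFin \o h)),
   (forall a b, - N <= a -> a <= b -> b <= N ->
      phi b - phi a = \int[mu]_(x in `[a, b]) h x) &
   {ae mu, forall x, - N < x < N -> derivable phi x 1 /\ derive1 phi x = h x}].
Proof.
have dom : lip_restr `<< mu.
  apply/null_content_dominatesP => A mA mA0; rewrite /lip_restr /mrestr.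
  apply/eqP; rewrite eq_le measure_ge0 andbT -(ls_dom mA0) le_measure ?inE//.
  exact: measurableI.
pose f := Radon_Nikodym_SigmaFinite.f lip_restr mu.
have ffin := Radon_Nikodym_SigmaFinite.f_fin_num dom.
have fint := Radon_Nikodym_SigmaFinite.f_integrable dom.
have fE := Radon_Nikodym_SigmaFinite.f_integral dom.
pose k : R -> R := fine \o f.
have kf : EFin \o k = f by apply/funext => x /=; rewrite fineK.
have kint : mu.-integrable setT (EFin \o k) by rewrite kf.
(* The measure lives on []- N, N]], so integrating its density from minus infinity yields
   [G x - G (- N)]. *)
pose F x := \int[mu]_(t in `]-oo, x]) k t.
have FE x : - N <= x -> x <= N -> F x = G x - G (- N).
  move=> Nx xN; rewrite /F /Rintegral (kf : (fun t => (k t)%:E) = f) -fE; last exact: measurable_itv.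
  have e : `]-oo, x]%classic `&` D = `]- N, x]%classic.
    apply/seteqP; split => y /=; rewrite /D /= !in_itv /=.
      by move=> [yx /andP[-> _]].
    by move=> /andP[-> yx]; split => //; exact: le_trans xN.
  have e2 : lip_restr `]-oo, x]%classic = ls `]- N, x]%classic by rewrite -e.
  by rewrite [X in fine X]e2 lsE.
have kintS A : measurable A -> mu.-integrable A (EFin \o k).
  by move=> mA; apply: integrableS kint.
have subint a b : a <= b -> \int[mu]_(x in `[a, b]) k x = F b - F a.
  move=> ab; rewrite /F Rintegral_itvB ?bnd_simp//; last exact: kintS.
  by rewrite Rintegral_itv_obnd_cbnd//; exact: kintS.
have Lint a b : mu.-integrable `[a, b] (EFin \o (fun=> L)).
  apply: continuous_compact_integrable; first exact: segment_compact.
  by apply: continuous_subspaceT => x; exact: cvg_cst.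
exists (fun x => k x - L); split.
- move=> a b; rewrite (_ : EFin \o _ = ((EFin \o k) \- (EFin \o (fun=> L)))%E)//.
  by apply: integrableB => //; exact: kintS.
- move=> a b Na ab bN; rewrite RintegralB//; last exact: kintS.
  rewrite subint// Rintegral_cst// [X in L * fine X](lebesgue_measure_cc ab) !FE//; try lra.
  by rewrite /= /G /lip_cumul; lra.
- have kloc : locally_integrable [set: R] k by apply: open_integrable_locally => //; exact: openT.
  have := FTC1Ny (fun y => kintS _ (measurable_itv _)) kloc.
  apply: filterS; first exact: (ae_filter_ringOfSetsType mu).
  move=> x [dF F'] /andP[Nx xN].
  have Fd : is_derive x 1 F (k x) by apply: DeriveDef; rewrite // -derive1E.
  have nE : \forall y \near x, F y + G (- N) - L * y = phi y.
    near=> y; have Ny : - N <= y by apply: ltW; near: y; exact: lt_nbhsr.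
    have yN : y <= N by apply: ltW; near: y; exact: lt_nbhsl.
    by rewrite FE// /G /lip_cumul; lra.
  have H : is_derive x 1 phi (k x - L).
    apply: near_eq_is_derive nE _.
    have -> : k x - L = k x + 0 - L *: 1 by rewrite addr0 /GRing.scale /= mulr1.
    exact: is_deriveB.
  by case: H => H1 <-; rewrite derive1E.
Unshelve. all: by end_near. Qed.
End LipschitzDensity.

Section LipschitzAE.
Variables (R : realType) (phi : R -> R) (L : R).
Hypothesis phiL : forall s t, `|phi s - phi t| <= L * `|s - t|.
Local Notation mu := (@lebesgue_measure R).

Lemma lipschitz_ae_derivable : {ae mu, forall x, derivable phi x 1}.
Proof.
have H (n : nat) : {ae mu, forall x, - n%:R < x < n%:R -> derivable phi x 1}.
  have [h [_ _]] := lipschitz_density phiL n%:R.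
  by apply: filterS => [|x H xn]; [exact: (ae_filter_ringOfSetsType mu)|case: (H xn)].
suff: ~` [set x | derivable phi x 1] `<=`
      \bigcup_n (~` [set x | - n%:R < x < n%:R -> derivable phi x 1]).
  move/(@negligibleS _ _ _ mu); apply => /=.
  by apply: negligible_bigcup => k /=; exact: H.
move=> x /= dx; rewrite -setC_bigcap => h; apply: dx.
apply: (h (Num.bound `|x|)) => //=.
by rewrite -ltr_norml archi_boundP.
Qed.

Lemma lipschitz_increment_le (a b c : R) : a <= b ->
  {ae mu, forall x, a <= x <= b -> derivable phi x 1 -> derive1 phi x <= c} ->
  phi b - phi a <= c * (b - a).
Proof.
move=> ab H.
pose N : R := `|a| + `|b| + 1.
have [Na bN] : - N < a /\ b < N.
  have := normr_ge0 a; have := normr_ge0 b; have := ler_norm b; have := ler_norm (- a).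
  by rewrite normrN /N; split; lra.
have [h [hint hE hae]] := lipschitz_density phiL N.
rewrite hE//; [|lra..].
have -> : c * (b - a) = \int[mu]_(x in `[a, b]) c.
  by rewrite Rintegral_cst// [X in _ * fine X](lebesgue_measure_cc ab).
have cint : mu.-integrable `[a, b] (EFin \o (fun=> c)).
  apply: continuous_compact_integrable; first exact: segment_compact.
  by apply: continuous_subspaceT => x; exact: cvg_cst.
apply: ae_le_Rintegral => //.
have F := ae_filter_ringOfSetsType mu.
apply: filterS2 H hae => x H1 H2; rewrite /= in_itv /= => xab.
have [dx <-] : derivable phi x 1 /\ derive1 phi x = h x.
  by apply: H2; case/andP: xab => *; apply/andP; split; lra.
exact: H1.
Qed.
End LipschitzAE.

(** * Measurability of vector-valued maps, and density points *)

Section MeasurablePreimage.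
Variable R : realType.

Lemma ratr_approx (x e : R) : 0 < e -> exists q : rat, `|x - ratr q| < e.
Proof.
move=> e0; have [q] := @rat_in_itvoo R (x - e) (x + e) ltac:(lra).
by rewrite in_itv /= => /andP[h1 h2]; exists q; rewrite ltr_norml; lra.
Qed.

Lemma ratr_row_approx k (x : 'rV[R]_k) (e : R) : 0 < e ->
  exists q : 'rV[rat]_k, forall i, `|x 0 i - ratr (q 0 i)| < e.
Proof.
move=> e0; have /choice[q qP] : forall i : 'I_k, exists q : rat, `|x 0 i - ratr q| < e.
  by move=> i; exact: ratr_approx.
by exists (\row_i q i) => i; rewrite mxE.
Qed.

Lemma invnat_lt (e : R) : 0 < e -> exists n : nat, n.+1%:R^-1 < e.
Proof.
move=> e0; exists (Num.bound e^-1); rewrite -[ltRHS]invrK ltf_pV2 ?posrE ?invr_gt0 ?ltr0Sn//.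
rewrite (lt_trans (archi_boundP _)) ?invr_ge0 ?(ltW e0)// ltr_nat.
exact: ltnSn.
Qed.

(** Measurability is given coordinate by coordinate. An open set is the union of the countably many
    rational boxes it contains, and the preimage of a box is a finite intersection. *)
Lemma measurable_preimage_open d (T : measurableType d) k (Y : T -> 'rV[R]_k)
    (D : set T) (O : set 'rV[R]_k) : measurable D ->
  (forall i, measurable_fun D (fun t => Y t 0 i)) -> open O ->
  measurable (D `&` Y @^-1` O).
Proof.
move=> mD mY oO.
pose box (c : 'rV[rat]_k * nat) : set 'rV[R]_k :=
  [set y | forall i, `|y 0 i - ratr (c.1 0 i)| < c.2.+1%:R^-1].
have -> : D `&` Y @^-1` O =
    \bigcup_c (if pselect (box c `<=` O) then D `&` Y @^-1` (box c) else set0).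
  apply/seteqP; split => [t [Dt OYt]|t [c _]]; last first.
    by case: pselect => // bO [Dt bt]; split => //; exact: bO.
  have /nbhs_ballP[e /= e0 He] := oO _ OYt.
  have [n ne] := invnat_lt (divr_gt0 e0 (ltr0n R 2)).
  have n0 : 0 < n.+1%:R^-1 :> R by rewrite invr_gt0 ltr0Sn.
  have [q qP] := ratr_row_approx (Y t) n0.
  exists (q, n) => //; case: pselect => [bO|[]]; first by split.
  move=> y yb; apply: He; split => // i j; rewrite ord1 /ball /=.
  have h1 := lt_trans (qP j) ne; have h2 := lt_trans (yb j) ne; rewrite /= in h1 h2.
  rewrite (_ : Y t 0 j - y 0 j = (Y t 0 j - ratr (q 0 j)) - (y 0 j - ratr (q 0 j))); last by ring.
  by apply: (le_lt_trans (ler_normB _ _)); lra.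
apply: countable_bigcupT_measurable; first exact: countableP.
move=> c; case: pselect => bO; last exact: measurable0.
have -> : D `&` Y @^-1` (box c) = D `&` \bigcap_(i in [set: 'I_k])
    (D `&` (fun t => Y t 0 i) @^-1` ball (ratr (c.1 0 i) : R) (c.2.+1%:R^-1)).
  apply/seteqP; split => t [Dt H]; split => //.
    move=> i _; split => //=; rewrite /ball /= distrC; exact: H.
  by move=> i; have [_] := H i Logic.I; rewrite /= /ball /= distrC.
apply: measurableI => //; apply: fin_bigcap_measurable => // i _.
by apply: mY => //; apply: open_measurable; exact: ball_open.
Qed.

Lemma measurable_preimage_closed d (T : measurableType d) k (Y : T -> 'rV[R]_k)
    (D : set T) (O : set 'rV[R]_k) : measurable D ->
  (forall i, measurable_fun D (fun t => Y t 0 i)) -> closed O ->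
  measurable (D `&` Y @^-1` O).
Proof.
move=> mD mY cO.
have -> : D `&` Y @^-1` O = D `\` (D `&` Y @^-1` (~` O)).
  apply/seteqP; split => t [Dt]; first by move=> h; split => // -[].
  by move=> h; split => //; apply: contrapT => h2; apply: h.
apply: measurableD => //; apply: measurable_preimage_open => //.
exact: closed_openC.
Qed.

Lemma measurable_fun_continuous_comp d (T : measurableType d) k (Y : T -> 'rV[R]_k)
    (D : set T) (f : 'rV[R]_k -> R) : measurable D ->
  (forall i, measurable_fun D (fun t => Y t 0 i)) -> continuous f ->
  measurable_fun D (fun t => f (Y t)).
Proof.
move=> mD mY cf; apply: (measurability _ (RGenOInfty.measurableE R)) => //.
move=> _ [_ [a ->] <-].
apply: (@measurable_preimage_open _ _ _ Y D (f @^-1` `]a, +oo[)) => //.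
by apply: open_comp => // x _; exact: cf.
Qed.

End MeasurablePreimage.

(** If [S] had no point within [e * |s|] of [t + s], it would miss an interval of length
    [2 * e * |s|] in the ball of radius [2 * |s|] around [t], and fill at most a fraction
    [1 - e / 2] of it. *)
Lemma density_approach (R : realType) (S : set R) (t e : R) :
  measurable S -> S t -> 0 < e -> e <= 1 ->
  (@lebesgue_measure R (S `&` ball t r) * (@lebesgue_measure R (ball t r))^-1
     @[r --> 0^'+] --> (\1_S t)%:E)%E ->
  exists2 d, 0 < d & forall s, `|s| < d ->
    exists2 s', `|s' - s| <= e * `|s| & S (t + s').
Proof.
move=> mS St e0 e1 H.
have n1 : nbhs ((\1_S t)%:E : \bar R) [set y | ((1 - e / 2)%:E < y)%E].
  apply: open_nbhs_nbhs; split; first exact: open_ereal_gt_ereal.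
  by rewrite /= indicE mem_set//= lte_fin; lra.
have [d /= d0 Hd] := H _ n1.
exists (d / 2); first by rewrite divr_gt0.
move=> s sd; have [->|s0] := eqVneq s 0.
  by exists 0; rewrite ?subrr ?normr0 ?mulr0// addr0.
apply: contrapT => noS.
have ns0 : 0 < `|s| by rewrite normr_gt0.
pose r := 2 * `|s|.
have r0 : 0 < r by rewrite mulr_gt0.
have /= := Hd r; rewrite sub0r normrN (gtr0_norm r0) => /(_ _ r0) HH.
have {HH} : ((1 - e / 2)%:E < @lebesgue_measure R (S `&` ball t r)
    * (@lebesgue_measure R (ball t r))^-1)%E by apply: HH; rewrite /r; lra.
rewrite lebesgue_measure_ball ?(ltW r0)//.
pose I : set R := `[t + s - e * `|s|, t + s + e * `|s|]%classic.
have es : e * `|s| <= `|s| by rewrite ler_piMl.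
have es0 : 0 < e * `|s| by rewrite mulr_gt0.
have IB : I `<=` `[t - r, t + r]%classic.
  move=> y; rewrite /I /= !in_itv /= => /andP[h1 h2].
  by have := ler_norm s; have := ler_norm (- s); rewrite normrN /r; move=> ? ?; apply/andP; split; lra.
have SI : S `&` ball t r `<=` `[t - r, t + r]%classic `\` I.
  move=> y [Sy]; rewrite ball_itv /= in_itv /= => /andP[h1 h2]; split.
    by rewrite /= in_itv /=; lra.
  rewrite /I /= in_itv /= => /andP[h3 h4]; apply: noS; exists (y - t).
    by rewrite ler_norml; lra.
  by rewrite subrKC.
have mI : measurable I by exact: measurable_itv.
have mSB : measurable (S `&` ball t r) by apply: measurableI => //; apply: open_measurable; exact: ball_open.
have le1 : (@lebesgue_measure R (S `&` ball t r) <= (2 * r - 2 * (e * `|s|))%:E)%E.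
  apply: (@le_trans _ _ (@lebesgue_measure R (`[t - r, t + r]%classic `\` I))).
    by rewrite le_measure ?inE//; exact: measurableD.
  rewrite measureD//=.
  - rewrite (setIidr IB) lebesgue_measure_cc; last lra.
    rewrite [X in (_ - X)%E]lebesgue_measure_cc; last lra.
    by rewrite -EFinB lee_fin; lra.
  - by rewrite lebesgue_measure_cc ?ltry//; lra.
rewrite ltNge => /negP; apply.
have -> : ((r *+ 2)%:E)^-1%E = ((r *+ 2)^-1)%:E :> \bar R.
  by rewrite inver mulrn_eq0 /= gt_eqF.
apply: (le_trans (lee_wpmul2r _ le1)); first by rewrite lee_fin invr_ge0 mulrn_wge0// ltW.
rewrite -EFinM lee_fin ler_pdivrMr ?mulrn_wgt0// /r; lra.
Qed.

(** * Differentiability by adding one coordinate direction at a time *)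

Section Rademacher.
Variables (R : realType) (k : nat).
Implicit Types (f : 'rV[R]_k -> R) (x y z v w : 'rV[R]_k) (L : R).

Definition lipschitz_with L f := forall x y, `|f x - f y| <= L * enorm (x - y).

Definition supported (j : nat) v := forall i : 'I_k, (j <= i)%N -> v 0 i = 0.

(** The index [(p, m, n)] holds a rational slope, a radius [1 / (m + 1)] and a relative error
    [1 / (n + 1)]. There are countably many such sets, each closed when [f] is Lipschitz, so
    Lebesgue density applies to all of them at once. *)
Definition affine_approx f (j : nat) (c : 'rV[rat]_k * nat * nat) : set 'rV[R]_k :=
  [set x | forall v, supported j v -> enorm v < c.1.2.+1%:R^-1 ->
     `|f (x + v) - f x - dotr (map_mx ratr c.1.1) v| <= c.2.+1%:R^-1 * enorm v].

(** Differentiability along the first [j] coordinates, phrased without naming a gradient; at [j = k]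
    it is full differentiability. *)
Definition approx_diff f (j : nat) x :=
  forall n, exists p m, affine_approx f j (p, m, n) x.

Lemma lipschitz_with_ge0 L f : lipschitz_with L f -> (0 < k)%N -> 0 <= L.
Proof.
move=> fL k0; have := fL (delta_mx 0 (Ordinal k0)) 0.
rewrite subr0; set e := delta_mx _ _ => H.
have e0 : 0 < enorm e.
  apply: lt_le_trans (coord_le_enorm e (Ordinal k0)).
  by rewrite mxE !eqxx normr1.
by rewrite -(pmulr_lge0 _ e0); exact: le_trans (normr_ge0 _) H.
Qed.

Lemma lipschitz_with_continuous L f : lipschitz_with L f -> continuous f.
Proof.
move=> fL x; apply/(@cvgrPdist_lt _ _ _ (nbhs x) (nbhs_filter x)) => e e0.
have L0 : 0 < `|L| + 1 by rewrite ltr_wpDl.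
apply/nbhs_enormP; exists (e / (`|L| + 1)); first by rewrite divr_gt0.
move=> y yx; apply: (le_lt_trans (fL x y)); rewrite enormBC.
apply: (@le_lt_trans _ _ ((`|L| + 1) * enorm (y - x))).
  by rewrite ler_wpM2r ?enorm_ge0// (le_trans (ler_norm _))// lerDl.
by rewrite mulrC -ltr_pdivlMr.
Qed.

Lemma affine_approx_closed L f j c : lipschitz_with L f -> closed (affine_approx f j c).
Proof.
move=> fL; have cf := lipschitz_with_continuous fL.
have -> : affine_approx f j c = \bigcap_(v in [set v | supported j v /\
    enorm v < c.1.2.+1%:R^-1]) [set x |
     `|f (x + v) - f x - dotr (map_mx ratr c.1.1) v| <= c.2.+1%:R^-1 * enorm v].
  by apply/seteqP; split => [x H v [h1 h2]|x H v h1 h2]; [exact: H|exact: H].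
apply: closed_bigI => v _.
pose h := fun x => `|f (x + v) - f x - dotr (map_mx ratr c.1.1) v|.
rewrite (_ : [set x | _] = h @^-1` [set t | t <= c.2.+1%:R^-1 * enorm v])//.
apply: closed_comp => [x _|]; last exact: closed_le.
apply: (@lipschitz_with_continuous (2 * L) h) => {}x y.
apply: (le_trans (ler_dist_dist _ _)).
rewrite (_ : _ - _ = (f (x + v) - f (y + v)) - (f x - f y)); last by ring.
apply: (le_trans (ler_normB _ _)); have := fL (x + v) (y + v).
by rewrite opprD addrACA subrr addr0; have := fL x y; lra.
Qed.

Lemma supported0 v : supported 0 v -> v = 0.
Proof. by move=> sv; apply/rowP => i; rewrite mxE sv. Qed.

Lemma supportedS (j : nat) (jk : (j < k)%N) v : supported j.+1 v ->
  exists2 w, supported j w /\ enorm w <= enorm v &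
    v = w + v 0 (Ordinal jk) *: delta_mx 0 (Ordinal jk).
Proof.
move=> sv; set e := delta_mx 0 _.
exists (v - v 0 (Ordinal jk) *: e); last by rewrite subrK.
split.
  move=> i; rewrite leq_eqVlt => /orP[/eqP ji|ji].
    have -> : i = Ordinal jk by apply/val_inj; rewrite /= ji.
    by rewrite !mxE !eqxx mulr1 subrr.
  have ij : (i == Ordinal jk) = false.
    by apply/negbTE; apply: contraTneq ji => ->; rewrite /= ltnn.
  by rewrite /e !mxE (sv i)// ij andbF mulr0 subr0.
rewrite -(ler_sqr _ _) ?nnegrE ?enorm_ge0// !enorm_sqr; apply: ler_sum => i _.
rewrite /e !mxE eqxx /=; have [->|] := eqVneq i (Ordinal jk).
  by rewrite mulr1 subrr expr0n sqr_ge0.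
by rewrite mulr0 subr0.
Qed.

Lemma enorm_delta (i : 'I_k) : enorm (delta_mx 0 i : 'rV[R]_k) = 1.
Proof.
rewrite /enorm (bigD1 i)//= big1 ?addr0; first by rewrite mxE !eqxx expr1n sqrtr1.
by move=> j ji; rewrite mxE eqxx /= (negbTE ji) expr0n.
Qed.

Lemma dotrC v w : dotr v w = dotr w v.
Proof. by apply: eq_bigr => i _; rewrite mulrC. Qed.

Lemma dotr_delta v (i : 'I_k) : dotr v (delta_mx 0 i) = v 0 i.
Proof.
rewrite /dotr (bigD1 i)//= big1 ?addr0; first by rewrite mxE !eqxx mulr1.
by move=> j ji; rewrite mxE eqxx /= (negbTE ji) mulr0.
Qed.

(** Split an increment as [v + s *: e]. The affine approximation in [v] is known at [x] but not at
    [x + s *: e]; density provides it at some [x + s' *: e] with [s'] close to [s], and the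
    Lipschitz bound pays for the exchange. *)
Lemma approx_diffS L f j (jk : (j < k)%N) z t :
  lipschitz_with L f ->
  let e : 'rV[R]_k := delta_mx 0 (Ordinal jk) in
  derivable (fun s : R => f (z + s *: e)) t 1 ->
  (forall c, affine_approx f j c (z + t *: e) ->
     forall d, 0 < d -> d <= 1 -> exists2 del, 0 < del & forall s, `|s| < del ->
       exists2 s', `|s' - s| <= d * `|s| & affine_approx f j c (z + (t + s') *: e)) ->
  approx_diff f j (z + t *: e) -> approx_diff f j.+1 (z + t *: e).
Proof.
move=> fL e df dens ad n; set x := z + t *: e.
have L0 : 0 <= L := lipschitz_with_ge0 fL (leq_ltn_trans (leq0n _) jk).
set n1 : R := n.+1%:R^-1.
have n10 : 0 < n1 by rewrite invr_gt0 ltr0Sn.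
(* Error budget in units of [d * enorm w]: exchanging [s] for [s'] costs [L] twice, the
   approximation in [v] costs one, and the rational substitute [q] for the partial derivative costs
   two. *)
pose d := Num.min 1 (n1 / (2 * L + 3)).
have L3 : 0 < 2 * L + 3 by lra.
have d0 : 0 < d by rewrite lt_min ltr01 divr_gt0.
have d1 : d <= 1 by rewrite ge_min lexx.
have dn : (2 * L + 3) * d <= n1.
  by rewrite mulrC -ler_pdivlMr// ge_min lexx orbT.
have [n' n'd] := invnat_lt d0.
have [p [m pm]] := ad n'.
have [del1 del10 H1] := dens _ pm _ d0 d1.
set D := 'D_1 (fun s : R => f (z + s *: e)) t.
have /cvgrPdist_lt/(_ _ d0) Hder : (h^-1 *: (f (z + (h *: 1 + t) *: e) - f (z + t *: e)))
   @[h --> 0^'] --> D by exact: df.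
have [del2 /= del20 H2] := Hder.
have [q qD] := ratr_approx D d0.
have H3 s : `|s| < del2 -> `|f (x + s *: e) - f x - ratr q * s| <= 2 * d * `|s|.
  move=> sd; have [->|s0] := eqVneq s 0.
    by rewrite scale0r addr0 mulr0 !subrr normr0 mulr0.
  have es : z + (s *: (1 : R) + t) *: e = x + s *: e.
    by rewrite (_ : s *: (1 : R) = s) ?[s + t]addrC ?scalerDl ?addrA// [LHS]mulr1.
  have /= := H2 s; rewrite sub0r normrN es => /(_ sd s0) H.
  have H' : `|D * s - (f (x + s *: e) - f x)| <= d * `|s|.
    rewrite (_ : D * s - _ = (D - s^-1 * (f (x + s *: e) - f x)) * s); last first.
      by rewrite mulrBl mulrAC mulVf// mul1r.
    by rewrite normrM ler_wpM2r// ltW.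
  have e1 : f (x + s *: e) - f x - ratr q * s =
     - (D * s - (f (x + s *: e) - f x)) + (D - ratr q) * s by ring.
  rewrite e1; apply: (le_trans (ler_normD _ _)); rewrite normrN.
  have : `|(D - ratr q) * s| <= d * `|s| by rewrite normrM ler_wpM2r// ltW.
  lra.
pose m' := Num.min (m.+1%:R^-1) (Num.min del1 del2).
have m'0 : 0 < m' by rewrite !lt_min invr_gt0 ltr0Sn del10.
have [M Mm'] := invnat_lt m'0.
(* The slope [p] with its entry in the new direction replaced by [q]. *)
exists (p + (q - p 0 (Ordinal jk)) *: delta_mx 0 (Ordinal jk)), M => w sw /= wM.
have [v [sv vw] wE] := supportedS jk sw.
set s := w 0 (Ordinal jk) in wE.
have sw' : `|s| <= enorm w by exact: coord_le_enorm.
have {}wM := lt_trans wM Mm'.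
move: wM; rewrite !lt_min => /andP[wm /andP[w1 w2]].
have [s' s's /= As'] := H1 s (le_lt_trans sw' w1).
have := As' v sv (le_lt_trans vw wm).
set pv := dotr _ v; rewrite scalerDl addrA -/x => Hv.
have := H3 s (le_lt_trans sw' w2) => Hs.
have h1 : `|f (x + w) - f (x + s' *: e + v)| <= L * (d * `|s|).
  apply: (le_trans (fL _ _)); rewrite wE (_ : _ - _ = (s - s') *: e); last first.
    by apply/rowP => i; rewrite !mxE; ring.
  by rewrite enormZ enorm_delta mulr1 ler_wpM2l// distrC.
have h2 : `|f (x + s' *: e) - f (x + s *: e)| <= L * (d * `|s|).
  apply: (le_trans (fL _ _)); rewrite (_ : _ - _ = (s' - s) *: e); last first.
    by apply/rowP => i; rewrite !mxE; ring.
  by rewrite enormZ enorm_delta mulr1 ler_wpM2l.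
have -> : dotr (map_mx ratr (p + (q - p 0 (Ordinal jk)) *: delta_mx 0 (Ordinal jk))) w =
    pv + ratr q * s.
  rewrite map_mxD map_mxZ map_delta_mx dotrC linearD linearZ /= -!(dotrC _ w).
  rewrite wE !linearD !linearZ /= -/pv [dotr (delta_mx _ _) v]dotrC !dotr_delta !mxE !eqxx (sv (Ordinal jk))//=.
  rewrite rmorphB /= /GRing.scale /=; ring.
have e2 : f (x + w) - f x - (pv + ratr q * s) = (f (x + w) - f (x + s' *: e + v))
   + (f (x + s' *: e + v) - f (x + s' *: e) - pv) + (f (x + s' *: e) - f (x + s *: e))
   + (f (x + s *: e) - f x - ratr q * s) by ring.
rewrite e2; apply: (le_trans (ler_normD _ _)).
have := ler_normD (f (x + w) - f (x + s' *: e + v)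
   + (f (x + s' *: e + v) - f (x + s' *: e) - pv)) (f (x + s' *: e) - f (x + s *: e)).
have := ler_normD (f (x + w) - f (x + s' *: e + v))
   (f (x + s' *: e + v) - f (x + s' *: e) - pv).
have h3 : n'.+1%:R^-1 * enorm v <= d * enorm w.
  by apply: ler_pM => //; rewrite ?enorm_ge0 ?invr_ge0 ?ler0n// ltW.
have h4 : d * `|s| <= d * enorm w by rewrite ler_wpM2l// ltW.
have h5 : L * (d * `|s|) <= L * (d * enorm w) by rewrite ler_wpM2l.
have h6 : (2 * L + 3) * d * enorm w <= n1 * enorm w by rewrite ler_wpM2r ?enorm_ge0.
move=> h7 h8; rewrite /= in Hv; rewrite /= -/n1.
have {Hv h3} Hv := le_trans Hv h3; have {h1} h1 := le_trans h1 h5.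
have {h2} h2 := le_trans h2 h5.
move: (enorm w) h1 h2 h4 h6 Hv => W h1 h2 h4 h6 Hv.
move: Hs h1 h2 h4 h6 h7 h8 Hv; clear.
move: (`|f (x + w) - f (x + s' *: e + v)|) (`|f (x + s' *: e) - f (x + s *: e)|)
  (`|f (x + s *: e) - f x - ratr q * s|) (`|s|) d => a1 a2 a3 s1 d1; lra.
Qed.

End Rademacher.

(** * Product measures *)

Section ProductSigmaFinite.
Context d1 d2 (T1 : measurableType d1) (T2 : measurableType d2) (R : realType).
Variable m1 : {sigma_finite_measure set T1 -> \bar R}.
Variable m2 : {sigma_finite_measure set T2 -> \bar R}.

(* An alias of [m1 \x m2]: the sigma-finite instance that the library declares
   on [product_measure1] is shadowed by the one for subprobabilities. *)
Definition prod_sf : set (T1 * T2) -> \bar R := (m1 \x m2)%E.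

HB.instance Definition _ := Measure.on prod_sf.

Let prod_sf_sigma_finite : sigma_finite setT prod_sf.
Proof.
have /sigma_finiteP[F [TF ndF Foo]] := sigma_finiteT m1.
have /sigma_finiteP[G [TG ndG Goo]] := sigma_finiteT m2.
exists (fun n => F n `*` G n).
  apply/esym; rewrite -subTset => -[x y] _.
  have [n _ Fnx] : (\bigcup_n F n) x by rewrite -TF.
  have [l _ Gly] : (\bigcup_n G n) y by rewrite -TG.
  exists (maxn n l) => //; split.
  - by move: x Fnx; exact/subsetPset/ndF/leq_maxl.
  - by move: y Gly; exact/subsetPset/ndG/leq_maxr.
move=> n; have [? ?] := Foo n; have [? ?] := Goo n.
split; first exact: measurableX.
by rewrite [ltLHS]product_measure1E// lte_mul_pinfty// ge0_fin_numE.
Qed.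

HB.instance Definition _ := Measure_isSigmaFinite.Build _ _ _ prod_sf
  prod_sf_sigma_finite.

End ProductSigmaFinite.

(** * Almost everywhere differentiability and the mean value inequality *)

Section RademacherAE.
Variables (R : realType) (k : nat).
Implicit Types (f : 'rV[R]_k -> R) (x y z v w : 'rV[R]_k) (L : R).
Local Notation mu := (@lebesgue_measure R).

Lemma ae_forall_countable d (T : measurableType d) (m : {measure set T -> \bar R})
    (C : countType) (P : C -> T -> Prop) :
  (forall c, {ae m, forall t, P c t}) -> {ae m, forall t, forall c, P c t}.
Proof.
move=> H; have F := ae_filter_ringOfSetsType m.
have : {ae m, forall t, forall n : nat, if unpickle n is Some c then P c t else True}.
  by apply: ae_foralln => n; case: (unpickle n) => [c|]; [exact: H|exact: aeW].
by apply: filterS => t H1 c; have := H1 (pickle c); rewrite pickleK.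
Qed.

Lemma line_measurable z v (i : 'I_k) :
  measurable_fun setT (fun t : R => (z + t *: v) 0 i).
Proof.
rewrite (_ : (fun t => _) = (fun t : R => z 0 i + t * v 0 i)); last first.
  by apply/funext => t; rewrite !mxE.
by apply: measurable_funD => //; exact: measurable_funM.
Qed.

Lemma lipschitz_on_line L f z v : lipschitz_with L f ->
  forall s t : R, `|f (z + s *: v) - f (z + t *: v)| <= (L * enorm v) * `|s - t|.
Proof.
move=> fL s t; apply: (le_trans (fL _ _)).
by rewrite opprD addrACA subrr add0r -scalerBl enormZ mulrA mulrAC.
Qed.

Lemma approx_diffS_ae L f (j : nat) (jk : (j < k)%N) z : lipschitz_with L f ->
  let e : 'rV[R]_k := delta_mx 0 (Ordinal jk) in
  {ae mu, forall t, approx_diff f j (z + t *: e) -> approx_diff f j.+1 (z + t *: e)}.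
Proof.
move=> fL e; have F := ae_filter_ringOfSetsType mu.
pose S c : set R := [set t | affine_approx f j c (z + t *: e)].
have mS c : measurable (S c).
  rewrite -[S c]setTI; apply: (@measurable_preimage_closed _ _ _ _
    (fun t : R => z + t *: e) setT (affine_approx f j c)) => //.
    by move=> i; exact: line_measurable.
  exact: affine_approx_closed fL.
have h1 : {ae mu, forall t, derivable (fun s : R => f (z + s *: e)) t 1}.
  exact: (lipschitz_ae_derivable (lipschitz_on_line z e fL)).
have h2 := ae_forall_countable (fun c => lebesgue_density (mS c)).
apply: filterS2 h1 h2 => t d1 d2; apply: (approx_diffS (L := L)) => // c Sc d d0 d1'.
have [del del0 H] := density_approach (mS c) Sc d0 d1' (d2 c).
by exists del.
Qed.

Lemma approx_diff_measurable d (T : measurableType d) (Y : T -> 'rV[R]_k) L f j :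
  (forall i, measurable_fun setT (fun t => Y t 0 i)) -> lipschitz_with L f ->
  measurable [set t | approx_diff f j (Y t)].
Proof.
move=> mY fL.
have -> : [set t | approx_diff f j (Y t)] = \bigcap_n \bigcup_(c : 'rV[rat]_k * nat)
    (setT `&` Y @^-1` (affine_approx f j (c.1, c.2, n))).
  apply/seteqP; split => [t H n _|t H n].
    by have [p [m pm]] := H n; exists (p, m).
  by have [[p m] _ [_ pm]] := H n Logic.I; exists p, m.
apply: bigcapT_measurable => n; apply: countable_bigcupT_measurable => // c.
by apply: measurable_preimage_closed => //; exact: affine_approx_closed fL.
Qed.

(** A stand-in for Lebesgue measure on the span of the first [j] coordinates: the parametrisation
    [Y] charges every neighbourhood of [0], and on every translate each Lipschitz function is
    approximable along these coordinates almost everywhere. Leaving [T] abstract lets the induction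
    on [j] form products with the line. *)
Definition null_param (j : nat) d (T : measurableType d)
    (m : {sigma_finite_measure set T -> \bar R}) (Y : T -> 'rV[R]_k) :=
  [/\ (forall i, measurable_fun setT (fun t => Y t 0 i)),
      (forall e, 0 < e -> m [set t | enorm (Y t) < e] != 0%E) &
      (forall L f z, lipschitz_with L f -> m [set t | ~ approx_diff f j (z + Y t)] = 0%E)].

Lemma measurable_shift d (T : measurableType d) (Y : T -> 'rV[R]_k) z :
  (forall i, measurable_fun setT (fun t => Y t 0 i)) ->
  forall i, measurable_fun setT (fun t => (z + Y t) 0 i).
Proof.
by move=> mY i; under eq_fun do rewrite mxE; apply: measurable_funD.
Qed.

(** Fubini for null sets; [product_null2] takes the sections the other way, through uniqueness of
    the product measure. *)
Lemma product_null d (T : measurableType d) (m : {sigma_finite_measure set T -> \bar R})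
    (Z : set (T * R)) : measurable Z ->
  (forall t, mu [set s | Z (t, s)] = 0%E) -> prod_sf m mu Z = 0%E.
Proof.
move=> mZ H; rewrite /prod_sf /product_measure1; apply: integral0_eq => t _ /=.
by rewrite -[RHS](H t); congr (mu _); rewrite xsectionE.
Qed.

Lemma product_null2 d (T : measurableType d) (m : {sigma_finite_measure set T -> \bar R})
    (Z : set (T * R)) : measurable Z ->
  (forall s, m [set t | Z (t, s)] = 0%E) -> prod_sf m mu Z = 0%E.
Proof.
move=> mZ H; rewrite /prod_sf; have -> : (m \x mu)%E Z = (m \x^ mu)%E Z.
  by apply: product_measure_unique => //= A B mA mB; rewrite product_measure2E.
rewrite /product_measure2; apply: integral0_eq => s _ /=.
by rewrite -[RHS](H s); congr (m _); rewrite ysectionE.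
Qed.

(** Points that fail at stage [j] form a null set by sections at fixed [s], where the shift is
    absorbed into [z]. Points that fail only at stage [j.+1] form a null set by sections along lines
    in the new direction. *)
Lemma null_paramS j (jk : (j < k)%N) d (T : measurableType d)
    (m : {sigma_finite_measure set T -> \bar R}) (Y : T -> 'rV[R]_k) :
  null_param j m Y ->
  null_param j.+1
    (prod_sf m mu)
    (fun ts => Y ts.1 + ts.2 *: delta_mx 0 (Ordinal jk)).
Proof.
set e := delta_mx 0 _ => -[mY pY nY].
have mY' : forall i, measurable_fun setT (fun ts : T * R => (Y ts.1 + ts.2 *: e) 0 i).
  move=> i; under eq_fun do rewrite !mxE.
  apply: measurable_funD; first exact: measurableT_comp (mY i) measurable_fst.
  by apply: measurable_funM => //; exact: measurable_snd.
split => //.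
- move=> ep ep0.
  pose A := [set t | enorm (Y t) < ep / 2]; pose B := ball (0 : R) (ep / 2).
  have mA : measurable A.
    rewrite -[X in measurable X]setTI.
    apply: (@measurable_preimage_open _ _ _ _ Y setT [set v | enorm v < ep / 2]) => //.
    rewrite (_ : [set v | _] = @enorm R k @^-1` [set t | t < ep / 2])//.
    by apply: open_comp => [v _|]; [exact: continuous_enorm|exact: open_lt].
  have mB : measurable B by exact: measurable_ball.
  apply/eqP => H.
  have : (prod_sf m mu (A `*` B) <= 0)%E.
    rewrite -H; apply: le_measure; rewrite ?inE.
    + exact: measurableX.
    + rewrite -[X in measurable X]setTI.
      apply: (@measurable_preimage_open _ _ _ _ _ setT [set v | enorm v < ep]) => //.
      rewrite (_ : [set v | _] = @enorm R k @^-1` [set t | t < ep])//.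
      by apply: open_comp => [v _|]; [exact: continuous_enorm|exact: open_lt].
    + move=> [t s] [/= h1]; rewrite /B /ball /= sub0r normrN => h2.
      rewrite /A /= in h1.
      apply: (le_lt_trans (enorm_triangle _ _)); rewrite enormZ enorm_delta mulr1; lra.
  rewrite [leLHS]product_measure1E// leNgt => /negP; apply; apply: mule_gt0.
    by rewrite measure_gt0; apply: pY; lra.
  by rewrite [ltRHS]lebesgue_measure_ball ?lte_fin ?mulrn_wgt0//; lra.
- move=> L f z fL.
  pose Z1 := [set ts : T * R | ~ approx_diff f j (z + (Y ts.1 + ts.2 *: e))].
  pose Z2 := [set ts : T * R | ~ approx_diff f j.+1 (z + (Y ts.1 + ts.2 *: e))].
  have mZ1 : measurable Z1.
    apply: measurableC; apply: approx_diff_measurable fL; exact: measurable_shift.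
  have mZ2 : measurable Z2.
    apply: measurableC; apply: approx_diff_measurable fL; exact: measurable_shift.
  have Z1_0 : prod_sf m mu Z1 = 0%E.
    apply: product_null2 => // s; rewrite -[RHS](nY L f (z + s *: e) fL).
    congr (m _); apply/seteqP; split => t; rewrite /Z1 /= -!addrA [s *: e + _]addrC//.
  have Z2_0 : prod_sf m mu (Z2 `\` Z1) = 0%E.
    apply: product_null => [|t]; first exact: measurableD.
    have [N [mN N0 HN]] := approx_diffS_ae jk (z + Y t) fL.
    apply: (subset_measure0 (B := N)) => //.
      have := measurable_xsection t (measurableD mZ2 mZ1).
      by rewrite xsectionE.
    move=> s [/= h1 h2]; apply: HN => /= H; apply: h1; rewrite addrA; apply: H.
    by rewrite -addrA; apply: contrapT.
  apply/eqP; rewrite eq_le measure_ge0 andbT.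
  apply: (@le_trans _ _ (prod_sf m mu (Z1 `|` (Z2 `\` Z1)))).
    rewrite le_measure ?inE//; first by apply: measurableU => //; exact: measurableD.
    by move=> ts h; have [|] := pselect (Z1 ts); [left|right].
  rewrite (le_trans (measureU2 _ _ _))//; first exact: measurableD.
  by rewrite -[leRHS]adde0 -{1}Z1_0 -Z2_0.
Qed.

Lemma null_param_exists (j : nat) : (j <= k)%N ->
  exists d (T : measurableType d) (m : {sigma_finite_measure set T -> \bar R})
    (Y : T -> 'rV[R]_k), null_param j m Y.
Proof.
elim: j => [_|j IH jk].
  exists _, unit, (@dirac _ unit tt R), (fun=> 0); split.
  - by move=> i; exact: measurable_cst.
  - by move=> e e0; rewrite /= /dirac indicE mem_set /= ?enorm0// onee_eq0.
  - move=> L f z _; rewrite (_ : [set t | _] = set0) ?measure0//.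
    apply/seteqP; split=> // t /= []; move=> n; exists 0, 0%N => v /supported0 -> _ /=.
    by rewrite addr0 subrr linear0 subrr normr0 enorm0 mulr0.
have [d [T [m [Y H]]]] := IH (ltnW jk).
exists _, _, (prod_sf m mu), (fun ts => Y ts.1 + ts.2 *: delta_mx 0 (Ordinal jk)).
exact: (null_paramS jk H).
Qed.

(** Two affine approximations at the same point have slopes that differ, in each coordinate, by at
    most the sum of their relative errors; the slopes therefore converge at an explicit rate. *)
Lemma approx_diff_differentiable f x : approx_diff f k x -> differentiable f x.
Proof.
move=> /choice[p0 /choice[m0 H0]].
pose p n : 'rV[R]_k := map_mx ratr (p0 n).
have H n v : enorm v < (m0 n).+1%:R^-1 ->
    `|f (x + v) - f x - dotr (p n) v| <= n.+1%:R^-1 * enorm v.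
  by move=> vm; apply: (H0 n) => // i; rewrite leqNgt ltn_ord.
have pC n n' (i : 'I_k) : `|p n 0 i - p n' 0 i| <= n.+1%:R^-1 + n'.+1%:R^-1.
  pose t := Num.min (m0 n).+1%:R^-1 (m0 n').+1%:R^-1 / 2 : R.
  have mt : 0 < Num.min (m0 n).+1%:R^-1 (m0 n').+1%:R^-1 :> R.
    by rewrite lt_min !invr_gt0 !ltr0Sn.
  have t0 : 0 < t by rewrite divr_gt0.
  have tm : t < Num.min (m0 n).+1%:R^-1 (m0 n').+1%:R^-1 by rewrite /t; lra.
  move: tm; rewrite lt_min => /andP[t1 t2].
  have ev : enorm (t *: delta_mx 0 i : 'rV[R]_k) = t.
    by rewrite enormZ enorm_delta mulr1 gtr0_norm.
  have := H n (t *: delta_mx 0 i); have := H n' (t *: delta_mx 0 i).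
  rewrite ev !linearZ /= !dotr_delta => /(_ t2) h2 /(_ t1) h1.
  rewrite -(ler_pM2r t0) -{1}(gtr0_norm t0) -normrM mulrBl.
  rewrite (_ : _ - _ = (f (x + t *: delta_mx 0 i) - f x - t *: p n' 0 i) -
     (f (x + t *: delta_mx 0 i) - f x - t *: p n 0 i)); last by rewrite /GRing.scale /=; ring.
  apply: (le_trans (ler_normB _ _)); rewrite mulrDl [leRHS]addrC.
  by rewrite !scalerN in h1 h2; exact: lerD.
(* The intervals of radius [1 / (n + 1)] around [p n 0 i] meet pairwise, so the supremum of their
   left ends lies in all of them. *)
pose q : 'rV[R]_k := \row_i sup [set p n 0 i - n.+1%:R^-1 | n in [set: nat]].
have qp n (i : 'I_k) : `|q 0 i - p n 0 i| <= n.+1%:R^-1.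
  have ub : ubound [set p n 0 i - n.+1%:R^-1 | n in [set: nat]] (p n 0 i + n.+1%:R^-1).
    move=> _ [n' _ <-]; have := pC n' n i.
    by move: (n'.+1%:R^-1) (n.+1%:R^-1) => u u'; rewrite ler_norml => /andP[? ?]; lra.
  have qE : q 0 i = sup [set p n 0 i - n.+1%:R^-1 | n in [set: nat]] by rewrite mxE.
  rewrite ler_distl qE; apply/andP; split.
    by apply: ub_le_sup; [exists (p n 0 i + n.+1%:R^-1)|exists n].
  by apply: ge_sup => //; exists (p n 0 i - n.+1%:R^-1), n.
apply: (@differentiable_enormP _ _ _ _ q) => e e0.
have k1 : 0 < k.+1%:R :> R by rewrite ltr0Sn.
have [n ne] := invnat_lt (divr_gt0 e0 k1).
exists ((m0 n).+1%:R^-1); first by rewrite invr_gt0 ltr0Sn.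
move=> v vm; have Hn := H n v vm.
have Hq : `|dotr (q - p n) v| <= k%:R * n.+1%:R^-1 * enorm v.
  apply: (le_trans (dotr_le _ _)); rewrite ler_wpM2r ?enorm_ge0//.
  apply: (le_trans (enorm_le_sum _)).
  rewrite mulr_natl -[X in _ *+ X](card_ord k) -sumr_const.
  by apply: ler_sum => i _; have := qp n i; rewrite !mxE.
have e1 : f (x + v) - f x - dotr q v = (f (x + v) - f x - dotr (p n) v) - dotr (q - p n) v.
  by rewrite !(dotrC _ v) linearB /=; ring.
rewrite e1; apply: (le_trans (ler_normB _ _)); apply: (le_trans (lerD Hn Hq)).
rewrite -mulrDl ler_wpM2r ?enorm_ge0//.
have : n.+1%:R^-1 * k.+1%:R <= e by rewrite -ler_pdivlMr// ltW.
by rewrite -(natr1 k); move: (n.+1%:R^-1) => u; lra.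
Qed.

Lemma derive1_line f z v s : differentiable f (z + s *: v) ->
  derive1 (fun t : R => f (z + t *: v)) s = 'd f (z + s *: v) v.
Proof.
move=> df; rewrite derive1E /derive; apply: cvg_lim => //.
have := diff_quotient_cvg (v := v) df; apply: cvg_trans; apply: near_eq_cvg.
near=> t; rewrite /= (_ : t *: (1 : R) = t); last exact: mulr1.
by rewrite scalerDl [t *: v + _]addrC addrA.
Unshelve. all: by end_near. Qed.

(** A given line may avoid the points of differentiability. By Fubini almost every translate of it
    is good, and the translates by vectors shorter than [e] have positive measure. *)
Lemma ae_good_param L f x v : lipschitz_with L f -> forall e, 0 < e ->
  exists2 w, enorm w < e & {ae mu, forall s, differentiable f (x + w + s *: v)}.
Proof.
move=> fL e e0; have [d [T [m [Y [mY pY nY]]]]] := null_param_exists (leqnn k).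
pose Z := [set ts : T * R | ~ approx_diff f k (x + (Y ts.1 + ts.2 *: v))].
have mZ : measurable Z.
  apply: measurableC; apply: approx_diff_measurable fL; apply: measurable_shift => i.
  under eq_fun do rewrite !mxE.
  apply: measurable_funD; first exact: measurableT_comp (mY i) measurable_fst.
  by apply: measurable_funM => //; exact: measurable_snd.
have Z0 : prod_sf m mu Z = 0%E.
  apply: product_null2 => // s; rewrite -[RHS](nY L f (x + s *: v) fL).
  by congr (m _); apply/seteqP; split => t; rewrite /Z /= -!addrA [s *: v + _]addrC.
have [N [mN N0 HN]] : {ae m, forall t, mu (xsection Z t) = 0%E}.
  have := (@ae_eq_integral_abs _ _ _ m setT measurableT (fun t => mu (xsection Z t)) _).1.
  move=> /(_ (measurable_fun_xsection mu mZ)) H.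
  have {}H : ae_eq m setT (fun t => mu (xsection Z t)) (cst 0%E).
    apply: H; rewrite -[RHS]Z0 /prod_sf /product_measure1.
    by apply: eq_integral => t _ /=; rewrite gee0_abs.
  have F := ae_filter_ringOfSetsType m.
  by apply: filterS H => t /(_ Logic.I).
have [t te Nt] : exists2 t, enorm (Y t) < e & ~ N t.
  apply: contrapT => H; have /eqP := pY e e0; apply.
  apply: (subset_measure0 (B := N)) => //.
    rewrite -[X in measurable X]setTI.
    apply: (@measurable_preimage_open _ _ _ _ Y setT [set v | enorm v < e]) => //.
    rewrite (_ : [set v | _] = @enorm R k @^-1` [set t | t < e])//.
    by apply: open_comp => [? _|]; [exact: continuous_enorm|exact: open_lt].
  by move=> t te; apply: contrapT => Nt; apply: H; exists t.
exists (Y t) => //; exists (xsection Z t); split.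
- exact: measurable_xsection.
- by apply: contrapT => H; apply: Nt; apply: HN.
- move=> s /= H; rewrite xsectionE /Z /= => H2; apply: H.
  by apply: approx_diff_differentiable; rewrite -addrA.
Qed.

(** The inequality is integrated along a nearby parallel segment, which convexity keeps inside the
    ball; the Lipschitz bound charges the shift [w] at both ends. *)
Lemma rademacher_increment L f x v a h c r :
  lipschitz_with L f -> 0 <= h -> enorm (x - c) < r -> enorm (x + h *: v - c) < r ->
  (forall y, enorm (y - c) < r -> differentiable f y -> 'd f y v <= a) ->
  f (x + h *: v) - f x <= a * h.
Proof.
move=> fL h0 xc hc H; apply/ler_addgt0Pr => e e0.
pose b := Num.max (enorm (x - c)) (enorm (x + h *: v - c)).
have [b1 b2] : enorm (x - c) <= b /\ enorm (x + h *: v - c) <= b.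
  by rewrite !le_max !lexx orbT.
have br : b < r by rewrite gt_max xc hc.
have L1 : 0 < 2 * `|L| + 1 by rewrite ltr_wpDl// mulr_ge0.
pose d := Num.min (r - b) (e / (2 * `|L| + 1)).
have d0 : 0 < d by rewrite lt_min subr_gt0 br divr_gt0.
have [db de] : d <= r - b /\ d <= e / (2 * `|L| + 1) by rewrite !ge_min !lexx orbT.
have [w wd [N [mN N0 HN]]] := ae_good_param x v fL d0.
pose phi (s : R) := f (x + w + s *: v).
have inc : phi h - phi 0 <= a * (h - 0).
  apply: (lipschitz_increment_le (lipschitz_on_line (x + w) v fL)) => //.
  exists N; split => // s /= Hs; apply: HN => /= df; apply: Hs => /andP[s0 sh] _.
  rewrite derive1_line//; apply: H => //.
  have [h00|hn0] := eqVneq h 0.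
    have -> : s = 0 by apply/le_anti; rewrite s0 -h00 sh.
    rewrite scale0r addr0 addrAC; apply: (le_lt_trans (enorm_triangle _ _)); lra.
  have hp : 0 < h by rewrite lt_def hn0.
  pose th := s / h.
  have [th0 th1] : 0 <= th /\ th <= 1 by rewrite divr_ge0// ler_pdivrMr// mul1r.
  have -> : x + w + s *: v - c = ((1 - th) *: (x - c) + th *: (x + h *: v - c)) + w.
    have sE : s = th * h by rewrite divfK.
    by rewrite sE; apply/rowP => i; rewrite !mxE; ring.
  apply: (le_lt_trans (enorm_triangle _ _)).
  have := enorm_triangle ((1 - th) *: (x - c)) (th *: (x + h *: v - c)).
  rewrite !enormZ (ger0_norm th0) ger0_norm ?subr_ge0// => h1.
  have h2 : (1 - th) * enorm (x - c) <= (1 - th) * b by rewrite ler_wpM2l ?subr_ge0.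
  have h3 : th * enorm (x + h *: v - c) <= th * b by rewrite ler_wpM2l.
  by move: h1 h2 h3; lra.
rewrite subr0 /phi scale0r addr0 in inc.
have h1 := fL (x + h *: v) (x + w + h *: v).
have h2 := fL (x + w) x.
have e1 : x + h *: v - (x + w + h *: v) = - w by apply/rowP => i; rewrite !mxE; ring.
have e2 : x + w - x = w by rewrite addrAC subrr add0r.
rewrite e1 enormN in h1; rewrite e2 in h2.
have h3 : L * enorm w <= `|L| * d.
  apply: (@le_trans _ _ (`|L| * enorm w)); first by rewrite ler_wpM2r ?enorm_ge0 ?ler_norm.
  by rewrite ler_wpM2l// ltW.
have h4 : 2 * `|L| * d <= e.
  apply: (@le_trans _ _ (d * (2 * `|L| + 1))); last by rewrite -ler_pdivlMr.
  by rewrite mulrC ler_wpM2l ?(ltW d0)// lerDl.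
have := ler_norm (f (x + h *: v) - f (x + w + h *: v)).
have := ler_norm (f (x + w) - f x).
by move: inc h1 h2 h3 h4; lra.
Qed.
End RademacherAE.

(** * Radial retraction and localisation *)

Section RadialRetraction.
Variables (R : realType) (k : nat).
Implicit Types (f : 'rV[R]_k -> R) (x y z v w : 'rV[R]_k) (L rho : R).

(** Serves twice: to extend a function that is Lipschitz on a ball, and to cut off the right-hand
    side of the system. The constant [2] in [retract_lip] is crude, but follows from the triangle
    inequality alone. *)
Definition retract rho x : 'rV[R]_k := if enorm x <= rho then x else (rho / enorm x) *: x.

Lemma retract_id rho x : enorm x <= rho -> retract rho x = x.
Proof. by rewrite /retract => ->. Qed.

Lemma retract_le rho x : 0 <= rho -> enorm (retract rho x) <= rho.
Proof.
move=> rho0; rewrite /retract; case: ifPn => //; rewrite -ltNge => rx.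
have x0 : 0 < enorm x by exact: le_lt_trans rx.
by rewrite enormZ ger0_norm ?divr_ge0 ?enorm_ge0// divfK// gt_eqF.
Qed.

Lemma retract_lip rho x y : 0 <= rho ->
  enorm (retract rho x - retract rho y) <= 2 * enorm (x - y).
Proof.
move=> rho0.
have mixed u w : enorm u <= rho -> rho < enorm w ->
    enorm (u - (rho / enorm w) *: w) <= 2 * enorm (u - w).
  move=> ur wr; have w0 : 0 < enorm w by exact: le_lt_trans wr.
  apply: (le_trans (enorm_dist _ w _)).
  have -> : w - (rho / enorm w) *: w = ((enorm w - rho) / enorm w) *: w.
    by rewrite mulrBl divff ?gt_eqF// scalerBl scale1r.
  rewrite enormZ normrM normfV (ger0_norm (enorm_ge0 w)) divfK ?gt_eqF//.
  rewrite ger0_norm ?subr_ge0 ?(ltW wr)//.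
  have := ler_enormB w u; rewrite enormBC => h; have := ler_norm (enorm w - enorm u).
  by move: h; lra.
rewrite /retract; case: ifPn => xr; case: ifPn => yr.
- by have := enorm_ge0 (x - y); lra.
- by apply: mixed => //; rewrite ltNge.
- by rewrite enormBC [in leRHS]enormBC; apply: mixed => //; rewrite ltNge.
- rewrite -!ltNge in xr yr; have x0 := le_lt_trans rho0 xr; have y0 := le_lt_trans rho0 yr.
  have -> : (rho / enorm x) *: x - (rho / enorm y) *: y =
    (rho / enorm x) *: (x - y) + (rho / enorm x * (enorm y - enorm x) / enorm y) *: y.
    rewrite (_ : rho / enorm x * (enorm y - enorm x) / enorm y = rho / enorm x - rho / enorm y).
      by apply/rowP => i; rewrite !mxE; ring.
    by field; rewrite !gt_eqF.
  have q0 : 0 <= rho / enorm x by rewrite divr_ge0// enorm_ge0.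
  have q1 : rho / enorm x <= 1 by rewrite ler_pdivrMr// mul1r ltW.
  move: (rho / enorm x) q0 q1 => q q0 q1.
  apply: (le_trans (enorm_triangle _ _)); rewrite !enormZ !normrM normfV.
  rewrite (gtr0_norm y0) divfK ?gt_eqF// -mulrDr (ger0_norm q0).
  have h := ler_enormB y x; rewrite [in X in _ <= X]enormBC in h.
  have s0 : 0 <= enorm (x - y) + `|enorm y - enorm x| by rewrite addr_ge0 ?enorm_ge0.
  apply: (@le_trans _ _ (1 * (enorm (x - y) + `|enorm y - enorm x|))).
    by rewrite ler_wpM2r.
  by rewrite mul1r; lra.
Qed.

Lemma near_eq_differentiable f g y d : 0 < d ->
  (forall z, enorm (z - y) < d -> f z = g z) -> differentiable g y -> differentiable f y.
Proof.
move=> d0 H dg; have -> : f = g + (f - g) by rewrite addrC subrK.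
apply: differentiableD => //; apply: (@differentiable_enormP _ _ _ _ 0) => e e0.
exists d => // v vd; have -> : dotr 0 v = 0 by rewrite dotrC linear0.
have E z : enorm (z - y) < d -> (f - g) z = 0 by move=> /H zE; rewrite -[LHS]/(f z - g z) zE subrr.
rewrite !E; first by rewrite !subr0 normr0 mulr_ge0 ?enorm_ge0// ltW.
  by rewrite subrr enorm0.
by rewrite addrC addKr.
Qed.

Lemma near_eq_diff f g y d v : 0 < d ->
  (forall z, enorm (z - y) < d -> f z = g z) -> differentiable g y -> 'd f y v = 'd g y v.
Proof.
move=> d0 H dg; have df := near_eq_differentiable d0 H dg.
by rewrite -!deriveE//; apply: near_eq_derive; apply/nbhs_enormP; exists d.
Qed.

(** Composition with the retraction makes [f] globally Lipschitz and changes neither its values nor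
    its differentials inside the ball. *)
Lemma local_increment L f x v a h c r :
  (forall y z, enorm (y - c) <= r -> enorm (z - c) <= r -> `|f y - f z| <= L * enorm (y - z)) ->
  0 <= h -> enorm (x - c) < r -> enorm (x + h *: v - c) < r ->
  (forall y, enorm (y - c) < r -> differentiable f y -> 'd f y v <= a) ->
  f (x + h *: v) - f x <= a * h.
Proof.
move=> fL h0 xr hr H.
have r0 : 0 <= r by rewrite ltW// (le_lt_trans _ xr)// enorm_ge0.
pose g y := f (c + retract r (y - c)).
have gE y : enorm (y - c) <= r -> g y = f y by move=> yr; rewrite /g retract_id// subrKC.
have gL : lipschitz_with (`|L| * 2) g.
  move=> y z; apply: le_trans (fL _ _ _ _) _; rewrite ?[c + _]addrC ?addrK ?retract_le//.
  rewrite opprD addrACA subrr addr0 -mulrA.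
  apply: (@le_trans _ _ (`|L| * enorm (retract r (y - c) - retract r (z - c)))).
    by rewrite ler_wpM2r ?enorm_ge0// ler_norm.
  rewrite ler_wpM2l//; apply: (le_trans (retract_lip _ _ r0)).
  by rewrite opprD addrACA subrr addr0.
rewrite -(gE _ (ltW xr)) -(gE _ (ltW hr)); apply: (rademacher_increment gL) xr hr _ => // y yr dg.
have d0 : 0 < r - enorm (y - c) by rewrite subr_gt0.
have near_fg z : enorm (z - y) < r - enorm (y - c) -> f z = g z.
  by move=> zy; rewrite gE//; apply: (le_trans (enorm_dist _ y _)); lra.
rewrite -(near_eq_diff v d0 near_fg dg); apply: H => //.
exact: near_eq_differentiable d0 near_fg dg.
Qed.

End RadialRetraction.

(** * Gains and the small-gain condition *)

Lemma le_sum_term (R : realDomainType) (I : finType) (F : I -> R) i :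
  (forall i, 0 <= F i) -> F i <= \sum_i F i.
Proof. by move=> F0; rewrite (bigD1 i)//= lerDl sumr_ge0. Qed.

Section FiniteKinf.
Variable R : realType.

Lemma eq_isKinf (g h : R -> R) : (forall r, 0 <= r -> g r = h r) -> isKinf h -> isKinf g.
Proof.
move=> E Ih; apply: isKinf_of_surj => [r r0|a b a0 ab|y y0].
- by rewrite E// (isK_ge0 Ih.1).
- by rewrite !E// ?(isK_lt Ih.1)// (le_trans a0)// ltW.
- by have [x x0 <-] := isKinf_surj Ih y0; exists x => //; rewrite E.
Qed.

Lemma isKinfD0 (g h : R -> R) : isKinf g -> isKinf0 h -> isKinf (fun r => g r + h r).
Proof.
move=> Ig [Ih|h0]; first exact: isKinfDl Ig Ih.1.
by apply: (eq_isKinf _ Ig) => r r0; rewrite h0// addr0.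
Qed.

Lemma isKinfD_sum (I : Type) (s : seq I) (g : R -> R) (h : I -> R -> R) :
  isKinf g -> (forall i, isKinf0 (h i)) -> isKinf (fun r => g r + \sum_(i <- s) h i r).
Proof.
move=> Ig Ih; elim: s => [|i s IH].
  by apply: (eq_isKinf _ Ig) => r _; rewrite big_nil addr0.
apply: (@eq_isKinf _ (fun r => (g r + \sum_(i <- s) h i r) + h i r)).
  by move=> r _; rewrite big_cons [h i r + _]addrC addrA.
exact: isKinfD0.
Qed.

Lemma isKinf_iter m (g : R -> R) : isKinf g -> isKinf (iter m g).
Proof.
move=> Ig; elim: m => [|m IH]; first exact: isKinf_id.
exact: (isKinf_comp Ig IH).
Qed.

Lemma isKinf_finite_min (I : finType) (h : I -> R -> R) : (forall i, isKinf (h i)) ->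
  exists2 p, isKinf p & forall i r, 0 <= r -> p r <= h i r.
Proof.
move=> Ih.
suff [p Ip H] : exists2 p, isKinf p & forall i r, i \in enum I -> 0 <= r -> p r <= h i r.
  by exists p => // i r r0; apply: H; rewrite ?mem_enum.
elim: (enum I) => [|i s [p Ip H]]; first by exists id; [exact: isKinf_id|].
exists (fun r => Num.min (h i r) (p r)); first exact: isKinf_min.
move=> j r; rewrite inE ge_min => /predU1P[->|js] r0; first by rewrite lexx.
by rewrite H ?orbT.
Qed.

Lemma isKinf_finite_max (I : finType) (h : I -> R -> R) : (forall i, isKinf (h i)) ->
  exists2 p, isKinf p & forall i r, 0 <= r -> h i r <= p r.
Proof.
move=> Ih.
suff [p Ip H] : exists2 p, isKinf p & forall i r, i \in enum I -> 0 <= r -> h i r <= p r.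
  by exists p => // i r r0; apply: H; rewrite ?mem_enum.
elim: (enum I) => [|i s [p Ip H]]; first by exists id; [exact: isKinf_id|].
exists (fun r => Num.max (h i r) (p r)); first exact: isKinf_max.
move=> j r; rewrite inE le_max => /predU1P[->|js] r0; first by rewrite lexx.
by rewrite H ?orbT.
Qed.

Lemma isKinf0_ge0 (g : R -> R) r : isKinf0 g -> 0 <= r -> 0 <= g r.
Proof. by move=> [[Kg _]|g0] r0; [exact: isK_ge0 Kg r0|rewrite g0]. Qed.

Lemma isKinf0_le (g : R -> R) a b : isKinf0 g -> 0 <= a -> a <= b -> g a <= g b.
Proof.
move=> [[Kg _]|g0] a0 ab; first exact: isK_le.
by rewrite !g0// (le_trans a0).
Qed.

Lemma isKinf0_continuous (g : R -> R) : isKinf0 g -> continuous (fun x : R => g (Num.max x 0)).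
Proof.
move=> [[Kg _]|g0]; first exact: isK_continuous_max.
rewrite (_ : (fun x => _) = fun=> 0); first by move=> x; exact: cvg_cst.
by apply/funext => x; rewrite g0// le_max lexx orbT.
Qed.

End FiniteKinf.

Section Gains.
Variables (R : realType) (n : nat) (isSum : pred 'I_n) (g : 'I_n -> 'I_n -> R -> R).
Hypothesis hg : forall i j, isKinf0 (g i j).
Implicit Types (z s : 'I_n -> R) (i j : 'I_n) (c r u : R).
Local Notation nonneg z := (forall i, 0 <= z i).
Local Notation Gamma := (Gam isSum g).

Definition vmax z : R := \big[Num.max/0]_i z i.

Lemma vmax_ge0 z : 0 <= vmax z.
Proof. exact: bigmax_ge_id. Qed.

Lemma le_vmax z i : z i <= vmax z.
Proof. exact: le_bigmax. Qed.

Lemma vmax_le z c : 0 <= c -> (forall i, z i <= c) -> vmax z <= c.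
Proof. by move=> c0 H; apply/bigmax_leP; split => // i _. Qed.

Lemma Gam_ge0 z i : nonneg z -> 0 <= Gamma z i.
Proof.
move=> z0; rewrite /Gam; case: ifP => _; last exact: bigmax_ge_id.
by apply: sumr_ge0 => j _; exact: isKinf0_ge0.
Qed.

Lemma Gam_le z s i : nonneg z -> (forall j, z j <= s j) -> Gamma z i <= Gamma s i.
Proof.
move=> z0 zs; rewrite /Gam; case: ifP => _.
  by apply: ler_sum => j _; exact: isKinf0_le.
by apply: le_bigmax2 => j _; exact: isKinf0_le.
Qed.

Section SmallGain.
Variable alpha : R -> R.
Hypothesis Ialpha : isKinf alpha.
Hypothesis alpha_lip : forall r s : R, `|alpha r - alpha s| <= `|r - s|.
Hypothesis smallgain : forall z, nonneg z -> (exists i, z i != 0) ->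
  exists i, Gamma (Dalpha isSum alpha z) i < z i.

Let a_le (r s : R) : r <= s -> alpha s <= alpha r + (s - r).
Proof.
move=> rs; have := alpha_lip s r; rewrite [in leRHS]ger0_norm ?subr_ge0//.
by move=> /(le_trans (ler_norm _)); lra.
Qed.

(** [Dalpha] is a bijection of the orthant, so [z] is the image of some [s]. Applying [id + alpha]
    to both sides of [Gam z i < s i] on a summation row moves the enlargement from the argument of
    [Gam] to its value. *)
Lemma smallgain_out z : nonneg z -> (exists i, z i != 0) ->
  exists i, Gamma z i + (if isSum i then alpha (Gamma z i) else 0) < z i.
Proof.
move=> z0 [k zk].
pose D (r : R) : R := r + alpha r.
have ID : isKinf D by apply: isKinfDl; [exact: isKinf_id|exact: Ialpha.1].
have /choice[s sP] : forall i, exists u : R, 0 <= u /\ (if isSum i then D u else u) = z i.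
  move=> i; case: (isSum i); last by exists (z i).
  by have [x x0 xz] := isKinf_surj ID (z0 i); exists x.
have Ds : Dalpha isSum alpha s = z.
  by apply/funext => i; rewrite /Dalpha; have [_ <-] := sP i; case: ifP.
have [|] := smallgain (z := s) (fun i => (sP i).1).
  exists k; apply: contra zk => /eqP sk; have [_ <-] := sP k; rewrite sk /D.
  by case: ifP => _ //; case: Ialpha.1 => -> _ _ _; rewrite addr0.
move=> i; rewrite Ds => Hi; exists i; have [si0 <-] := sP i.
case: ifP => // _; last by rewrite addr0.
have G0 := Gam_ge0 i z0.
by have := isK_lt ID.1 G0 si0; rewrite Hi.
Qed.

(* Enlarging by half of [alpha] leaves the other half for [bounded_solutions]; along the path
   it is the margin that absorbs the inputs. *)
Definition Amap z i : R := Gamma z i + (if isSum i then alpha (Gamma z i) / 2 else 0).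

Lemma Amap_le z s i : nonneg z -> (forall j, z j <= s j) -> Amap z i <= Amap s i.
Proof.
move=> z0 zs; rewrite /Amap lerD ?Gam_le//; case: ifP => // _.
by rewrite ler_pM2r// (isK_le Ialpha.1) ?Gam_ge0 ?Gam_le.
Qed.

Lemma Gam_le_Amap z i : nonneg z -> Gamma z i <= Amap z i.
Proof.
move=> z0; rewrite /Amap lerDl; case: ifP => // _.
by rewrite divr_ge0// (isK_ge0 Ialpha.1)// Gam_ge0.
Qed.

Lemma Amap_ge0 z i : nonneg z -> 0 <= Amap z i.
Proof. by move=> z0; exact: le_trans (Gam_ge0 i z0) (Gam_le_Amap i z0). Qed.

(* If [z <= max (A z) c], one more index is bounded at each step: the indices already
   bounded by [b] contribute at most [Q b] to a gain, which the margin between [A] and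
   the small-gain condition absorbs as soon as [alpha y >= 3 * Q b]. *)
Lemma bounded_solutions : exists2 C, isKinf C & (forall c, 0 <= c -> c <= C c) /\
  forall c z, 0 <= c -> nonneg z -> (forall i, z i <= Num.max (Amap z i) c) ->
    forall i, z i <= C c.
Proof.
pose Q (c : R) : R := c + \sum_(p : 'I_n * 'I_n) g p.1 p.2 c.
have IQ : isKinf Q by apply: isKinfD_sum => //; exact: isKinf_id.
have [av Iav avP] := isKinf_inv Ialpha.
pose Y (c : R) : R := av (3 * Q c).
have IY : isKinf Y.
  by apply: (isKinf_comp Iav); apply: isKinfM_cst.
pose H (r : R) : R := r + alpha r / 2.
have IH : isKinf H.
  apply: isKinfDl; first exact: isKinf_id.
  by have := isKinfM_cst (c := 2^-1) Ialpha ltac:(lra) => -[]; under eq_fun do rewrite mulrC.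
(* Bounds the next index in either case: a summation row whose unbounded part is at most [Y b] gives
   [H (Y b + Q b)], and a maximum row gives [Q b]. *)
pose C1 := H \o (fun c => Y c + Q c).
have IC1 : isKinf C1 by apply: isKinf_comp => //; exact: isKinfDl IY IQ.1.
have Q0 c : 0 <= c -> 0 <= Q c by exact: isK_ge0 IQ.1.
have Y0 c : 0 <= c -> 0 <= Y c by exact: isK_ge0 IY.1.
have gQs c i : 0 <= c -> \sum_j g i j c <= Q c.
  move=> c0; apply: ler_wpDl => //; rewrite -(pair_bigA _ (fun i j => g i j c)) /=.
  apply: (@le_sum_term _ _ (fun i => \sum_j g i j c)) => l.
  by rewrite sumr_ge0// => j _; exact: isKinf0_ge0.
have gQ c i j : 0 <= c -> g i j c <= Q c.
  move=> c0; apply: le_trans (gQs c i c0); apply: (@le_sum_term _ _ (fun j => g i j c)).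
  by move=> l; exact: isKinf0_ge0.
have cQ c : 0 <= c -> c <= Q c.
  by move=> c0; rewrite lerDl sumr_ge0// => p _; exact: isKinf0_ge0.
have rH r : 0 <= r -> r <= H r.
  by move=> r0; rewrite lerDl divr_ge0// (isK_ge0 Ialpha.1).
have QC1 c : 0 <= c -> Q c <= C1 c.
  move=> c0; apply: le_trans (rH _ _); last by rewrite addr_ge0 ?Y0 ?Q0.
  by rewrite lerDr Y0.
have cC1 c : 0 <= c -> c <= C1 c by move=> c0; exact: le_trans (cQ c c0) (QC1 c c0).
have C1_0 c : 0 <= c -> 0 <= C1 c by move=> c0; exact: le_trans (cC1 c c0).
have it0 m c : 0 <= c -> 0 <= iter m C1 c by move=> c0; elim: m => //= m; exact: C1_0.
have itc m c : 0 <= c -> c <= iter m C1 c.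
  move=> c0; elim: m => //= m h; apply: le_trans h _; exact/cC1/it0.
exists (iter n C1); first exact: isKinf_iter.
split=> [c c0|c z c0 z0 Hz]; first exact: itc.
suff step m : (m <= n)%N -> exists J : {set 'I_n}, (m <= #|J|)%N /\
    forall i, i \in J -> z i <= iter m C1 c.
  have [J [nJ HJ]] := step n (leqnn n) => i; apply: HJ.
  have : J == [set: 'I_n]%SET by rewrite eqEcard finset.subsetT cardsT card_ord.
  by move=> /eqP ->; rewrite inE.
elim: m => [_|m IHm mn].
  by exists finset.set0; split => // i; rewrite inE.
have [J [mJ HJ]] := IHm (ltnW mn); set b := iter m C1 c in HJ.
have b0 : 0 <= b by exact: it0.
have [JT|JT] := eqVneq J [set: 'I_n]%SET.
  exists J; split; first by rewrite JT cardsT card_ord.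
  by move=> i iJ; apply: (le_trans (HJ i iJ)); exact: cC1.
suff [i iJ zi] : exists2 i, i \notin J & z i <= C1 b.
  exists (i |: J)%SET; split; first by rewrite cardsU1 iJ add1n.
  move=> j; rewrite !inE => /predU1P[->//|/HJ zj]; apply: (le_trans zj); exact: cC1.
apply: contrapT => no.
have big i : i \notin J -> C1 b < z i.
  by move=> iJ; rewrite ltNge; apply/negP => zi; apply: no; exists i.
(* Erasing the indices already bounded leaves a nonzero vector; the row singled out by the
   small-gain condition lies outside [J], since its entry must be positive. *)
pose s i := if i \in J then 0 else z i.
have s0 i : 0 <= s i by rewrite /s; case: ifP.
have [k kJ] : exists k, k \notin J.
  apply: contrapT => nk; move/eqP: JT; apply; apply/setP => i; rewrite inE.
  by apply: contrapT => /negP iJ; apply: nk; exists i.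
have [|i] := smallgain_out s0.
  by exists k; rewrite /s (negbTE kJ) gt_eqF// (le_lt_trans _ (big k kJ))// C1_0.
have y0 := Gam_ge0 i s0; set y := Gamma s i in y0 *.
have [iJ|iJ] := boolP (i \in J).
  have -> : s i = 0 by rewrite /s iJ.
  rewrite ltNge => /negP; apply; rewrite addr_ge0//; case: ifP => // _.
  exact: isK_ge0 Ialpha.1 _.
have -> : s i = z i by rewrite /s (negbTE iJ).
move=> Bi; have zA : z i <= Amap z i.
  have := Hz i; rewrite le_max => /orP[//|zc].
  have := lt_le_trans (big i iJ) zc; have := cC1 b b0; have := itc m c c0; rewrite -/b; lra.
have q0 := Q0 b b0; have bi := big i iJ.
have gs j : g i j (z j) <= Num.max (g i j (s j)) (if j \in J then g i j b else 0).
  rewrite /s le_max; case: ifPn => [jJ|_]; last by rewrite lexx.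
  by rewrite (isKinf0_le (hg i j) (z0 j) (HJ j jJ)) orbT.
move: zA Bi; rewrite /Amap; case: ifPn => [Si|Si].
- have GQ : Gamma z i <= y + Q b.
    rewrite /y /Gam Si; apply: (@le_trans _ _ (\sum_j (g i j (s j) + g i j b))).
      apply: ler_sum => j _; apply: (le_trans (gs j)).
      rewrite ge_max lerDl (isKinf0_ge0 (hg i j) b0)/=; case: ifP => _.
        by rewrite lerDr (isKinf0_ge0 (hg i j)).
      by rewrite addr_ge0// (isKinf0_ge0 (hg i j)).
    by rewrite big_split /= lerD2l gQs.
  have G0 := Gam_ge0 i z0; move=> zA Bi.
  have HA : z i <= H (y + Q b).
    by apply: (le_trans zA); apply: (isK_le IH.1).
  have yY : ~ y <= Y b.
    move=> yY; have := lt_le_trans bi HA; rewrite ltNge => /negP; apply.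
    by apply: (isK_le IH.1); [rewrite addr_ge0|rewrite /= lerD2r].
  have ay : 3 * Q b <= alpha y.
    rewrite leNgt; apply/negP => ay; apply: yY; rewrite /Y -(avP y y0).1.
    by apply: (isK_le Iav.1); [exact: isK_ge0 Ialpha.1 _|exact: ltW].
  (* As [alpha] is 1-Lipschitz, [z i <= H (y + Q b) <= y + alpha y / 2 + 3 * Q b / 2 <= y + alpha y
     < z i]; hence the factor [3] in [Y]. *)
  have := a_le (r := y) (s := y + Q b); rewrite lerDl q0 => /(_ isT).
  by move: HA; rewrite /H; lra.
- rewrite !addr0 => zA yz.
  have : Gamma z i <= Num.max y (Q b).
    rewrite /y /Gam (negbTE Si); apply/bigmax_leP; split.
      by rewrite le_max q0 orbT.
    move=> j _; apply: (le_trans (gs j)); rewrite ge_max !le_max.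
    rewrite (le_bigmax _ (fun j => g i j (s j))) /=; apply/orP; right; case: ifP => _ //.
    exact: gQ.
  rewrite le_max => /orP[h|h]; first by move: yz; rewrite ltNge (le_trans zA h).
  have := le_trans zA h; have := QC1 b b0; lra.
Qed.

End SmallGain.
End Gains.

(** * Decay points and bi-infinite chains *)

Section Chain.
Variables (R : realType) (n : nat) (isSum : pred 'I_n) (g : 'I_n -> 'I_n -> R -> R).
Variables (alpha C eps : R -> R).
Hypothesis hg : forall i j, isKinf0 (g i j).
Hypothesis Ialpha : isKinf alpha.
Implicit Types (z s w : 'I_n -> R) (i j : 'I_n) (b c r u : R).
Local Notation nonneg z := (forall i, 0 <= z i).
Local Notation A := (Amap isSum g alpha).
Hypothesis IC : isKinf C.
Hypothesis Ieps : isKinf eps.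
Hypothesis Ceps : forall r, 0 <= r -> C (eps r) = r / 2.
Hypothesis leC : forall c, 0 <= c -> c <= C c.
Hypothesis Cbound : forall c z, 0 <= c -> nonneg z ->
  (forall i, z i <= Num.max (A z i) c) -> forall i, z i <= C c.

(* The [eps] term keeps all components of a decay point comparable with the largest one. *)
Definition Tmap z i : R := Num.max (A z i) (eps (vmax z)).

Let eps0 r : 0 <= r -> 0 <= eps r. Proof. exact: isK_ge0 Ieps.1. Qed.
Let C0 r : 0 <= r -> 0 <= C r. Proof. exact: isK_ge0 IC.1. Qed.

Lemma vmax_mono z s : (forall i, z i <= s i) -> vmax z <= vmax s.
Proof. by move=> zs; apply: le_bigmax2 => i _. Qed.

Lemma Tmap_ge0 z i : nonneg z -> 0 <= Tmap z i.
Proof. by move=> z0; rewrite le_max Amap_ge0. Qed.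

Lemma Tmap_le z s i : nonneg z -> (forall j, z j <= s j) -> Tmap z i <= Tmap s i.
Proof.
move=> z0 zs; rewrite ge_max !le_max Amap_le//=.
by rewrite (isK_le Ieps.1) ?vmax_ge0 ?vmax_mono ?orbT.
Qed.

(** [Cbound] applies at the level [max (eps (vmax z)) c]. If the first term wins,
    [C (eps r) = r / 2] gives [vmax z <= vmax z / 2], so [z] vanishes. *)
Lemma Tmap_bound z c : 0 <= c -> nonneg z -> (forall i, z i <= Num.max (Tmap z i) c) ->
  vmax z <= C c.
Proof.
move=> c0 z0 H; have e0 := eps0 (vmax_ge0 z).
have m0 : 0 <= Num.max (eps (vmax z)) c by rewrite le_max c0 orbT.
have Hz : forall i, z i <= C (Num.max (eps (vmax z)) c).
  apply: Cbound => // i; apply: (le_trans (H i)).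
  by rewrite /Tmap !ge_max !le_max !lexx !orbT.
have := vmax_le (C0 m0) Hz.
have [ec|ce] := leP (eps (vmax z)) c; first by [].
rewrite Ceps ?vmax_ge0// => h; have := vmax_ge0 z; have := C0 c0; lra.
Qed.

Lemma Tmap_fix0 z i : nonneg z -> (forall i, z i <= Tmap z i) -> z i = 0.
Proof.
move=> z0 H; apply/le_anti; rewrite z0 andbT.
have := Tmap_bound (lexx 0) z0; case: IC.1 => -> _ _ _ h.
by apply: le_trans (le_vmax z i) (h _) => l; rewrite le_max H.
Qed.

(** Tarski's argument. The vectors with [z <= max (T z) r] are bounded by [C r]; their
    coordinatewise supremum [s] satisfies [s <= w] for [w = max (T s) r], and [w] is itself such a
    vector, whence [w <= s]. *)
Lemma decay_point r : 0 <= r ->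
  exists s, [/\ (forall i, r <= s i) & forall i, Tmap s i <= s i].
Proof.
move=> r0.
pose S := [set z | nonneg z /\ forall i, z i <= Num.max (Tmap z i) r].
pose V i := [set z i | z in S].
have Vub i : ubound (V i) (C r).
  move=> _ [z [z0 Hz] <-]; apply: le_trans (le_vmax z i) _; exact: Tmap_bound.
have Sr : S (fun=> r) by split => // i; rewrite le_max lexx orbT.
have Vs i : has_sup (V i) by split; [exists r, (fun=> r)|exists (C r); exact: Vub].
pose s i := sup (V i).
have Ss z : S z -> forall i, z i <= s i.
  by move=> Sz i; apply: (ub_le_sup (Vs i).2); exists z.
have sr i : r <= s i by exact: (Ss _ Sr).
have s0 i : 0 <= s i by exact: le_trans r0 (sr i).
pose w i := Num.max (Tmap s i) r.
have sw i : s i <= w i.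
  apply: (ge_sup (Vs i).1) => _ [z [z0 Hz] <-]; apply: (le_trans (Hz i)).
  rewrite /w ge_max; apply/andP; split; rewrite le_max ?lexx ?orbT// Tmap_le//.
  by apply: Ss; split.
have Sw : S w.
  split=> i; first by rewrite /w le_max r0 orbT.
  by rewrite [leLHS]/w ge_max; apply/andP; split; rewrite le_max ?lexx ?orbT// Tmap_le.
exists s; split => // i; apply: le_trans (Ss _ Sw i).
by rewrite /w le_max lexx.
Qed.

Section Limits.
Variables (I : Type) (F : set_system I).
Hypothesis FF : ProperFilter F.
Variables (z : I -> 'I_n -> R) (l : 'I_n -> R).
Hypothesis z0 : forall t, nonneg (z t).
Hypothesis zl : forall i, z t i @[t --> F] --> l i.

Lemma limit_ge0 : nonneg l.
Proof.
move=> i; apply: (cvgr_to_ge (@zl i)).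
by apply: nearW => t; exact: z0.
Qed.

Lemma vmax_cvg (f : I -> 'I_n -> R) (m : 'I_n -> R) :
  (forall i, f t i @[t --> F] --> m i) -> vmax (f t) @[t --> F] --> vmax m.
Proof.
move=> fm; rewrite /vmax.
by apply: (@cvg_big _ _ _ _ (fun=> true) _ _ _ _ (fun i t => f t i) m) => //;
  exact: max_continuous.
Qed.

Lemma Kcvg (h : R -> R) (f : I -> R) (m : R) : (forall t, 0 <= f t) -> 0 <= m ->
  continuous (fun x : R => h (Num.max x 0)) -> f t @[t --> F] --> m ->
  h (f t) @[t --> F] --> h m.
Proof.
move=> f0 m0 hc fm; have := continuous_cvg _ (hc m) fm.
have -> : (fun x : R => h (Num.max x 0)) \o f = (fun t => h (f t)).
  by apply/funext => t /=; rewrite max_l.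
by move=> H; rewrite (max_l m0) in H; exact: H.
Qed.

Lemma Gam_cvg i : Gam isSum g (z t) i @[t --> F] --> Gam isSum g l i.
Proof.
have gc j : g i j (z t j) @[t --> F] --> g i j (l j).
  apply: Kcvg => //; first exact: limit_ge0.
  exact: isKinf0_continuous.
rewrite /Gam; case: ifP => _; last exact: vmax_cvg.
by apply: (@cvg_big _ _ _ _ (fun=> true) _ _ _ _ (fun j t => g i j (z t j))) => //;
  exact: add_continuous.
Qed.

Lemma Tmap_cvg i : Tmap (z t) i @[t --> F] --> Tmap l i.
Proof.
have Ac : A (z t) i @[t --> F] --> A l i.
  rewrite /Amap; case: ifP => _; last by under eq_fun do rewrite addr0; rewrite addr0; exact: Gam_cvg.
  apply: cvgD; first exact: Gam_cvg.
  apply: cvgM; last exact: cvg_cst.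
  apply: Kcvg; [by move=> t; exact: Gam_ge0|exact/Gam_ge0/limit_ge0| |exact: Gam_cvg].
  exact: isK_continuous_max Ialpha.1.
have ec : eps (vmax (z t)) @[t --> F] --> eps (vmax l).
  apply: Kcvg; [by move=> t; exact: vmax_ge0|exact: vmax_ge0| |exact: vmax_cvg].
  exact: isK_continuous_max Ieps.1.
rewrite /Tmap maxr_absE; under eq_fun do rewrite maxr_absE.
apply: cvgM; last exact: cvg_cst.
by apply: cvgD; [exact: cvgD|apply: cvg_norm; exact: cvgB].
Qed.
End Limits.

(* Averaging makes [Pmap] strictly decreasing on decay points of [Tmap] that are not fixed. *)
Definition Pmap z i : R := (z i + Tmap z i) / 2.

Lemma Pmap_decay z : nonneg z -> (forall i, Tmap z i <= z i) ->
  [/\ nonneg (Pmap z), (forall i, Pmap z i <= z i), (forall i, Tmap z i <= Pmap z i) &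
     forall i, Tmap (Pmap z) i <= Pmap z i].
Proof.
move=> z0 Tz.
have P0 : nonneg (Pmap z) by move=> i; rewrite divr_ge0// addr_ge0// Tmap_ge0.
have Pz i : Pmap z i <= z i by rewrite /Pmap; have := Tz i; lra.
have TP i : Tmap z i <= Pmap z i by rewrite /Pmap; have := Tz i; lra.
by split => // i; apply: le_trans (TP i); exact: Tmap_le.
Qed.

Lemma iter_Pmap_decay z m : nonneg z -> (forall i, Tmap z i <= z i) ->
  nonneg (iter m Pmap z) /\ forall i, Tmap (iter m Pmap z) i <= iter m Pmap z i.
Proof.
move=> z0 Tz; elim: m => //= m [h1 h2]; have [] := Pmap_decay h1 h2.
by move=> ? _ _ ?.
Qed.

(** When [z] and [y] are successive terms of an orbit with a common limit, that limit is a fixed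
    point. *)
Lemma Pmap_limit_fix (I : Type) (F : set_system I) (FF : ProperFilter F)
    (y z : I -> 'I_n -> R) (l : 'I_n -> R) :
  (forall t, nonneg (z t)) -> (\forall t \near F, y t = Pmap (z t)) ->
  (forall i, z t i @[t --> F] --> l i) -> (forall i, y t i @[t --> F] --> Pmap l i).
Proof.
move=> z0 yz zl i.
have H : Pmap (z t) i @[t --> F] --> Pmap l i.
  apply: cvgM; last exact: cvg_cst.
  by apply: cvgD; [exact: zl|exact: Tmap_cvg].
apply: cvg_trans H; apply: near_eq_cvg; near=> t.
by rewrite (near yz t).
Unshelve. all: by end_near. Qed.

Lemma Pmap_fix0 l i : nonneg l -> (forall i, Pmap l i = l i) -> l i = 0.
Proof.
move=> l0 Pl; apply: Tmap_fix0 => // {}i; have := Pl i; rewrite /Pmap; lra.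
Qed.

Lemma iter_Pmap_to0 z : nonneg z -> (forall i, Tmap z i <= z i) ->
  forall i, iter m Pmap z i @[m --> \oo] --> (0 : R).
Proof.
move=> z0 Tz; have D m := iter_Pmap_decay m z0 Tz.
pose y m := iter m Pmap z.
have dec i : {homo (fun m => y m i) : a b / (a <= b)%N >-> b <= a}.
  apply/nonincreasing_seqP => m; rewrite /y /=.
  by have [_ + _ _] := Pmap_decay (D m).1 (D m).2.
have yl i : y m i @[m --> \oo] --> inf (range (fun m => y m i)).
  apply: nonincreasing_cvgn => //; exists 0 => _ [m _ <-]; exact: (D m).1.
pose l i := inf (range (fun m => y m i)).
have yP i : y m.+1 i @[m --> \oo] --> Pmap l i.
  apply: (@Pmap_limit_fix _ \oo _ (fun m => y m.+1) y) => //; last by apply: nearW.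
  by move=> m; exact: (D m).1.
have Pl i : Pmap l i = l i.
  have h : y m.+1 i @[m --> \oo] --> l i by have := yl i; rewrite -(cvg_shiftS (fun m => y m i)).
  exact: (cvg_unique _ (yP i) h).
have l0 i : 0 <= l i.
  by apply: lb_le_inf; [exists (y 0%N i), 0%N|move=> _ [m _ <-]; exact: (D m).1].
by move=> i; have h := yl i; rewrite -/(l i) (Pmap_fix0 i l0 Pl) in h; exact: h.
Qed.

(** An ultrafilter decides every inequality [x <= u m], so the supremum of the levels [x] for which
    it holds is the limit. *)
Lemma ultra_bounded_cvg (U : set_system nat) (u : nat -> R) b : UltraFilter U ->
  U [set m | 0 <= u m <= b] -> exists l : R, u m @[m --> U] --> l.
Proof.
move=> UU Ub; pose S := [set x | U [set m | x <= u m]].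
have S0 : S 0 by apply: filterS Ub => m /= /andP[].
have Sub : ubound S b.
  move=> x Sx; have [m [/= h1 /andP[_ h2]]] := filter_ex (filterI Sx Ub).
  exact: le_trans h1 h2.
exists (sup S); apply/cvgrPdist_lt => e e0.
have h1 : U [set m | sup S - e < u m].
  have [|x Sx xe] := @sup_adherent _ S e e0; first by split; [exists 0|exists b].
  by apply: filterS Sx => m /= ; exact: lt_le_trans.
have h2 : U [set m | u m < sup S + e].
  have [h|h] := in_ultra_setVsetC [set m | sup S + e <= u m] UU.
    have : sup S + e <= sup S by apply: ub_le_sup => //; exists b.
    by lra.
  by apply: filterS h => m /= /negP; rewrite -ltNge.
apply: filterS2 h1 h2 => m /= h1 h2; rewrite ltr_distlC; apply/andP; split; lra.
Qed.

(** An ascending orbit would require inverting [Pmap]. It is obtained as a limit of orbits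
    descending from ever larger decay points, each indexed backwards from its first entry into
    [vmax <= 1]. *)
Lemma upward_orbit (i0 : 'I_n) : exists c : nat -> 'I_n -> R,
  [/\ (forall m, nonneg (c m)), (forall m i, Tmap (c m) i <= c m i),
      (forall m, c m = Pmap (c m.+1)) & 1 <= vmax (c 1%N)].
Proof.
have /choice[s sP] : forall N : nat, exists s, [/\ (forall i, N%:R <= s i) &
    forall i, Tmap s i <= s i] by move=> N; exact: decay_point.
have s0 N i : 0 <= s N i by have [h _] := sP N; exact: le_trans (h i).
have sT N i : Tmap (s N) i <= s N i by have [_ h] := sP N; exact: h.
have exK N : exists m, vmax (iter m Pmap (s N)) <= 1.
  have : vmax (iter m Pmap (s N)) @[m --> \oo] --> vmax (fun _ : 'I_n => 0 : R).
    apply: (@vmax_cvg nat \oo _ (fun m => iter m Pmap (s N)) (fun=> 0)) => i.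
    exact: iter_Pmap_to0.
  move=> /(cvgr_le _)/(_ 1) H.
  have [|m _ Hm] := H; last by exists m; apply: Hm => /=.
  by apply: le_lt_trans (ltr01); apply: vmax_le.
pose K N := ex_minn (exK N).
have KP N : vmax (iter (K N) Pmap (s N)) <= 1 by rewrite /K; case: ex_minnP.
have Kmin N m : (m < K N)%N -> 1 < vmax (iter m Pmap (s N)).
  rewrite /K; case: ex_minnP => k _ kmin mk; rewrite ltNge; apply/negP => /kmin.
  by rewrite leqNgt mk.
pose cN N m := iter (K N - m) Pmap (s N).
have cND N m := iter_Pmap_decay (K N - m) (s0 N) (sT N).
have cNS N m : (m < K N)%N -> cN N m = Pmap (cN N m.+1).
  by move=> mK; rewrite /cN -iterS subnS prednK// subn_gt0.
(* If [vmax (Pmap z) <= b] then [eps (vmax z) <= 2 * b], and applying [C] gives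
   [vmax z / 2 <= C (2 * b)]. This bounds the re-indexed orbits uniformly in [N]. *)
pose B (b : R) := 2 * C (2 * b); pose b m := iter m B 1.
have bb m : 0 <= b m <= b m.+1.
  have leB b' : 0 <= b' -> b' <= B b'.
    move=> b0; have := @leC (2 * b') ltac:(lra); rewrite /B; lra.
  have b0 : 0 <= b m.
    by elim: m => [|m h]; [exact: ler01|apply: (le_trans h); exact: leB].
  by rewrite b0 /=; exact: leB.
have bmono m m' : (m <= m')%N -> b m <= b m'.
  move=> /subnK <-; elim: (m' - m)%N => [//|d h]; rewrite addSn; apply: (le_trans h).
  by have /andP[] := bb (d + m)%N.
have bound N m : (m <= K N)%N -> vmax (cN N m) <= b m.
  elim: m => [_|m IH mK]; first by rewrite /cN subn0.
  have := IH (ltnW mK); rewrite cNS// => vm.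
  have [z0 zT] := cND N m.+1; rewrite -/(cN N m.+1) in z0 zT.
  set z := cN N m.+1 in z0 zT vm *.
  have h1 : eps (vmax z) <= 2 * b m.
    have := le_vmax (Pmap z) i0; rewrite {1}/Pmap.
    have : eps (vmax z) <= Tmap z i0 by rewrite /Tmap le_max lexx orbT.
    by have := z0 i0; lra.
  have := isK_le IC.1 (eps0 (vmax_ge0 z)) h1; rewrite Ceps ?vmax_ge0//.
  by rewrite /b iterS -/(b m) /B; lra.
have Kbig m : \forall N \near \oo, (m < K N)%N.
  exists (Num.bound (b m)) => // N /= mN; rewrite ltnNge; apply/negP => Km.
  have := bound N (K N) (leqnn _); rewrite /cN subnn /= leNgt => /negP; apply.
  apply: (le_lt_trans (bmono _ _ Km)); apply: (lt_le_trans (archi_boundP _)).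
    by have /andP[] := bb m.
  apply: (@le_trans _ _ N%:R); first by rewrite ler_nat.
  by apply: le_trans (le_vmax (s N) i0); have [] := sP N.
(* One ultrafilter gives limits at all indices at once, in place of a diagonal subsequence. *)
have [U [UU oU]] := @ultraFilterLemma nat \oo _.
have lims m i : exists l : R, cN N m i @[N --> U] --> l.
  apply: (@ultra_bounded_cvg _ _ (b m)) => //; apply: oU.
  have := Kbig m; apply: filterS => N mK.
  apply/andP; split; first exact: (cND N m).1.
  exact: le_trans (le_vmax _ i) (bound N m (ltnW mK)).
pose c m i := sval (cid (lims m i)).
have cl m i : cN N m i @[N --> U] --> c m i by rewrite /c; case: cid.
have c0 m i : 0 <= c m i.
  by apply: (cvgr_to_ge (@cl m i)); apply: nearW => N; exact: (cND N m).1.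
exists c; split => //.
- move=> m i; apply: (ler_cvg_to _ (@cl m i)).
    by apply: (@Tmap_cvg _ U _ (fun N => cN N m)) => // N; exact: (cND N m).1.
  by apply: nearW => N; exact: (cND N m).2.
- move=> m; apply/funext => i; apply: (cvg_unique _ (@cl m i)) => //.
  apply: (@Pmap_limit_fix _ U _ (fun N => cN N m) (fun N => cN N m.+1)) => //.
    by move=> N; exact: (cND N m.+1).1.
  by apply: oU; apply: filterS (Kbig m) => N; exact: cNS.
- apply: (cvgr_to_ge (@vmax_cvg _ U _ (fun N => cN N 1%N) (c 1%N) (fun i => @cl 1%N i))).
  apply: oU; apply: filterS (Kbig 1%N) => N K1; apply/ltW/Kmin.
  by rewrite subn1 prednK// (ltn_trans _ K1).
Qed.

(** Nonnegative indices follow the ascending orbit, negative ones the descending orbit of [c 0].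
    Were the ascending orbit bounded, its limit would be a fixed point, hence [0], against
    [1 <= vmax (c 1)]. *)
Lemma chain_exists (i0 : 'I_n) : exists c : int -> 'I_n -> R,
  [/\ (forall k i, 0 < c k i), (forall k i, c k i < c (k + 1) i),
      (forall k i, Tmap (c (k + 1)) i <= c k i),
      (forall i b, exists k, b < c k i) & (forall i e, 0 < e -> exists k, c k i < e)].
Proof.
have [c [c0 cT cP c1]] := upward_orbit i0.
pose cc (k : int) := match k with Posz m => c m | Negz m => iter m.+1 Pmap (c 0%N) end.
have ccP k : cc k = Pmap (cc (k + 1)).
  case: k => [m|[|m]]; rewrite /cc.
  - by rewrite (_ : Posz m + 1 = Posz m.+1)//; lia.
  - by rewrite (_ : Negz 0 + 1 = 0).
  - by rewrite (_ : Negz m.+1 + 1 = Negz m)//; lia.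
have D k : nonneg (cc k) /\ forall i, Tmap (cc k) i <= cc k i.
  case: k => m; first by split; [exact: c0|exact: cT].
  by apply: (@iter_Pmap_decay (c 0%N) m.+1); [exact: c0|exact: cT].
have ccle k i : cc k i <= cc (k + 1) i.
  by rewrite [cc k]ccP; have [_ + _ _] := Pmap_decay (D (k + 1)).1 (D (k + 1)).2.
have ccT k i : Tmap (cc (k + 1)) i <= cc k i.
  by rewrite [cc k]ccP; have [_ _ + _] := Pmap_decay (D (k + 1)).1 (D (k + 1)).2.
have cle m i : c m i <= c m.+1 i.
  by have := ccle m i; rewrite (_ : Posz m + 1 = Posz m.+1)//; lia.
have cmono i m m' : (m <= m')%N -> c m i <= c m' i.
  move=> /subnK <-; elim: (m' - m)%N => [//|d h]; rewrite addSn; exact: le_trans (cle _ _).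
have vpos m : 0 < vmax (c m.+1).
  apply: (lt_le_trans ltr01); apply: (le_trans c1); apply: vmax_mono => i; exact: cmono.
have unbM b : exists m, b < vmax (c m).
  apply: contrapT => H.
  have Hb m : vmax (c m) <= b.
    by rewrite leNgt; apply/negP => h; apply: H; exists m.
  pose l i := sup (range (fun m => c m i)).
  have cub i : has_ubound (range (fun m => c m i)).
    by exists b => _ [m _ <-]; exact: le_trans (le_vmax _ i) (Hb m).
  have cl i : c m i @[m --> \oo] --> l i.
    by apply: nondecreasing_cvgn => //; apply/nondecreasing_seqP => m; exact: cle.
  have l0 i : 0 <= l i.
    by apply: le_trans (c0 0%N i) _; apply: ub_le_sup => //; exists 0%N.
  have Pl i : Pmap l i = l i.
    have h : c m i @[m --> \oo] --> Pmap l i.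
      apply: (@Pmap_limit_fix _ \oo _ c (fun m => c m.+1)) => //; first by apply: nearW.
      move=> j; have := cl j; rewrite -(cvg_shiftS (fun m => c m j)); exact.
    exact: (cvg_unique _ h (cl i)).
  have : vmax (c 1%N) <= 0.
    apply: vmax_le => // i; rewrite -(Pmap_fix0 i l0 Pl).
    by apply: ub_le_sup => //; exists 1%N.
  by have := c1; lra.
(* The [eps] term carries unboundedness from the largest coordinate to every coordinate. *)
have cge m i : eps (vmax (c m.+1)) / 2 <= c m i.
  rewrite (cP m) /Pmap; have := c0 m.+1 i.
  have : eps (vmax (c m.+1)) <= Tmap (c m.+1) i by rewrite /Tmap le_max lexx orbT.
  lra.
have unb i b : exists m, b < c m i.
  have [y y0 yb] := Ieps.2 (2 * b + 1).
  have [m my] := unbM y; exists m.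
  apply: (@lt_le_trans _ _ (eps (vmax (c m.+1)) / 2)); last exact: cge.
  have h : eps y <= eps (vmax (c m.+1)).
    apply: (isK_le Ieps.1) => //; apply: (le_trans (ltW my)); apply: vmax_mono => j; exact: cle.
  lra.
(* A coordinate that stands still for one step equals its [Tmap] value; monotonicity of [Tmap] then
   freezes it at all later steps, against unboundedness. *)
have stuck k i : cc k i = cc (k + 1) i -> cc (k + 1) i = cc (k + 1 + 1) i.
  move=> e; apply/le_anti; rewrite ccle /=.
  have h1 : cc (k + 1) i = Tmap (cc (k + 1)) i by move: e; rewrite [cc k]ccP /Pmap; lra.
  have h2 : Tmap (cc (k + 1)) i <= Tmap (cc (k + 1 + 1)) i.
    by apply: Tmap_le; [exact: (D _).1|move=> j; exact: ccle].
  have h3 : cc (k + 1) i = Pmap (cc (k + 1 + 1)) i by rewrite -ccP.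
  by move: h3; rewrite /Pmap; lra.
have strict k i : cc k i < cc (k + 1) i.
  rewrite lt_neqAle ccle andbT; apply/negP => /eqP e.
  have st (m : nat) : cc (k + m%:Z) i = cc k i /\ cc (k + m%:Z + 1) i = cc k i.
    elim: m => [|m [h1 h2]]; first by rewrite addr0 -e.
    rewrite (_ : k + m.+1%:Z = k + m%:Z + 1); last by lia.
    by split=> //; rewrite -stuck ?h2// h1.
  have [m Hm] := unb i (cc k i).
  have [m' [mm' e']] : exists m' : nat, (m <= m')%N /\ k + (`|k| + m)%N%:Z = m'%:Z.
    by case: (k) => a; [exists (a + (a + m))%N|exists m]; lia.
  have := cmono i _ _ mm'; rewrite (_ : c m' = cc (k + (`|k| + m)%N%:Z)); last by rewrite e'.
  by rewrite (st _).1 leNgt Hm.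
have pos k i : 0 < cc k i.
  have := strict (k - 1) i; rewrite subrK; apply: le_lt_trans; exact: (D _).1.
exists cc; split => //.
- by move=> i b; have [m Hm] := unb i b; exists m%:Z.
- move=> i e e0; have /cvgrPdist_lt/(_ _ e0) := iter_Pmap_to0 (c0 0%N) (cT 0%N) i.
  move=> [m _ Hm]; exists (Negz m); have := Hm m.+1 (leqnSn m).
  by rewrite sub0r normrN ger0_norm//; exact: (D (Negz m)).1.
Qed.
End Chain.

(** * Piecewise linear paths *)

Section PiecewiseLinear.
Variable R : realType.
Implicit Types (a b : int -> R) (k l : int) (x y c d : R).

(** The nodes of a partition of the positive half-line into cells that accumulate only at [0] and at
    infinity. *)
Definition ladder a := [/\ (forall k, 0 < a k), (forall k, a k < a (k + 1)),
  (forall c, exists k, c < a k) & (forall e, 0 < e -> exists k, a k < e)].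

Lemma ladder_addn a k (m : nat) : ladder a -> a k <= a (k + m%:Z).
Proof.
case=> _ aS _ _; elim: m => [|m IH]; first by rewrite addr0.
apply: (le_trans IH); rewrite (_ : k + m.+1%:Z = k + m%:Z + 1) ?ltW//; lia.
Qed.

Lemma ladder_le a k l : ladder a -> k <= l -> a k <= a l.
Proof.
by move=> La kl; rewrite (_ : l = k + `|l - k|%N%:Z); [exact: ladder_addn|lia].
Qed.

Lemma ladder_lt a k l : ladder a -> k < l -> a k < a l.
Proof.
move=> La kl; have [_ aS _ _] := La; apply: (lt_le_trans (aS k)); apply: ladder_le => //.
by lia.
Qed.

Lemma ladder_find a x : ladder a -> 0 < x -> exists k, a k <= x < a (k + 1).
Proof.
move=> La x0; have [_ _ aoo a0] := La.
have [k0 h0] := a0 _ x0; have [k1 h1] := aoo x.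
have kk : k0 < k1.
  by rewrite ltNge; apply/negP => /(ladder_le La); have := lt_trans h0 h1; lra.
have exm : exists m : nat, x < a (k0 + m%:Z).
  by exists `|k1 - k0|%N; rewrite (_ : k0 + _ = k1)//; lia.
case: (ex_minnP exm) => -[|m] Hm mmin.
  by move: Hm; rewrite addr0; have := h0; lra.
exists (k0 + m%:Z); apply/andP; split.
  by rewrite leNgt; apply/negP => /mmin; rewrite ltnn.
by rewrite (_ : k0 + m%:Z + 1 = k0 + m.+1%:Z)//; lia.
Qed.

(* Interpolation of the points [(a k, b k)]; [0] on nonpositive arguments. *)
Definition PL a b x : R :=
  if x <= 0 then 0 else
  let k := xget 0 [set k | a k <= x < a (k + 1)] in
  b k + (x - a k) * ((b (k + 1) - b k) / (a (k + 1) - a k)).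

(** The formula of a cell also holds at its right end, where the chosen index is [k + 1]. *)
Lemma PLE a b k x : ladder a -> a k <= x -> x <= a (k + 1) ->
  PL a b x = b k + (x - a k) * ((b (k + 1) - b k) / (a (k + 1) - a k)).
Proof.
move=> La kx xk; have [apos aS _ _] := La.
have x0 : 0 < x by exact: lt_le_trans (apos k) kx.
rewrite /PL leNgt x0 /=; case: xgetP => [l _ /andP[lx xl]|no]; last first.
  by have [l Hl] := ladder_find La x0; case: (no l Hl).
have d0 l' : a (l' + 1) - a l' != 0 by rewrite gt_eqF// subr_gt0.
move: xk; rewrite le_eqVlt => /predU1P[xk|xk]; last first.
  have -> : l = k; last by [].
  apply/le_anti/andP; split; rewrite leNgt; apply/negP => h.
    have : a (k + 1) <= a l by apply: ladder_le => //; lia.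
    by lra.
  have : a (l + 1) <= a k by apply: ladder_le => //; lia.
  by lra.
have -> : l = k + 1.
  apply/le_anti/andP; split; rewrite leNgt; apply/negP => h.
    have : a (k + 1) < a l by apply: ladder_lt.
    by lra.
  have : a (l + 1) <= a (k + 1) by apply: ladder_le => //; lia.
  by lra.
rewrite -xk subrr mul0r addr0 xk mulrCA divff ?d0// mulr1; ring.
Qed.

Lemma PL_pos a b x : 0 < x -> ladder a -> exists k, [/\ a k <= x, x < a (k + 1) &
  PL a b x = b k + (x - a k) * ((b (k + 1) - b k) / (a (k + 1) - a k))].
Proof.
move=> x0 La; have [k /andP[kx xk]] := ladder_find La x0; exists k; split => //.
by apply: PLE => //; exact: ltW.
Qed.

Lemma PL0 a b x : x <= 0 -> PL a b x = 0.
Proof. by rewrite /PL => ->. Qed.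

Lemma slope_gt0 a b k : ladder a -> ladder b -> 0 < (b (k + 1) - b k) / (a (k + 1) - a k).
Proof. by move=> [_ aS _ _] [_ bS _ _]; rewrite divr_gt0// subr_gt0. Qed.

Lemma PL_itv a b k x : ladder a -> ladder b -> a k <= x -> x <= a (k + 1) ->
  b k <= PL a b x /\ PL a b x <= b (k + 1).
Proof.
move=> La Lb kx xk; have s0 := slope_gt0 k La Lb; rewrite (PLE b La kx xk).
have [_ aS _ _] := La; have d0 : 0 < a (k + 1) - a k by rewrite subr_gt0.
split; first by rewrite lerDl mulr_ge0 ?(ltW s0) ?subr_ge0.
rewrite -lerBrDl; apply: (@le_trans _ _ ((a (k + 1) - a k) * ((b (k + 1) - b k) / (a (k + 1) - a k)))).
  by rewrite ler_wpM2r ?(ltW s0)// lerD2r.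
by rewrite mulrCA divff ?gt_eqF// mulr1.
Qed.

Lemma PL_node a b k : ladder a -> PL a b (a k) = b k.
Proof.
move=> La; have [_ aS _ _] := La.
by rewrite (PLE b La (lexx _) (ltW (aS k))) subrr mul0r addr0.
Qed.

(** Finitely many cells have slopes between a positive minimum and a maximum; increments are glued
    at the common nodes. *)
Lemma PL_slopes a b k (m : nat) : ladder a -> ladder b ->
  exists c d, (0 < c <= d) /\ forall x y, a k <= x -> x <= y -> y <= a (k + m%:Z) ->
    c * (y - x) <= PL a b y - PL a b x <= d * (y - x).
Proof.
move=> La Lb; elim: m => [|m [c [d [/andP[c0 cd] H]]]].
  exists 1, 1; split; first by rewrite ltr01 lexx.
  move=> x y kx xy; rewrite addr0 => yk; have -> : y = x by lra.
  by rewrite !subrr mulr0 lexx.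
set p := k + m%:Z in H.
have ep : k + m.+1%:Z = p + 1 by rewrite /p; lia.
pose s := (b (p + 1) - b p) / (a (p + 1) - a p).
have s0 : 0 < s by exact: slope_gt0.
have Hs x y : a p <= x -> x <= y -> y <= a (p + 1) -> PL a b y - PL a b x = s * (y - x).
  move=> px xy yp; rewrite (PLE b La px (le_trans xy yp)) (PLE b La (le_trans px xy) yp) -/s; ring.
exists (Num.min c s), (Num.max d s); split.
  by rewrite lt_min c0 s0 /= le_max ge_min cd.
have [m1 m2] : Num.min c s <= c /\ Num.min c s <= s by rewrite !ge_min !lexx orbT.
have [M1 M2] : d <= Num.max d s /\ s <= Num.max d s by rewrite !le_max !lexx orbT.
move: (Num.min c s) (Num.max d s) m1 m2 M1 M2 => c' d' m1 m2 M1 M2.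
have mono (u w z : R) : w <= z -> 0 <= u -> w * u <= z * u by move=> wz u0; rewrite ler_wpM2r.
move=> x y kx xy; rewrite ep => yp.
have [yq|qy] := leP y (a p).
  have /andP[h1 h2] := H x y kx xy yq; have yx : 0 <= y - x by rewrite subr_ge0.
  by rewrite (le_trans (mono _ _ _ m1 yx))// (le_trans h2)// mono.
have [xq|qx] := leP x (a p).
  have /andP[h1 h2] := H x (a p) kx xq (lexx _).
  have h3 := Hs (a p) y (lexx _) (ltW qy) yp.
  have u1 : 0 <= a p - x by rewrite subr_ge0.
  have u2 : 0 <= y - a p by rewrite subr_ge0 ltW.
  have := mono _ _ _ m1 u1; have := mono _ _ _ m2 u2.
  have := mono _ _ _ M1 u1; have := mono _ _ _ M2 u2.
  by move=> *; apply/andP; split; lra.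
rewrite (Hs x y (ltW qx) xy yp); have yx : 0 <= y - x by rewrite subr_ge0.
by rewrite !mono.
Qed.

Lemma PL_slopes_on a b p q : ladder a -> ladder b -> 0 < p ->
  exists c d, (0 < c <= d) /\ forall x y, p <= x -> x <= y -> y <= q ->
    c * (y - x) <= PL a b y - PL a b x <= d * (y - x).
Proof.
move=> La Lb p0; have [_ _ aoo a0] := La.
have [k kp] := a0 _ p0; have [l ql] := aoo (Num.max p q).
have kl : k < l.
  rewrite ltNge; apply/negP => /(ladder_le La).
  by move: ql; rewrite gt_max => /andP[h _]; have := lt_trans kp h; lra.
have [c [d [cd H]]] := PL_slopes k `|l - k|%N La Lb; exists c, d; split => // x y px xy yq.
apply: H => //; first exact: le_trans (ltW kp) px.
rewrite (_ : k + _ = l); last by lia.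
by rewrite (le_trans yq)// ltW// (le_lt_trans _ ql)// le_max lexx orbT.
Qed.

Lemma PL_gt0 a b x : ladder a -> ladder b -> 0 < x -> 0 < PL a b x.
Proof.
move=> La Lb x0; have [k [kx xk _]] := PL_pos b x0 La.
have [h _] := PL_itv La Lb kx (ltW xk); apply: lt_le_trans h.
by case: Lb.
Qed.

Lemma PL_lt a b x y : ladder a -> ladder b -> 0 <= x -> x < y -> PL a b x < PL a b y.
Proof.
move=> La Lb; rewrite le_eqVlt => /predU1P[<- y0|x0 xy].
  by rewrite (PL0 _ _ (lexx 0)) PL_gt0.
have [c [d [/andP[c0 _] H]]] := PL_slopes_on y La Lb x0.
have /andP[h _] := H x y (lexx _) (ltW xy) (lexx _).
by rewrite -subr_gt0 (lt_le_trans _ h)// mulr_gt0// subr_gt0.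
Qed.

(** Exchanging abscissae and ordinates inverts the interpolation. *)
Lemma PLK a b x : ladder a -> ladder b -> 0 <= x -> PL b a (PL a b x) = x.
Proof.
move=> La Lb; rewrite le_eqVlt => /predU1P[<-|x0]; first by rewrite !PL0// PL0.
have [k [kx xk e]] := PL_pos b x0 La.
have [h1 h2] := PL_itv La Lb kx (ltW xk).
rewrite (PLE a Lb h1 h2) e; have [_ aS _ _] := La; have [_ bS _ _] := Lb.
have da : a (k + 1) - a k != 0 by rewrite gt_eqF// subr_gt0.
have db : b (k + 1) - b k != 0 by rewrite gt_eqF// subr_gt0.
by field; rewrite da db.
Qed.

Lemma PL_ge0 a b x : ladder a -> ladder b -> 0 <= PL a b x.
Proof.
move=> La Lb; have [x0|x0] := leP x 0; first by rewrite PL0.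
exact/ltW/PL_gt0.
Qed.

Lemma PL_Kinf a b : ladder a -> ladder b -> isKinf (PL a b).
Proof.
move=> La Lb; apply: isKinf_of_surj => [r _|x y x0 xy|y y0]; first exact: PL_ge0.
  exact: PL_lt.
by exists (PL b a y); [exact: PL_ge0|exact: PLK].
Qed.

Lemma ladder_pow2 : ladder (fun k : int => 2 ^ k : R).
Proof.
have p k : 0 < 2 ^ k :> R by exact: exprz_gt0.
split => //.
- by move=> k; rewrite expfzDr// expr1z; have := p k; lra.
- move=> c; exists (Num.bound `|c|)%:Z; apply: (le_lt_trans (ler_norm c)).
  apply: (lt_le_trans (archi_boundP (normr_ge0 c))).
  by rewrite -exprnP -natrX ler_nat ltnW// ltn_expl.
- move=> e e0; have ev : 0 < e^-1 by rewrite invr_gt0.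
  exists (- (Num.bound e^-1)%:Z); rewrite -exprnN -[ltRHS]invrK ltf_pV2 ?posrE ?exprn_gt0//.
  apply: (lt_le_trans (archi_boundP (ltW ev))).
  by rewrite -natrX ler_nat ltnW// ltn_expl.
Qed.

End PiecewiseLinear.

Lemma derive1_slopes (R : realType) (f : R -> R) (r c d e : R) : 0 < e ->
  (forall x y, `|x - r| < e -> `|y - r| < e -> x <= y ->
     c * (y - x) <= f y - f x <= d * (y - x)) ->
  derivable f r 1 -> c <= derive1 f r <= d.
Proof.
move=> e0 H df; rewrite derive1E.
have Q : \forall h \near (0 : R)^', c <= h^-1 *: ((f \o shift r) (h *: 1) - f r) <= d.
  near=> h; have h0 : h != 0 by near: h; exact: nbhs_dnbhs_neq.
  have he : `|h| < e by near: h; apply: dnbhs0_lt.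
  rewrite /= scaler1 [_ *: _]mulrC.
  have rr : `|r - r| < e by rewrite subrr normr0.
  have hr : `|h + r - r| < e by rewrite addrK.
  have [hp|hn] := ltP 0 h.
    have /andP[h1 h2] := H r (h + r) rr hr (ltac:(lra)).
    by rewrite ler_pdivlMr// ler_pdivrMr//; apply/andP; split; lra.
  have {}hn : h < 0 by rewrite lt_neqAle h0.
  have /andP[h1 h2] := H (h + r) r hr rr (ltac:(lra)).
  by rewrite ler_ndivlMr// ler_ndivrMr//; apply/andP; split; lra.
apply/andP; split.
  by apply: limr_ge => //; apply: filterS Q => h /andP[].
by apply: limr_le => //; apply: filterS Q => h /andP[].
Unshelve. all: by end_near.
Qed.

Lemma compact_pos_bounds (R : realType) (P : set R) : compact P -> P `<=` [set r | 0 < r] ->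
  exists p q, 0 < p /\ P `<=` [set x | p <= x <= q].
Proof.
move=> cP P0; have [M [_ HM]] := compact_bounded cP.
have : nbhs (0 : R) (~` P).
  apply: open_nbhs_nbhs; split; last by move=> /P0/=; rewrite ltxx.
  by apply: closed_openC; apply: compact_closed.
move=> /nbhs_ballP[e /= e0 He]; exists e, (M + 1); split => // x Px /=.
have x0 : 0 < x by exact: P0.
apply/andP; split.
  rewrite leNgt; apply/negP => xe; apply: (He x _ Px).
  by rewrite /ball /= sub0r normrN gtr0_norm.
by apply: (le_trans (ler_norm x)); exact: (HM (M + 1) (ltac:(lra)) x Px).
Qed.

(** * The path and its margin for inputs *)

Section Path.
Variables (R : realType) (n : nat) (isSum : pred 'I_n) (g : 'I_n -> 'I_n -> R -> R)
  (gi : 'I_n -> R -> R).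
Hypothesis hg : forall i j, isKinf0 (g i j).
Hypothesis hgi : forall i, isK (gi i).
Implicit Types (i j : 'I_n) (r u : R) (z s : 'I_n -> R).
Local Notation nonneg z := (forall i, 0 <= z i).

Lemma Gam_maxrow_lt z (w : R) i : ~~ isSum i -> 0 < w -> (forall j, g i j (z j) < w) ->
  Gam isSum g z i < w.
Proof.
by move=> si w0 H; rewrite /Gam (negbTE si); apply: bigmax_lt.
Qed.

Lemma isKinf0_lt_or0 (h : R -> R) (a b : R) : isKinf0 h -> 0 <= a -> a < b ->
  h a < h b \/ h a = 0.
Proof.
move=> [Ih|h0] a0 ab; last by right; exact: h0.
by left; case: Ih.1 => _ _ _; apply.
Qed.

(** On a cell [c k <= sigma r <= c (k + 1)], so [T (sigma r) <= T (c (k + 1)) <= c k <= sigma r] by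
    monotonicity, whatever the shape of the decay set. *)
Lemma ladder_omega_path (c : int -> 'I_n -> R) (alpha eps : R -> R) :
  isKinf alpha -> isKinf eps ->
  (forall k i, 0 < c k i) -> (forall k i, c k i < c (k + 1) i) ->
  (forall k i, Tmap isSum g alpha eps (c (k + 1)) i <= c k i) ->
  (forall i b, exists k, b < c k i) -> (forall i e, 0 < e -> exists k, c k i < e) ->
  let sigma i := PL (fun k => 2 ^ k) (c^~ i) in
  let sigmainv i := PL (c^~ i) (fun k => 2 ^ k) in
  Omega_path isSum g sigma sigmainv /\
  forall r i, 0 < r -> Tmap isSum g alpha eps (fun j => sigma j r) i <= sigma i r.
Proof.
move=> Ialpha Ieps c0 cS cT coo cz sigma sigmainv.
have L2 := ladder_pow2 R.
have Lc i : ladder (c^~ i).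
  split; [by move=> k|by move=> k|by move=> b; exact: coo|by move=> e; exact: cz].
have Is i : isKinf (sigma i) by exact: PL_Kinf.
have T r i : 0 < r -> Tmap isSum g alpha eps (fun j => sigma j r) i <= sigma i r.
  move=> r0; have [k /andP[kr rk]] := ladder_find L2 r0.
  have b j := PL_itv L2 (Lc j) kr (ltW rk).
  apply: le_trans (b i).1; apply: le_trans (cT k i).
  by apply: Tmap_le => // j; [exact/ltW/PL_gt0|case: (b j)].
split; last exact: T.
rewrite /Omega_path; split; first exact: Is.
- by move=> i r r0; split; apply: PLK.
- move=> i r0 r00.
  have [p [d [/andP[p0 pd] H]]] := PL_slopes_on (r0 * 2) (Lc i) L2 (divr_gt0 r00 (ltr0Sn R 1)).
  exists (r0 / 2), d; split; first by lra.
  have Hab a b : `|a - r0| < r0 / 2 -> `|b - r0| < r0 / 2 -> a <= b ->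
      `|sigmainv i a - sigmainv i b| <= d * `|a - b|.
    rewrite !ltr_norml => /andP[a1 a2] /andP[b1 b2] ab.
    have /andP[h1 h2] := H a b (ltac:(lra)) ab (ltac:(lra)).
    have ba : 0 <= b - a by rewrite subr_ge0.
    rewrite distrC [`|a - b|]distrC !ger0_norm//.
    by apply: le_trans h1; rewrite mulr_ge0 ?(ltW p0).
  move=> a b ha hb; have [ab|/ltW ab] := leP a b; first exact: Hab.
  by rewrite distrC [`|a - b|]distrC Hab.
- move=> i P cP P0; have [p [q [p0 Pq]]] := compact_pos_bounds cP P0.
  have [e [d [ed H]]] := PL_slopes_on (q + p) (Lc i) L2 (divr_gt0 p0 (ltr0Sn R 1)).
  exists e, d; split => // r /Pq/= /andP[pr rq] dr.
  apply: (@derive1_slopes _ _ _ _ _ (p / 2)) => //; first by lra.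
  move=> x y; rewrite !ltr_norml => /andP[x1 x2] /andP[y1 y2] xy; apply: H => //; lra.
- move=> r r0 i.
  have := T r i r0; rewrite /Tmap ge_max => /andP[+ _]; rewrite /Amap.
  have s0 j : 0 <= sigma j r by exact/ltW/PL_gt0.
  have [k /andP[kr rk]] := ladder_find L2 r0.
  (* Strictness on maximum rows comes from [r < 2 ^ (k + 1)] and strictly increasing gains; on
     summation rows it comes from [alpha] being positive off [0]. *)
  have lt j : sigma j r < c (k + 1) j.
    by rewrite -(PL_node (c^~ j) (k + 1) L2); apply: PL_lt => //; exact: ltW.
  have [G0|G0] := eqVneq (Gam isSum g (fun j => sigma j r) i) 0.
    by move=> _; rewrite G0; exact: PL_gt0.
  have Gp : 0 < Gam isSum g (fun j => sigma j r) i by rewrite lt_neqAle eq_sym G0 Gam_ge0.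
  case: ifPn => si; first by have := isK_gt0 Ialpha.1 Gp; lra.
  move=> _; have [h1 h2] := PL_itv L2 (Lc i) kr (ltW rk).
  apply: lt_le_trans h1; apply: Gam_maxrow_lt => // j.
  have G : g i j (c (k + 1) j) <= c k i.
    apply: le_trans (cT k i); rewrite /Tmap le_max; apply/orP; left.
    rewrite /Amap (negbTE si) addr0 /Gam (negbTE si).
    exact: (le_bigmax_cond _ (fun j => g i j (c (k + 1) j))).
  have [h|->//] := isKinf0_lt_or0 (hg i j) (s0 j) (lt j).
  exact: lt_le_trans h G.
Qed.

(** On a summation row, if [Gam z i] is at least [eps (z i) / 2], the [alpha] term of [Amap] absorbs
    the input, and the summand [u] makes the inequality strict. Otherwise [Gam z i] and the input
    take at most half of [eps (z i) <= z i] each. *)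
Lemma Tmap_margin (alpha eps : R -> R) z i : isKinf alpha -> isKinf eps -> nonneg z ->
  Tmap isSum g alpha eps z i <= z i -> Gam isSum g z i < z i -> forall u, 0 < u ->
  u + gi i u <= Num.min (alpha (eps (z i) / 2) / 2) (eps (z i) / 2) ->
  Gambar isSum g gi z u i < z i.
Proof.
move=> Ia Ie z0; rewrite /Tmap ge_max => /andP[Az ez] Gz u u0.
have E : eps (z i) <= z i by apply: le_trans ez; apply: isK_le Ie.1 (z0 i) (le_vmax z i).
have E0 := isK_ge0 Ie.1 (z0 i).
rewrite le_min => /andP[m1 m2]; have g0 := isK_ge0 (hgi i) (ltW u0).
move: Az Gz; rewrite /Amap /Gambar; have G0 := Gam_ge0 isSum hg i z0.
case: ifPn => si Az Gz; last first.
  by move: Gz; rewrite /Gam (negbTE si) gt_max => -> /=; lra.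
rewrite (_ : \sum_j _ = Gam isSum g z i) ?[in LHS]/Gam; last by rewrite /Gam si.
have [h|h] := leP (eps (z i) / 2) (Gam isSum g z i); last by lra.
have E2 : 0 <= eps (z i) / 2 by lra.
by have := isK_le Ia.1 E2 h; lra.
Qed.

(** [phi] lies below, for every [i], the inverse of [r + gi i r] taken at the margin of row [i]
    along the path. The last clause bounds difference quotients of [sigmainv], the form in which the
    Lyapunov estimates use them. *)
Lemma omega_path_exists :
  (exists2 alpha, isKinf alpha & forall s, nonneg s -> (exists i, s i != 0) ->
     exists i, Gam isSum g (Dalpha isSum alpha s) i < s i) ->
  exists sigma sigmainv phi,
  [/\ Omega_path isSum g sigma sigmainv, isKinf phi,
      (forall r, 0 < r -> forall i,
         Gambar isSum g gi (fun j => sigma j r) (phi r) i < sigma i r),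
      (forall i, isKinf (sigmainv i)) &
      (forall i p q, 0 < p -> exists c d, (0 < c <= d) /\ forall x y, p <= x -> x <= y ->
         y <= q -> c * (y - x) <= sigmainv i y - sigmainv i x <= d * (y - x))].
Proof.
move=> [alpha0 Ialpha0 sg0].
(* The chain is built from some index [i0], so [n = 0] is treated apart. *)
have [[i0 _]|no] := pselect (exists i0 : 'I_n, True); last first.
  have {}no (i : 'I_n) : False by apply: no; exists i.
  exists (fun _ => id), (fun _ => id), id; split; [|exact: isKinf_id| | |].
  - by split => [i|i|i|i|r _ i]; case: (no i).
  - by move=> r _ i; case: (no i).
  - by move=> i; case: (no i).
  - by move=> i; case: (no i).
have [alpha Ialpha [ale alip]] := isKinf_lip1_minorant Ialpha0.
have sg s : nonneg s -> (exists i, s i != 0) ->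
    exists i, Gam isSum g (Dalpha isSum alpha s) i < s i.
  move=> s0 sn; have [i Hi] := sg0 s s0 sn; exists i; apply: le_lt_trans Hi.
  apply: Gam_le => // j; rewrite /Dalpha; case: ifP => _ //.
    by rewrite addr_ge0// isK_ge0//; case: Ialpha.
  by rewrite lerD2l ale.
have [C IC [leC Cb]] := bounded_solutions hg Ialpha alip sg.
have [Cv ICv CvP] := isKinf_inv IC.
pose eps (r : R) : R := Cv (2^-1 * r).
have h2 : 0 < 2^-1 :> R by rewrite invr_gt0.
have Ieps : isKinf eps by apply: (isKinf_comp ICv (isKinf_scale h2)).
have Ceps r : 0 <= r -> C (eps r) = r / 2.
  by move=> r0; rewrite /eps (CvP _ _).2 1?mulrC// mulr_ge0// ltW.
have [c [c0 cS cT coo cz]] := chain_exists hg Ialpha IC Ieps Ceps leC Cb i0.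
have := ladder_omega_path Ialpha Ieps c0 cS cT coo cz.
set sigma := (fun i => PL (fun k => 2 ^ k) _); set sigmainv := (fun i => PL _ _).
move=> /= [OP TP]; have [Is _ _ _ Gs] := OP.
have Lc i : ladder (c^~ i).
  split; [by move=> k|by move=> k|by move=> b; exact: coo|by move=> e; exact: cz].
pose mu i r := Num.min (2^-1 * alpha (2^-1 * eps (sigma i r))) (2^-1 * eps (sigma i r)).
have Imu i : isKinf (mu i).
  have I1 : isKinf (fun r => 2^-1 * eps (sigma i r)).
    by apply: isKinfM_cst => //; exact: (isKinf_comp Ieps (Is i)).
  apply: isKinf_min => //; apply: isKinfM_cst => //; exact: (isKinf_comp Ialpha I1).
have Igt i : isKinf (fun r => r + gi i r) by apply: isKinfDl => //; exact: isKinf_id.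
have /choice[gv gvP] : forall i, exists h, isKinf h /\
    forall r, 0 <= r -> h (r + gi i r) = r /\ h r + gi i (h r) = r.
  by move=> i; have [h Ih hP] := isKinf_inv (Igt i); exists h.
have [phi Iphi phiP] := isKinf_finite_min (fun i => isKinf_comp (gvP i).1 (Imu i)).
exists sigma, sigmainv, phi; split => //; last first.
- by move=> i p q p0; apply: PL_slopes_on => //; exact: ladder_pow2.
- by move=> i; apply: PL_Kinf => //; exact: ladder_pow2.
- move=> r r0 i.
  have s0 j : 0 <= sigma j r by apply: isK_ge0 (ltW r0); case: (Is j).
  apply: (Tmap_margin Ialpha Ieps s0 (TP r i r0) (Gs r r0 i)).
    by apply: isK_gt0 r0; case: Iphi.
  rewrite ![_ / 2]mulrC -/(mu i r).
  have [Igv gvK] := gvP i; have m0 : 0 <= mu i r by apply: isK_ge0 (ltW r0); case: (Imu i).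
  rewrite -[leRHS](gvK _ m0).2; apply: (isK_le (Igt i).1) (phiP i r (ltW r0)).
  by apply: isK_ge0 (ltW r0); case: Iphi.
Qed.
End Path.

(** * The max-type Lyapunov function *)

Section PositiveDefinite.
Variable R : realType.
Implicit Types (a b c : R).

Lemma isPD_lower (rho : R -> R) a b : isPD rho -> 0 < a -> a <= b ->
  exists2 c, 0 < c & forall t, a <= t <= b -> c <= rho t.
Proof.
move=> [rc rp] a0 ab.
have rc' : {within `[a, b], continuous rho}.
  apply: continuous_subspaceW rc => t /=; rewrite in_itv /= => /andP[h _].
  exact: le_trans (ltW a0) h.
have [t0] := EVT_min ab rc'; rewrite in_itv /= => /andP[at0 _] H.
exists (rho t0); last by move=> t tab; apply: H; rewrite in_itv.
have t00 : 0 < t0 by exact: lt_le_trans at0.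
have [h1 h2] := rp t0 (ltW t00); rewrite lt_neqAle h1 andbT eq_sym.
by apply/eqP => /h2 e; rewrite e ltxx in t00.
Qed.

(** Uniform decrease on each compact range of the norm is assembled into one positive definite rate
    by regularising the infimum over each level of [nrm]. The extra element [1] keeps that infimum
    meaningful on empty levels. *)
Lemma isPD_of_local_bounds (T : Type) (P : set T) (nrm val : T -> R) :
  (forall a b, 0 < a -> a <= b ->
     exists2 c, 0 < c & forall t, P t -> a <= nrm t <= b -> val t <= - c) ->
  exists2 al, isPD al & forall t, P t -> 0 < nrm t -> val t <= - al (nrm t).
Proof.
move=> H; pose S r := [set - val t | t in [set t | P t /\ nrm t = r]] `|` [set 1].
have Sne r : S r !=set0 by exists 1; right.
have lbS a b c : (forall t : T, P t -> a <= nrm t <= b -> val t <= - c) ->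
    forall r, a <= r <= b -> lbound (S r) (Num.min c 1).
  move=> Hc r rab y [[t [Pt tr] <-]|->]; last by rewrite ge_min lexx orbT.
  by rewrite ge_min lerNr Hc// tr.
have [|al Ial Hal] := @isPD_minorant R (fun r => inf (S r)).
  move=> a b a0 ab; have [c c0 Hc] := H a b a0 ab.
  exists (Num.min c 1); first by rewrite lt_min c0 ltr01.
  by move=> t tab; apply: lb_le_inf => //; apply: lbS Hc _ tab.
exists al => // t Pt t0; rewrite lerNr; apply: (le_trans (Hal _ t0)).
apply: ge_inf; last by left; exists t.
have [c c0 Hc] := H _ _ t0 (lexx _); exists (Num.min c 1).
by apply: (lbS _ _ _ Hc); rewrite lexx.
Qed.

Lemma finite_pos_min (I : finType) (d : I -> R) : (forall i, 0 < d i) ->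
  exists2 e, 0 < e & forall i, e <= d i.
Proof.
move=> d0; exists (\big[Num.min/1]_i d i); last by move=> i; exact: bigmin_le_cond.
by apply: lt_bigmin.
Qed.

Lemma vmax_dist n (z w : 'I_n -> R) c : 0 <= c -> (forall i, `|z i - w i| <= c) ->
  `|vmax z - vmax w| <= c.
Proof.
move=> c0 H.
have aux (z' w' : 'I_n -> R) : (forall i, `|z' i - w' i| <= c) -> vmax z' - vmax w' <= c.
  move=> H'; rewrite lerBlDr; apply: vmax_le => [|i]; first by rewrite addr_ge0// vmax_ge0.
  have := le_vmax w' i; have := H' i; rewrite ler_norml => /andP[]; lra.
by rewrite ler_norml lerNl opprB !aux// => i; rewrite distrC.
Qed.

Lemma vmax_attained n (z : 'I_n -> R) : 0 < vmax z -> exists i, z i = vmax z.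
Proof.
move=> z0; apply: contrapT => no.
have : vmax z < vmax z; last by rewrite ltxx.
rewrite {1}/vmax; apply: bigmax_lt => // i _; rewrite lt_neqAle le_vmax andbT.
by apply/eqP => e; apply: no; exists i.
Qed.

Lemma enorm_cvgP k (x : 'rV[R]_k) (h : 'rV[R]_k -> R) (e : R) : {for x, continuous h} ->
  0 < e -> exists2 d, 0 < d & forall y, enorm (y - x) < d -> `|h x - h y| < e.
Proof.
move=> hc e0; have /cvgrPdist_lt/(_ e e0) H := hc.
exact: (iffLR (@nbhs_enormP R k x _) H).
Qed.

Lemma enorm_continuousP k p (F : 'rV[R]_k -> 'rV[R]_p) (x : 'rV[R]_k) :
  {for x, continuous F} <->
  forall e, 0 < e -> exists2 d, 0 < d & forall y, enorm (y - x) < d -> enorm (F y - F x) < e.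
Proof.
split=> [Fc e e0|H].
  have nF : nbhs (F x) [set z | enorm (z - F x) < e] by apply/nbhs_enormP; exists e.
  exact: (iffLR (@nbhs_enormP R k x _) (Fc _ nF)).
move=> A /nbhs_enormP[e e0 He]; apply/nbhs_enormP.
by have [d d0 Hd] := H e e0; exists d => // y yd; apply: He; exact: Hd.
Qed.

(** At a point of differentiability the quotients with negative increment already determine the
    derivative. *)
Lemma diff_le_backward k (U : 'rV[R]_k -> R) x v a h0 : 0 < h0 -> differentiable U x ->
  (forall h, 0 < h -> h < h0 -> U x - U (x - h *: v) <= a * h) -> 'd U x v <= a.
Proof.
move=> h00 dU H.
have Q : (fun h : R => h^-1 * (U (x + h *: v) - U x)) @ (0 : R)^'- --> 'd U x v.
  by apply: cvg_dnbhs_at_left; exact: diff_quotient_cvg.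
apply: (cvgr_to_le Q); near=> h.
have hn : h < 0 by near: h; exact: nbhs_left_lt.
have hh : - h < h0 by rewrite ltrNl; near: h; apply: nbhs_left_gt; rewrite oppr_lt0.
have := H (- h) (ltac:(lra)) hh; rewrite scaleNr opprK => H1.
by rewrite mulrC ler_ndivrMr//; lra.
Unshelve. all: by end_near.
Qed.

End PositiveDefinite.

(** * Replacing one block of the state *)

Section BlockReplacement.
Variables (R : realType) (n : nat) (N : 'I_n -> nat).
Implicit Types (x y : 'rV[R]_(\sum_(j < n) N j)) (i j : 'I_n).

Lemma submxrowB x y i : submxrow (x - y) i = submxrow x i - submxrow y i.
Proof. by apply/rowP => j; rewrite !mxE. Qed.

Lemma submxrowZD x y i (h : R) : submxrow (x + h *: y) i = submxrow x i + h *: submxrow y i.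
Proof. by apply/rowP => j; rewrite !mxE. Qed.

Lemma continuous_submxrow i : continuous (fun x => submxrow x i).
Proof.
move=> x; apply/enorm_continuousP => e e0; exists e => // y; rewrite -submxrowB.
exact/le_lt_trans/enorm_block_le.
Qed.

Definition setblock x i (w : 'rV[R]_(N i)) : 'rV[R]_(\sum_(j < n) N j) :=
  mxrow (@eqtype.dfwith _ _ (fun j => submxrow x j) i w).

Lemma setblockE x i (w : 'rV[R]_(N i)) : submxrow (setblock x w) i = w.
Proof. by rewrite mxrowK; exact: eqtype.dfwith_in. Qed.

Lemma setblock_neq x i j (w : 'rV[R]_(N i)) : i != j ->
  submxrow (setblock x w) j = submxrow x j.
Proof. by move=> ij; rewrite mxrowK; exact: eqtype.dfwith_out. Qed.

Lemma enorm_setblockB x i (w : 'rV[R]_(N i)) :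
  enorm (setblock x w - x) <= enorm (w - submxrow x i).
Proof.
apply: (le_trans (enorm_le_blocks _)); rewrite (bigD1 i)//=.
have -> : \sum_(j < n | j != i) enorm (submxrow (setblock x w - x) j) = 0.
  by apply: big1 => j ji; rewrite submxrowB setblock_neq 1?eq_sym// subrr enorm0.
by rewrite addr0 submxrowB setblockE.
Qed.

Lemma setblock_id x i : setblock x (submxrow x i) = x.
Proof.
apply/eqP; rewrite -subr_eq0; apply/eqP/enorm_eq0/le_anti; rewrite enorm_ge0 andbT.
by rewrite (le_trans (enorm_setblockB _ _))// subrr enorm0.
Qed.

End BlockReplacement.

(** * Regularity and decrease of the maximum *)

Section MaxLyapunov.
Variables (R : realType) (n : nat) (N m : 'I_n -> nat).
Variable f : forall i, 'rV[R]_(\sum_(j < n) N j) -> 'rV[R]_(m i) -> 'rV[R]_(N i).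
Arguments f : clear implicits.
Variables (isSum : pred 'I_n) (V : forall i, 'rV[R]_(N i) -> R).
Arguments V : clear implicits.
Variables (g : 'I_n -> 'I_n -> R -> R) (gi alphai : 'I_n -> R -> R).
Hypothesis fcont : forall i, continuous
  (fun p : 'rV[R]_(\sum_(j < n) N j) * 'rV[R]_(m i) => f i p.1 p.2).
Hypothesis Vreg : forall i, [/\ continuous (V i), proper_pd (V i) & loclip_nz (V i)].
Hypothesis hg : forall i j, isKinf0 (g i j).
Hypothesis hgii : forall i r, 0 <= r -> g i i r = 0.
Hypothesis hgi : forall i, isK (gi i).
Hypothesis hal : forall i, isPD (alphai i).
Implicit Types (i j : 'I_n) (x : 'rV[R]_(\sum_(j < n) N j))
  (u : 'rV[R]_(\sum_(j < n) m j)).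
Local Notation Vx x := (fun j => V j (submxrow x j)).
Hypothesis decr : forall i x u, differentiable (V i) (submxrow x i) ->
  Gambar isSum g gi (Vx x) (enorm u) i <= V i (submxrow x i) ->
  'd (V i) (submxrow x i) (f i x (submxrow u i)) <= - alphai i (enorm (submxrow x i)).

Lemma proper_pd_ge0 k (U : 'rV[R]_k -> R) y : proper_pd U -> 0 <= U y.
Proof.
by move=> [p1 [p2 [I1 I2 H]]]; apply: le_trans (H y).1; apply: isK_ge0 I1.1 (enorm_ge0 y).
Qed.

Let V0 i y : 0 <= V i y. Proof. by apply: proper_pd_ge0; case: (Vreg i). Qed.

(** Since [g i i] vanishes, moving block [i] alone leaves the threshold of subsystem [i]
    unchanged. *)
Lemma Gambar_row_congr (z w : 'I_n -> R) r i : (forall j, 0 <= z j) -> (forall j, 0 <= w j) ->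
  (forall j, i != j -> z j = w j) ->
  Gambar isSum g gi z r i = Gambar isSum g gi w r i.
Proof.
move=> z0 w0 zw; have e j : g i j (z j) = g i j (w j).
  by have [<-|ij] := eqVneq i j; [rewrite !hgii|rewrite zw].
by rewrite /Gambar; case: ifP => _; [congr (_ + _)|congr (Num.max _ _)]; apply: eq_bigr.
Qed.

Lemma subsystem_increment x u i : submxrow x i != 0 ->
  Gambar isSum g gi (Vx x) (enorm u) i < V i (submxrow x i) ->
  exists2 h0, 0 < h0 & forall h, 0 <= h -> h < h0 ->
    V i (submxrow x i) + alphai i (enorm (submxrow x i)) / 2 * h <=
    V i (submxrow x i - h *: f i x (submxrow u i)).
Proof.
set xi := submxrow x i; set v := f i x _ => xi0 Gx.
pose a := alphai i (enorm xi).
have a0 : 0 < a.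
  have [_ /(_ _ (enorm_ge0 xi))[h1 h2]] := hal i.
  rewrite lt_neqAle h1 andbT eq_sym; apply/eqP => /h2/enorm_eq0 e.
  by rewrite e eqxx in xi0.
have [Vc _ Vl] := Vreg i.
have [d1 [L [d10 HL]]] := Vl xi xi0.
have L1 : 0 < `|L| + 1 by rewrite ltr_wpDl.
have HL' y z : enorm (y - xi) < d1 -> enorm (z - xi) < d1 ->
    `|V i y - V i z| <= (`|L| + 1) * enorm (y - z).
  move=> h1 h2; apply: (le_trans (HL y z h1 h2)); rewrite ler_wpM2r ?enorm_ge0//.
  by rewrite (le_trans (ler_norm L))// lerDl.
have [d2 d20 H2] := enorm_cvgP (Vc xi) (ltac:(rewrite subr_gt0; exact: Gx) :
  0 < V i xi - Gambar isSum g gi (Vx x) (enorm u) i).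
have fc : {for xi, continuous (fun w => f i (setblock x w) (submxrow u i))}.
  have sx : setblock x xi = x by exact: setblock_id.
  have c1 : (fun w => setblock x w) @ xi --> x.
    have c0 : {for xi, continuous (fun w => setblock x w)}.
      apply/enorm_continuousP => e e0; exists e => // y ye; rewrite sx.
      exact: le_lt_trans (enorm_setblockB _ _) ye.
    by move: c0; rewrite /prop_for /continuous_at /= sx.
  have := @fcont i (x, submxrow u i).
  rewrite /prop_for /continuous_at /= sx => fcx.
  have P : (fun w => (setblock x w, submxrow u i)) @ xi --> (x, submxrow u i).
    by apply: (@cvg_pair _ _ _ (nbhs xi) (nbhs x) (nbhs (submxrow u i))); [exact: c1|exact: cvg_cst].
  exact: (cvg_comp _ _ P fcx).
(* Half of [a] survives: [alphai] loses at most a quarter near [xi], and freezing the direction at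
   [v] loses another quarter. *)
have e30 : 0 < a / 4 / (`|L| + 1) by rewrite divr_gt0// divr_gt0.
have [d3 d30 H3] := (iffLR (enorm_continuousP _ _) fc) _ e30.
have [d4 d40 H4] : exists2 d4, 0 < d4 & forall y, enorm (y - xi) < d4 ->
    3 / 4 * a <= alphai i (enorm y).
  have hc : continuous (fun y : 'rV[R]_(N i) => alphai i (Num.max (enorm y) 0)).
    move=> y; apply: (@continuous_comp _ _ _ (@enorm R (N i)) (fun t : R => alphai i (Num.max t 0))).
      exact: continuous_enorm.
    by apply: (iffLR (within_RnnP _)); case: (hal i).
  have [d d0 Hd] := enorm_cvgP (hc xi) (ltac:(lra) : 0 < a / 4).
  exists d => // y /Hd; rewrite !max_l ?enorm_ge0// -/a.
  by rewrite ltr_norml => /andP[_]; lra.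
pose r : R := Num.min (Num.min d1 d2) (Num.min d3 d4).
have r0 : 0 < r by rewrite !lt_min d10 d20 d30 d40.
have [r1 r2 r3 r4] : [/\ r <= d1, r <= d2, r <= d3 & r <= d4].
  by split; rewrite /r !ge_min lexx ?orbT.
have rr : r / 2 < r by lra.
have v1 : 0 < enorm v + 1 by rewrite ltr_wpDl// enorm_ge0.
exists (r / 2 / (enorm v + 1)) => [|h h0 hr]; first by rewrite !divr_gt0.
have hv : enorm (xi - h *: v - xi) < r / 2.
  rewrite addrAC subrr add0r enormN enormZ ger0_norm//.
  by apply: le_lt_trans (_ : h * (enorm v + 1) < _);
    [rewrite ler_wpM2l// lerDl|rewrite -ltr_pdivlMr].
have : V i (xi - h *: v + h *: v) - V i (xi - h *: v) <= - (a / 2) * h; last first.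
  by rewrite subrK -/a; lra.
apply: (@local_increment _ _ (`|L| + 1) _ _ _ _ _ xi (r / 2)) => //.
- by move=> y z h1 h2; apply: HL'; lra.
- by rewrite subrK subrr enorm0 divr_gt0.
move=> y yr dy; pose x' := setblock x y.
have ey : submxrow x' i = y by exact: setblockE.
have Gy : Gambar isSum g gi (Vx x') (enorm u) i <= V i (submxrow x' i).
  rewrite (@Gambar_row_congr _ (Vx x)) => [|j|j|j ij]; [|exact: V0|exact: V0|by rewrite /x' setblock_neq].
  rewrite ey; have := H2 y (ltac:(lra)); rewrite ltr_norml => /andP[_]; lra.
have dx' : differentiable (V i) (submxrow x' i) by rewrite ey.
have := decr dx' Gy; rewrite ey => D1.
have D2 : `|'d (V i) y (v - f i x' (submxrow u i))| <= a / 4.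
  have dy0 : 0 < d1 - enorm (y - xi) by lra.
  apply: (le_trans (@diff_enorm_le _ _ _ _ (`|L| + 1) _ _ dy0 _ dy)).
    move=> z zy; apply: HL'; last by lra.
    by apply: (le_lt_trans (enorm_dist _ y _)); lra.
  rewrite -ler_pdivlMl// enormBC mulrC ltW//.
  have := H3 y (ltac:(lra)); rewrite -/x' setblock_id.
  by [].
have D3 := H4 y (ltac:(lra)).
rewrite linearB /= in D2.
by move: D2; rewrite ler_norml => /andP[_]; lra.
Qed.

Variables (sigma sigmainv : 'I_n -> R -> R) (phi : R -> R).
Hypothesis Is : forall i, isKinf (sigma i).
Hypothesis Iv : forall i, isKinf (sigmainv i).
Hypothesis sK : forall i r, 0 <= r -> sigmainv i (sigma i r) = r /\ sigma i (sigmainv i r) = r.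
Hypothesis Iphi : isKinf phi.
Hypothesis Gs : forall r, 0 < r -> forall i,
  Gambar isSum g gi (fun j => sigma j r) (phi r) i < sigma i r.
Hypothesis slope : forall i p q, 0 < p -> exists c d : R, (0 < c <= d) /\
  forall a b : R, p <= a -> a <= b -> b <= q ->
    c * (b - a) <= sigmainv i b - sigmainv i a <= d * (b - a).

Let wcomp x i := sigmainv i (V i (submxrow x i)).
Let W x := vmax (wcomp x).

Lemma wcomp_ge0 x i : 0 <= wcomp x i.
Proof. by apply: isK_ge0; [case: (Iv i)|exact: V0]. Qed.

Lemma wcomp_continuous i : continuous (wcomp^~ i).
Proof.
move=> x; apply: (@Kcvg R _ (nbhs x) _ (sigmainv i) (fun x => V i (submxrow x i))) => //.
- by apply: isK_continuous_max; case: (Iv i).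
- apply: (@continuous_comp _ _ _ (fun x => submxrow x i) (V i)).
    exact: continuous_submxrow.
  by case: (Vreg i) => h _ _; apply: h.
Qed.

Lemma maxV_continuous : continuous W.
Proof. by move=> x; apply: (@vmax_cvg _ _ _ (nbhs x) (nbhs_pfilter x)) => i; exact: wcomp_continuous. Qed.

Lemma maxV_proper : proper_pd W.
Proof.
have /choice[psi psiP] : forall i, exists p : (R -> R) * (R -> R),
    [/\ isKinf p.1, isKinf p.2 & forall y, p.1 (enorm y) <= V i y /\ V i y <= p.2 (enorm y)].
  by move=> i; have [_ [p1 [p2 H]] _] := Vreg i; exists (p1, p2).
have n0 : 0 < n.+1%:R^-1 :> R by rewrite invr_gt0.
pose h1 i := sigmainv i \o ((psi i).1 \o (fun r : R => n.+1%:R^-1 * r)).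
pose h2 i := sigmainv i \o (psi i).2.
have [p1 I1 P1] := @isKinf_finite_min R _ h1 (fun i => ltac:(
  have [a _ _] := psiP i; exact: (isKinf_comp (Iv i) (isKinf_comp a (isKinf_scale n0))))).
have [p2 I2 P2] := @isKinf_finite_max R _ h2 (fun i => ltac:(
  have [_ a _] := psiP i; exact: (isKinf_comp (Iv i) a))).
exists p1, p2; split => // x; split; last first.
  apply: vmax_le => [|i]; first by apply: isK_ge0 I2.1 (enorm_ge0 x).
  apply: le_trans (P2 i _ (enorm_ge0 x)); rewrite /h2 /wcomp /=.
  have [_ J2 H] := psiP i; apply: (isK_le (Iv i).1 (@V0 i (submxrow x i))).
  by apply: (le_trans (H _).2); apply: (isK_le J2.1 (enorm_ge0 _)); exact: enorm_block_le.
(* If every block were shorter, summation would give [enorm x <= n / (n + 1) * enorm x], so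
   [x = 0]. *)
have [[i Hi]|no] := pselect (exists i, n.+1%:R^-1 * enorm x <= enorm (submxrow x i)).
  apply: le_trans (le_vmax _ i); apply: (le_trans (P1 i _ (enorm_ge0 x))).
  rewrite /h1 /wcomp /=; have [J1 _ H] := psiP i.
  have s0 : 0 <= n.+1%:R^-1 * enorm x by rewrite mulr_ge0 ?enorm_ge0 ?(ltW n0).
  apply: (isK_le (Iv i).1 (isK_ge0 J1.1 s0)).
  by apply: le_trans (H _).1; apply: (isK_le J1.1 s0 Hi).
have -> : enorm x = 0; last by case: I1.1 => -> _ _ _; exact: vmax_ge0.
apply/le_anti; rewrite enorm_ge0 andbT.
have : enorm x <= \sum_(i < n) n.+1%:R^-1 * enorm x.
  apply: (le_trans (enorm_le_blocks x)); apply: ler_sum => i _; rewrite leNgt.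
  by apply/negP => /ltW h; apply: no; exists i.
rewrite sumr_const card_ord -[_ *+ n]mulr_natl mulrA.
have : n%:R / n.+1%:R = 1 - n.+1%:R^-1 :> R.
  by rewrite -natr1; field; rewrite natr1 pnatr_eq0.
move=> ->; rewrite mulrBl mul1r -subr_ge0 addrAC subrr sub0r oppr_ge0.
by rewrite pmulr_rle0.
Qed.

Lemma maxV_gt0 x : x != 0 -> 0 < W x.
Proof.
have [p1 [p2 [I1 _ H]]] := maxV_proper => x0; apply: lt_le_trans (H x).1.
by apply: isK_gt0 I1.1 _; rewrite enorm_gt0.
Qed.

(** A component may fail to be Lipschitz where its block vanishes; cutting it off from below at [r]
    makes it constant near such points. *)
Lemma component_loclip x0 i (r : R) : 0 < r -> exists d L : R, [/\ 0 < d, 0 <= L &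
  forall x y, enorm (x - x0) < d -> enorm (y - x0) < d ->
    `|Num.max (wcomp x i) r - Num.max (wcomp y i) r| <= L * enorm (x - y)].
Proof.
move=> r0; have mlip (a b : R) : `|Num.max a r - Num.max b r| <= `|a - b|.
  rewrite /Num.max; case: ltP => h1; case: ltP => h2; rewrite ?lexx//.
  - by rewrite subrr normr0.
  - by rewrite distrC [leRHS]distrC !ger0_norm; lra.
  - by rewrite !ger0_norm; lra.
have [x00|x00] := eqVneq (submxrow x0 i) 0.
  have w0 : wcomp x0 i = 0.
    rewrite /wcomp x00; have [_ [p1 [p2 [I1 I2 H]]] _] := Vreg i.
    have -> : V i 0 = 0.
      apply/le_anti; rewrite V0 andbT (le_trans (H 0).2)//.
      by rewrite enorm0; case: I2.1 => ->.
    by case: (Iv i).1.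
  have [d d0 Hd] := enorm_cvgP (@wcomp_continuous i x0) r0.
  exists d, 0; split => // x y /Hd; rewrite w0 sub0r normrN => xd /Hd.
  rewrite w0 sub0r normrN => yd; rewrite mul0r !max_r ?subrr ?normr0//.
    exact: le_trans (ler_norm _) (ltW yd).
  exact: le_trans (ler_norm _) (ltW xd).
have [Vc Vp Vl] := Vreg i.
have v0 : 0 < V i (submxrow x0 i).
  have [p1 [p2 [I1 _ H]]] := Vp; apply: lt_le_trans (H _).1.
  by apply: isK_gt0 I1.1 _; rewrite enorm_gt0.
set v := V i _ in v0.
have [d1 [L [d10 HL]]] := Vl _ x00.
have [d2 d20 H2] := enorm_cvgP (Vc (submxrow x0 i)) (ltac:(lra) : 0 < v / 2).
have [c [d [/andP[c0 cd] Hs]]] := slope i (v + v) (ltac:(lra) : 0 < v / 2).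
have d0 : 0 <= d by rewrite (le_trans (ltW c0)).
exists (Num.min d1 d2), (d * `|L|); split; [by rewrite lt_min d10|by rewrite mulr_ge0|].
move=> x y; rewrite !lt_min => /andP[x1 x2] /andP[y1 y2]; apply: (le_trans (mlip _ _)).
have blk z e : enorm (z - x0) < e -> enorm (submxrow z i - submxrow x0 i) < e.
  by rewrite -submxrowB; exact/le_lt_trans/enorm_block_le.
have rng z : enorm (z - x0) < d2 -> v / 2 <= V i (submxrow z i) <= v + v.
  move=> /blk/H2; rewrite -/v ltr_norml => /andP[h1 h2]; apply/andP; split; lra.
have /andP[xa xb] := rng _ x2; have /andP[ya yb] := rng _ y2.
have sl (a b : R) : v / 2 <= a -> a <= v + v -> v / 2 <= b -> b <= v + v ->
    `|sigmainv i a - sigmainv i b| <= d * `|a - b|.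
  move=> a1 a2 b1 b2; have [ab|/ltW ab] := leP a b.
    have /andP[h1 h2] := Hs a b a1 ab b2; have ba : 0 <= b - a by rewrite subr_ge0.
    rewrite distrC [`|a - b|]distrC !ger0_norm//.
    by apply: le_trans h1; rewrite mulr_ge0 ?(ltW c0).
  have /andP[h1 h2] := Hs b a b1 ab a2; have ba : 0 <= a - b by rewrite subr_ge0.
  rewrite !ger0_norm//.
  by apply: le_trans h1; rewrite mulr_ge0 ?(ltW c0).
apply: (le_trans (sl _ _ xa xb ya yb)); rewrite -mulrA ler_wpM2l//.
apply: (le_trans (HL _ _ (blk _ _ x1) (blk _ _ y1))).
apply: (@le_trans _ _ (`|L| * enorm (submxrow x i - submxrow y i))).
  by rewrite ler_wpM2r ?enorm_ge0// ler_norm.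
by rewrite ler_wpM2l// -submxrowB enorm_block_le.
Qed.

(** Near [x0] the maximum exceeds half of [W x0], so raising every component to that level does not
    change it. *)
Lemma maxV_loclip : loclip_nz W.
Proof.
move=> x0 x00; have r0 := maxV_gt0 x00; set r := W x0 / 2.
have r20 : 0 < r by rewrite /r divr_gt0.
have /choice[p pP] : forall i, exists p : R * R, [/\ 0 < p.1, 0 <= p.2 &
  forall x y, enorm (x - x0) < p.1 -> enorm (y - x0) < p.1 ->
    `|Num.max (wcomp x i) r - Num.max (wcomp y i) r| <= p.2 * enorm (x - y)].
  by move=> i; have [d [L H]] := component_loclip x0 i r20; exists (d, L).
have [e e0 He] := finite_pos_min (fun i => ltac:(by case: (pP i)) : 0 < (p i).1).
have [d d0 Hd] := enorm_cvgP (@maxV_continuous x0) r20.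
exists (Num.min e d), (\sum_i (p i).2); split; first by rewrite lt_min e0.
have WE x : enorm (x - x0) < d -> W x = vmax (fun i => Num.max (wcomp x i) r).
  move=> /Hd; rewrite ltr_norml => /andP[_ h]; have {}h : r < W x by rewrite /r in h *; lra.
  apply/le_anti/andP; split.
    apply: vmax_le => [|i]; first exact: vmax_ge0.
    by apply: le_trans (le_vmax _ i); rewrite le_max lexx.
  apply: vmax_le => [|i]; first exact: vmax_ge0.
  by rewrite ge_max le_vmax ltW.
move=> x y; rewrite !lt_min => /andP[x1 x2] /andP[y1 y2]; rewrite !WE//.
have S0 : 0 <= \sum_i (p i).2 by apply: sumr_ge0 => i _; case: (pP i).
apply: vmax_dist => [|i]; first by rewrite mulr_ge0 ?enorm_ge0.
have [_ _ H] := pP i.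
apply: (le_trans (H x y (lt_le_trans x1 (He i)) (lt_le_trans y1 (He i)))).
rewrite ler_wpM2r ?enorm_ge0//; apply: (@le_sum_term _ _ (fun i => (p i).2)) => j.
by case: (pP j).
Qed.

(** At an active index [V i] lies on the path at parameter [W x], and every other [V j] lies below
    it, so the strict inequality along the path transfers by monotonicity. *)
Lemma active_margin x u i : 0 < W x -> enorm u <= phi (W x) -> wcomp x i = W x ->
  V i (submxrow x i) = sigma i (W x) /\
  Gambar isSum g gi (Vx x) (enorm u) i < V i (submxrow x i).
Proof.
move=> W0 uW wi; have e : V i (submxrow x i) = sigma i (W x).
  by rewrite -wi /wcomp (sK i (V0 _)).2.
split => //; rewrite e; apply: le_lt_trans (Gs W0 i).
have Vs j : V j (submxrow x j) <= sigma j (W x).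
  rewrite -[leLHS](sK j (V0 _)).2; apply: (isK_le (Is j).1 (wcomp_ge0 x j)).
  exact: (le_vmax (wcomp x)).
have gg := isK_le (hgi i) (enorm_ge0 u) uW.
rewrite /Gambar; case: ifP => _.
  by apply: lerD => //; apply: ler_sum => j _; apply: isKinf0_le => //; exact: V0.
rewrite ge_max; apply/andP; split; last by rewrite le_max gg orbT.
rewrite le_max; apply/orP; left.
by apply: le_bigmax2 => j _; apply: isKinf0_le => //; exact: V0.
Qed.

Lemma maxV_decrease_on (a b : R) : 0 < a -> a <= b -> exists2 c, 0 < c & forall x u,
  differentiable W x -> enorm u <= phi (W x) -> a <= enorm x <= b ->
  'd W x (interconnect f x u) <= - c.
Proof.
move=> a0 ab; have [p1 [p2 [I1 I2 HW]]] := maxV_proper.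
have b0 : 0 < b by exact: lt_le_trans ab.
suff /choice[c cP] : forall i, exists c, 0 < c /\ forall x u,
    differentiable W x -> enorm u <= phi (W x) -> a <= enorm x <= b -> wcomp x i = W x ->
    'd W x (interconnect f x u) <= - c.
  have [c' c'0 Hc] := finite_pos_min (fun i => (cP i).1); exists c' => // x u dW uW xab.
  have W0 : 0 < W x.
    by apply: maxV_gt0; rewrite -enorm_gt0; case/andP: xab => h _; exact: lt_le_trans h.
  have [i wi] := vmax_attained W0.
  by apply: (le_trans ((cP i).2 x u dW uW xab wi)); rewrite lerN2.
move=> i; have [_ [q1 [q2 [J1 J2 HV]]] _] := Vreg i.
(* While [i] is active, [V i] stays in [[p, q]] on this shell, and [rh] is the resulting lower bound
   on the norm of block [i]. *)
pose p := sigma i (p1 a); pose q := sigma i (p2 b).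
have p0 : 0 < p by apply: isK_gt0 (Is i).1 (isK_gt0 I1.1 a0).
have [q2v K2 q2P] := isKinf_inv J2.
pose rh := q2v p; have rh0 : 0 < rh by exact: isK_gt0 K2.1 p0.
have rm : rh <= Num.max rh b by rewrite le_max lexx.
have [al al0 Hal] := isPD_lower (hal i) rh0 rm.
(* The slope [c] converts decrease of [V i] into decrease of [W]; the range reaches [q + 1] because
   [V i] grows backwards in time. *)
have [c [d [/andP[c0 _] Hs]]] := slope i (q + 1) p0.
exists (c * (al / 2)); split; first by rewrite mulr_gt0// divr_gt0.
move=> x u dW uW /andP[xa xb] wi.
have x0 : x != 0 by rewrite -enorm_gt0; exact: lt_le_trans xa.
have W0 := maxV_gt0 x0.
have [Vi Gi] := active_margin W0 uW wi.
have Wp : p1 a <= W x by apply: le_trans (HW x).1; exact: isK_le I1.1 (ltW a0) xa.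
have Wq : W x <= p2 b by apply: (le_trans (HW x).2); exact: isK_le I2.1 (enorm_ge0 x) xb.
have Vp : p <= V i (submxrow x i) by rewrite Vi; exact: isK_le (Is i).1 (isK_ge0 I1.1 (ltW a0)) Wp.
have Vq : V i (submxrow x i) <= q by rewrite Vi; exact: isK_le (Is i).1 (ltW W0) Wq.
have xr : rh <= enorm (submxrow x i).
  rewrite -(q2P _ (enorm_ge0 _)).1; apply: (isK_le K2.1 (ltW p0)).
  by apply: (le_trans Vp); exact: (HV _).2.
have xi0 : submxrow x i != 0 by rewrite -enorm_gt0; exact: lt_le_trans xr.
have Ha : al <= alphai i (enorm (submxrow x i)).
  apply: Hal; rewrite xr /= le_max; apply/orP; right.
  exact: le_trans (enorm_block_le _ _) xb.
have [h0 h00 Hh] := subsystem_increment xi0 Gi.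
set F := interconnect f x u; set v := f i x (submxrow u i) in Hh.
have Fi : submxrow F i = v by rewrite /F /interconnect mxrowK.
have Vc : {for 0, continuous (fun h : R => V i (submxrow x i - h *: v))}.
  apply: (@continuous_comp _ _ _ (fun h : R => submxrow x i - h *: v) (V i)).
    by apply: cvgB; [exact: cvg_cst|apply: cvgZr_tmp; exact: cvg_id].
  by case: (Vreg i) => hc _ _; apply: hc.
have /cvgrPdist_lt/(_ _ ltr01)/nbhs_ballP[h1 /= h10 Vn] := Vc.
(* Backwards in time, the maximum is bounded below by a single active component. *)
apply: (@diff_le_backward _ _ _ _ _ _ (Num.min h0 h1)) => //; first by rewrite lt_min h00.
move=> h hp; rewrite lt_min => /andP[hh0 hh1].
have {}Vn : V i (submxrow x i - h *: v) <= q + 1.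
  have := Vn h; rewrite /ball /= sub0r normrN gtr0_norm// => /(_ hh1).
  by rewrite scale0r subr0 ltr_norml => /andP[]; lra.
have H1 := Hh h (ltW hp) hh0.
have H2 : al / 2 * h <= V i (submxrow x i - h *: v) - V i (submxrow x i).
  apply: (@le_trans _ _ (alphai i (enorm (submxrow x i)) / 2 * h)); last by lra.
  by rewrite ler_wpM2r ?(ltW hp)//; lra.
have H20 : 0 <= al / 2 * h by rewrite mulr_ge0 ?(ltW hp)// divr_ge0// ltW.
have H5 : V i (submxrow x i) <= V i (submxrow x i - h *: v) by rewrite -subr_ge0 (le_trans H20).
have /andP[H3 _] := Hs _ _ Vp H5 Vn.
have H4 : W x + c * (al / 2 * h) <= W (x - h *: F).
  apply: le_trans (le_vmax _ i); rewrite -wi /wcomp.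
  rewrite (_ : submxrow (x - h *: F) i = submxrow x i - h *: v); last first.
    by rewrite -scaleNr submxrowZD scaleNr Fi.
  have : c * (al / 2 * h) <= c * (V i (submxrow x i - h *: v) - V i (submxrow x i)).
    by rewrite ler_wpM2l// ltW.
  by move: H3; lra.
by move: H4; lra.
Qed.

(** The gain is the inverse of [phi]. The bounds on shells exclude the origin, but there [W] is
    minimal, so its derivative, if it exists, is at most [0]. *)
Lemma max_ISS_Lyapunov : ISS_Lyapunov (interconnect f) W.
Proof.
split; [exact: maxV_continuous|exact: maxV_proper|exact: maxV_loclip|].
have [phiv Iphiv phivP] := isKinf_inv Iphi.
pose P1 x u := differentiable W x /\ enorm u <= phi (W x).
pose D1 x u : R := 'd W x (interconnect f x u).
pose P (p : 'rV[R]_(\sum_(j < n) N j) * 'rV[R]_(\sum_(j < n) m j)) := P1 p.1 p.2.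
have [|al Ial Hal] := @isPD_of_local_bounds R _ P (fun p => enorm p.1) (fun p => D1 p.1 p.2).
  move=> a b a0 ab; have [c c0 Hc] := maxV_decrease_on a0 ab; exists c => // -[x u] [dW uW].
  exact: Hc.
exists phiv, al; split => //; first by case: Iphiv.
move=> x u dW uW.
have W0 : 0 <= W x by exact: vmax_ge0.
have Pxu : P (x, u).
  split => //=; rewrite -(phivP _ (enorm_ge0 u)).2; apply: (isK_le Iphi.1) => //.
  by apply: isK_ge0 (enorm_ge0 u); case: Iphiv.
have [x0|x0] := eqVneq x 0; last by apply: (Hal (x, u)) => //=; rewrite enorm_gt0.
have -> : al (enorm x) = 0 by case: Ial => _ /(_ _ (enorm_ge0 x))[_ [_ ->]]//; rewrite x0 enorm0.
rewrite oppr0; apply: (@diff_le_backward _ _ _ _ _ _ 1) => // h _ _.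
rewrite mul0r subr_le0.
have -> : W x = 0; last exact: vmax_ge0.
have [p1 [p2 [_ I2 H]]] := maxV_proper; apply/le_anti; rewrite W0 andbT.
by apply: (le_trans (H x).2); rewrite x0 enorm0; case: I2.1 => ->.
Qed.

End MaxLyapunov.

(** * Lyapunov functions along trajectories *)

Section IntervalIntegrals.
Variable R : realType.
Local Notation mu := (@lebesgue_measure R).
Implicit Types (a b c t T : R).

Lemma Rintegral_increment (G : R -> R) a b T : mu.-integrable `[0, T] (EFin \o G) ->
  0 <= a -> a <= b -> b <= T ->
  \int[mu]_(s in `[0, b]) G s - \int[mu]_(s in `[0, a]) G s = \int[mu]_(s in `[a, b]) G s.
Proof.
move=> iG a0 ab bT.
have sub c d : 0 <= c -> d <= T -> `[c, d] `<=` `[0, T].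
  by move=> c0 dT s /=; rewrite !in_itv /= => /andP[h1 h2]; rewrite (le_trans c0 h1) (le_trans h2 dT).
have i1 : mu.-integrable `[0, b] (EFin \o G) by apply: integrableS iG => //; exact: sub.
have i2 : mu.-integrable `[a, b] (EFin \o G) by apply: integrableS iG => //; exact: sub.
rewrite Rintegral_itvB//.
rewrite Rintegral_itv_obnd_cbnd//; apply: integrableS i2 => //.
by move=> s /=; rewrite !in_itv /= => /andP[/ltW -> ->].
Qed.

Lemma integrable_cst_itv a b c : mu.-integrable `[a, b] (EFin \o cst c).
Proof.
have fin : (mu [set` `[a, b]] < +oo)%E.
  by rewrite lebesgue_measure_itv /=; case: ifP => _; rewrite -?EFinB ltry.
apply: (measurable_bounded_integrable _ fin) => //.
exists `|c|; split; first exact: num_real.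
by move=> M cM s _ /=; exact: ltW.
Qed.

Lemma Rintegral_lincomb (I : Type) (r : seq I) (c : I -> R) (G : I -> R -> R) a b :
  (forall j, mu.-integrable `[a, b] (EFin \o G j)) ->
  mu.-integrable `[a, b] (EFin \o (fun s => \sum_(j <- r) c j * G j s)) /\
  \int[mu]_(s in `[a, b]) (\sum_(j <- r) c j * G j s) =
  \sum_(j <- r) c j * \int[mu]_(s in `[a, b]) G j s.
Proof.
move=> iG; elim: r => [|j r [IHi IHe]].
  have e : (fun s : R => \sum_(j <- [::]) c j * G j s) = cst 0 by apply/funext => s; rewrite big_nil.
  rewrite e; split; first exact: integrable_cst_itv.
  by rewrite big_nil Rintegral_cst//= mul0r.
have e : (fun s : R => \sum_(j <- j :: r) c j * G j s) =
    (fun s => c j * G j s + \sum_(j <- r) c j * G j s).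
  by apply/funext => s; rewrite big_cons.
have i1 : mu.-integrable `[a, b] (EFin \o (fun s => c j * G j s)).
  by have := @integrableZl _ _ _ mu `[a, b]%classic (ltac:(exact: measurable_itv)) (c j) _ (iG j).
rewrite e; split.
  by have := @integrableD _ _ _ mu `[a, b]%classic (ltac:(exact: measurable_itv)) _ _ i1 IHi.
by rewrite RintegralD// RintegralZl// big_cons IHe.
Qed.

Lemma Rintegral_lincomb_le k (G : R -> 'rV[R]_k) (c : 'I_k -> R) C a b : a <= b ->
  (forall j, mu.-integrable `[a, b] (EFin \o (fun s => G s 0 j))) ->
  (forall s, a <= s <= b -> \sum_j c j * G s 0 j <= C) ->
  \sum_j c j * \int[mu]_(s in `[a, b]) G s 0 j <= C * (b - a).
Proof.
move=> ab iG H.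
have [i1 <-] := @Rintegral_lincomb _ (index_enum 'I_k) c (fun j s => G s 0 j) a b iG.
have -> : C * (b - a) = \int[mu]_(s in `[a, b]) C.
  by rewrite Rintegral_cst//= lebesgue_measure_cc.
apply: le_Rintegral => //; exact: integrable_cst_itv.
Qed.

End IntervalIntegrals.

Section LyapunovAlongSolutions.
Variables (R : realType) (k m : nat) (F : 'rV[R]_k -> 'rV[R]_m -> 'rV[R]_k) (V : 'rV[R]_k -> R).
Variables (gam alpha : R -> R).
Hypothesis Floc : loclip_unif F.
Hypothesis Vc : continuous V.
Hypothesis Vp : proper_pd V.
Hypothesis Vl : loclip_nz V.
Hypothesis Kgam : isK gam.
Hypothesis Pal : isPD alpha.
Hypothesis Vdec : forall x u, differentiable V x -> gam (enorm u) <= V x ->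
  'd V x (F x u) <= - alpha (enorm x).
Local Notation mu := (@lebesgue_measure R).

Lemma diff_coord (y w : 'rV[R]_k) :
  'd V y w = \sum_j 'd V y (delta_mx 0 j) * w 0 j.
Proof.
rewrite {1}(row_sum_delta w) linear_sum /=; apply: eq_bigr => j _.
by rewrite linearZ /= [RHS]mulrC.
Qed.

Lemma proper_pd_0 : V 0 = 0.
Proof.
apply/le_anti; rewrite (proper_pd_ge0 _ Vp) andbT.
have [p1 [p2 [_ I2 H]]] := Vp; apply: (le_trans (H 0).2).
by rewrite enorm0; case: I2.1 => ->.
Qed.

(** The averaged velocity [v] need not be a value of [F], but a differential is linear: its value on
    [v] is the mean of its values on [F (x s) (ut s)], where the uniform Lipschitz bound replaces
    [x s] by [y]. Agreement of [G] with [F] is asked only for a short time, which covers the cut-off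
    system too. *)
Lemma lyapunov_dini (x G : R -> 'rV[R]_k) (ut : R -> 'rV[R]_m) (r t b dl : R) :
  0 <= r -> t < b -> 0 < dl -> (forall s, enorm (ut s) <= r) ->
  (forall j, mu.-integrable `[t, b] (EFin \o (fun s => G s 0 j))) ->
  (forall s, t <= s <= b -> forall j, x s 0 j - x t 0 j = \int[mu]_(s in `[t, s]) G s 0 j) ->
  (forall e, 0 < e -> exists2 d, 0 < d & forall s, t <= s -> s < t + d -> s <= b ->
     enorm (x s - x t) < e) ->
  (forall s, t <= s -> s < t + dl -> s <= b -> G s = F (x s) (ut s)) ->
  gam r < V (x t) ->
  exists2 d, 0 < d & forall h, 0 <= h -> h < d ->
    t + h <= b /\ V (x (t + h)) + alpha (enorm (x t)) / 2 * h <= V (x t).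
Proof.
move=> r0 tb dl0 utr iG xE xc GF Vt; set xt := x t in xE xc Vt *.
pose a := alpha (enorm xt).
have xt0 : xt != 0.
  apply/eqP => e; move: Vt; rewrite e proper_pd_0 ltNge.
  by rewrite (isK_ge0 Kgam r0).
have a0 : 0 < a.
  have [_ /(_ _ (enorm_ge0 xt))[h1 h2]] := Pal.
  rewrite lt_neqAle h1 andbT eq_sym; apply/eqP => /h2/enorm_eq0 e.
  by rewrite e eqxx in xt0.
have [d1 [L [d10 HL]]] := Vl xt0.
pose L1 : R := `|L| + 1; have L10 : 0 < L1 by rewrite ltr_wpDl.
have HL' y z : enorm (y - xt) < d1 -> enorm (z - xt) < d1 ->
    `|V y - V z| <= L1 * enorm (y - z).
  move=> h1 h2; apply: (le_trans (HL y z h1 h2)); rewrite ler_wpM2r ?enorm_ge0//.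
  by rewrite /L1 (le_trans (ler_norm L))// lerDl.
have [d2 d20 H2] := enorm_cvgP (@Vc xt) (ltac:(rewrite subr_gt0; exact: Vt) : 0 < V xt - gam r).
have [d3 [La [d30 H3]]] := Floc r xt.
pose La1 : R := `|La| + 1; have La10 : 0 < La1 by rewrite ltr_wpDl.
have [d4 d40 H4] : exists2 d4, 0 < d4 & forall y, enorm (y - xt) < d4 ->
    3 / 4 * a <= alpha (enorm y).
  have hc : continuous (fun y : 'rV[R]_k => alpha (Num.max (enorm y) 0)).
    move=> y; apply: (@continuous_comp _ _ _ (@enorm R k) (fun t : R => alpha (Num.max t 0))).
      exact: continuous_enorm.
    by apply: (iffLR (within_RnnP _)); case: Pal.
  have [d d0 Hd] := enorm_cvgP (hc xt) (ltac:(lra) : 0 < a / 4).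
  exists d => // y /Hd; rewrite !max_l ?enorm_ge0// -/a.
  by rewrite ltr_norml => /andP[_]; lra.
(* Makes replacing [x s] by [y], at distance at most [d5 * 2], cost at most [a / 4]. *)
pose d5 : R := a / 4 / (L1 * La1) / 2.
have LL0 : 0 < L1 * La1 by rewrite mulr_gt0.
have d50 : 0 < d5 by rewrite !divr_gt0.
pose rr : R := Num.min (Num.min (Num.min d1 d2) (Num.min d3 d4)) d5.
have rr0 : 0 < rr by rewrite !lt_min d10 d20 d30 d40 d50.
have [r1 r2 r3 r4 r5] : [/\ rr <= d1, rr <= d2, rr <= d3, rr <= d4 & rr <= d5].
  by split; rewrite /rr !ge_min lexx ?orbT.
have rad0 : 0 < rr / 2 by rewrite divr_gt0.
have [dx dx0 Hdx] := xc _ rad0.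
pose d : R := Num.min (Num.min dl dx) (b - t).
exists d; first by rewrite !lt_min dl0 dx0 subr_gt0.
move=> h h0; rewrite !lt_min => /andP[/andP[hdl hdx] hb].
have thb : t + h <= b by rewrite -lerBrDl ltW.
split => //; move: h0; rewrite le_eqVlt => /predU1P[<-|h0]; first by rewrite mulr0 !addr0.
have near_s s : t <= s -> s <= t + h -> enorm (x s - xt) < rr / 2.
  move=> ts sh; apply: Hdx => //; last exact: le_trans thb.
  by apply: (le_lt_trans sh); rewrite ltrD2l.
pose v := h^-1 *: (x (t + h) - xt).
have hv : xt + h *: v = x (t + h) by rewrite /v scalerA divff ?gt_eqF// scale1r subrKC.
have : V (xt + h *: v) - V xt <= - (a / 2) * h; last by rewrite hv -/a; lra.
apply: (@local_increment _ _ L1 _ _ _ _ _ xt (rr / 2)) => //.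
- by move=> y z h1 h2; apply: HL'; move: r1 rad0; lra.
- exact: ltW.
- by rewrite subrr enorm0.
- by rewrite hv; apply: near_s => //; rewrite lerDl ltW.
move=> y yr dy; rewrite /v linearZ /= -[_ *: _]/(h^-1 * _) mulrC ler_pdivrMr//.
rewrite diff_coord.
have -> : \sum_j 'd V y (delta_mx 0 j) * (x (t + h) - xt) 0 j =
    \sum_j 'd V y (delta_mx 0 j) * \int[mu]_(s in `[t, t + h]) G s 0 j.
  apply: eq_bigr => j _; congr (_ * _); rewrite -xE; first by rewrite !mxE.
  by rewrite thb andbT lerDl ltW.
have -> : - (a / 2) * h = - (a / 2) * (t + h - t) by rewrite addrAC subrr add0r.
apply: Rintegral_lincomb_le; first by rewrite lerDl ltW.
  move=> j; apply: integrableS (iG j) => //.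
  by move=> s /=; rewrite !in_itv /= => /andP[-> /= /le_trans]; apply.
move=> s /andP[ts sh]; rewrite -diff_coord GF//; last 2 first.
- by apply: (le_lt_trans sh); rewrite ltrD2l.
- exact: le_trans thb.
have sx := near_s s ts sh.
have D1 : 'd V y (F y (ut s)) <= - alpha (enorm y).
  apply: Vdec => //; apply: (@le_trans _ _ (gam r)); first exact: isK_le Kgam (enorm_ge0 _) (utr s).
  have /H2 : enorm (y - xt) < d2 by move: r2 rad0 yr; lra.
  by rewrite ltr_norml => /andP[_]; lra.
have D3 : 3 / 4 * a <= alpha (enorm y) by apply: H4; move: r4 rad0 yr; lra.
have D2 : `|'d V y (F (x s) (ut s) - F y (ut s))| <= a / 4.
  have dy0 : 0 < d1 - enorm (y - xt) by move: r1 rad0 yr; lra.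
  apply: (le_trans (@diff_enorm_le _ _ _ _ L1 _ _ dy0 _ dy)).
    move=> z zy; apply: HL'; last by move: r1 rad0 yr; lra.
    by apply: (le_lt_trans (enorm_dist _ y _)); lra.
  have e1 : enorm (F (x s) (ut s) - F y (ut s)) <= La1 * enorm (x s - y).
    apply: (le_trans (H3 (x s) y (ut s) _ _ (utr s))); [by move: r3 rad0 sx; lra|by move: r3 rad0 yr; lra|].
    by rewrite ler_wpM2r ?enorm_ge0// /La1 (le_trans (ler_norm La))// lerDl.
  have e2 : enorm (x s - y) <= d5 * 2.
    apply: (le_trans (enorm_dist _ xt _)); rewrite [enorm (xt - y)]enormBC.
    by move: sx yr r5; lra.
  apply: (@le_trans _ _ (L1 * (La1 * (d5 * 2)))); last first.
    by rewrite mulrA /d5 divfK// mulrC divfK// gt_eqF.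
  by rewrite ler_wpM2l ?(ltW L10)// (le_trans e1)// ler_wpM2l// ltW.
move: D2; rewrite linearB /= ler_norml => /andP[_]; lra.
Qed.

End LyapunovAlongSolutions.

(** * Barriers and decay from Dini inequalities *)

Section Decay.
Variable R : realType.
Implicit Types (v w : R -> R) (a b c l s t : R).

Definition continuous_on_cc v a b := forall t e, a <= t <= b -> 0 < e ->
  exists2 d, 0 < d & forall s, a <= s <= b -> `|s - t| < d -> `|v s - v t| < e.

(** The supremum of the times up to which the bound has held cannot precede [b]: continuity carries
    the bound past it when [v < l], the hypothesis when [v = l]. *)
Lemma level_barrier v a b l : a <= b -> v a <= l -> continuous_on_cc v a b ->
  (forall t, a <= t < b -> v t = l ->
     exists2 d, 0 < d & forall h, 0 <= h -> h < d -> v (t + h) <= l) ->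
  v b <= l.
Proof.
move=> ab va vc H.
pose S := [set t | a <= t <= b /\ forall s, a <= s <= t -> v s <= l].
have Sa : S a.
  split; first by rewrite lexx.
  by move=> s /andP[h1 h2]; rewrite (_ : s = a)//; apply/le_anti; rewrite h1 h2.
have ubS : ubound S b by move=> t [/andP[]].
have hS : has_sup S by split; [exists a|exists b].
pose tau := sup S.
have atau : a <= tau by exact: (ub_le_sup hS.2 Sa).
have taub : tau <= b by apply: ge_sup => //; exists a.
have below s : a <= s -> s < tau -> v s <= l.
  move=> as_ st; have e0 : 0 < tau - s by rewrite subr_gt0.
  have [t [_ St]] := sup_adherent e0 hS; rewrite subKr => ts.
  by apply: St; rewrite as_ ltW.
have vtau : v tau <= l.
  rewrite leNgt; apply/negP => lv.
  have e0 : 0 < v tau - l by rewrite subr_gt0.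
  have [|d d0 Hd] := vc tau (v tau - l) _ e0; first by rewrite atau.
  have at' : a < tau.
    by rewrite lt_neqAle atau andbT; apply/eqP => e; move: lv; rewrite -e ltNge va.
  pose s : R := Num.max a (tau - d / 2).
  have [s1 s2 s3] : [/\ a <= s, s < tau & tau - d / 2 <= s].
    by rewrite /s; split; rewrite ?le_max ?gt_max ?lexx ?orbT// at' /=; lra.
  have := Hd s _ _; rewrite s1 (le_trans (ltW s2) taub) => /(_ isT).
  rewrite ltr0_norm ?subr_lt0// ltr_norml => /(_ (ltac:(lra)))/andP[h _].
  by have := below s s1 s2; lra.
have all_le s : a <= s -> s <= tau -> v s <= l.
  by move=> h1; rewrite le_eqVlt => /predU1P[->//|]; exact: below.
have [taub'|taub'] := leP b tau; first exact: all_le.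
have [d d0 Hd] : exists2 d, 0 < d & forall s, tau <= s -> s <= b -> s < tau + d -> v s <= l.
  move: (vtau); rewrite le_eqVlt => /predU1P[e|lt].
    have [|d d0 Hd] := H tau _ e; first by rewrite atau.
    exists d => // s h1 _ h2; have := Hd (s - tau) (ltac:(lra)) (ltac:(lra)).
    by rewrite subrKC.
  have e0 : 0 < l - v tau by rewrite subr_gt0.
  have [|d d0 Hd] := vc tau _ _ e0; first by rewrite atau.
  exists d => // s h1 h2 h3; have := Hd s _ _.
  rewrite (le_trans atau h1) h2 => /(_ isT).
  by rewrite ger0_norm ?subr_ge0// => /(_ (ltac:(lra))); rewrite ltr_norml => /andP[_]; lra.
pose t : R := Num.min b (tau + d / 2).
have [t1 t2 t3] : [/\ tau < t, t <= b & t < tau + d].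
  by rewrite /t; split; rewrite ?ge_min ?lt_min ?gt_min ?lexx// ?taub' /=; lra.
have : t <= tau; last by rewrite leNgt t1.
apply: (ub_le_sup hS.2); split; first by rewrite t2 (le_trans atau (ltW t1)).
move=> s /andP[s1 s2]; have [h|h] := leP s tau; first exact: all_le.
by apply: Hd; [exact: ltW|exact: le_trans s2 t2|exact: le_lt_trans s2 t3].
Qed.

Variables (w A : R -> R) (M T : R).
Hypothesis wc : continuous_on_cc w 0 T.
Hypothesis A0 : forall t, 0 <= A t.
Hypothesis dini : forall t, 0 <= t -> t < T -> M < w t ->
  exists2 d, 0 < d & forall h, 0 <= h -> h < d -> w (t + h) + A t * h <= w t.

(** If [w s < w t], a level strictly between [max (w s) M] and [w t] is a barrier, since the Dini
    inequality is available above [M]. *)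
Lemma dini_nonincreasing s t : 0 <= s -> s <= t -> t <= T -> M < w t -> w t <= w s.
Proof.
move=> s0 st tT Mt; rewrite leNgt; apply/negP => wst.
pose l : R := (Num.max (w s) M + w t) / 2.
have [m1 m2 m3] : [/\ w s <= Num.max (w s) M, M <= Num.max (w s) M & Num.max (w s) M < w t].
  by split; rewrite ?le_max ?gt_max ?lexx ?orbT// wst Mt.
have : w t <= l; last by rewrite /l; lra.
apply: (level_barrier st); first by rewrite /l; lra.
  move=> u e /andP[u1 u2] e0; have [|d d0 Hd] := wc (t := u) _ e0.
    by rewrite (le_trans s0 u1) (le_trans u2 tT).
  exists d => // z /andP[z1 z2]; apply: Hd.
  by rewrite (le_trans s0 z1) (le_trans z2 tT).
move=> u /andP[su ut] wu.
have [||d d0 Hd] := @dini u (le_trans s0 su); first exact: lt_le_trans tT.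
  by rewrite wu /l; lra.
exists d => // h h0 hd; have := Hd h h0 hd; have := mulr_ge0 (A0 u) h0; rewrite wu; lra.
Qed.

Lemma dini_decay t c : 0 <= t -> t <= T -> M < w t ->
  (forall s, 0 <= s <= t -> c <= A s) -> w t + c * t <= w 0.
Proof.
move=> t0 tT Mt cA; pose v s := w s + c * s.
have := @level_barrier v 0 t (w 0) t0; rewrite /v mulr0 addr0; apply => //.
  move=> u e /andP[u1 u2] e0; have e20 : 0 < e / 2 by rewrite divr_gt0.
  have [|d d0 Hd] := wc (t := u) _ e20; first by rewrite u1 (le_trans u2 tT).
  have c1 : 0 < `|c| + 1 by rewrite ltr_wpDl.
  exists (Num.min d (e / 2 / (`|c| + 1))); first by rewrite lt_min d0 divr_gt0.
  move=> z /andP[z1 z2]; rewrite lt_min ltr_pdivlMr// => /andP[zd ze].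
  have h1 : `|w z - w u| < e / 2 by apply: Hd => //; rewrite z1 (le_trans z2 tT).
  rewrite (_ : _ - _ = (w z - w u) + c * (z - u)); last by ring.
  apply: (le_lt_trans (ler_normD _ _)); rewrite normrM.
  have : `|c| * `|z - u| <= `|z - u| * (`|c| + 1) by rewrite mulrC ler_wpM2l// lerDl.
  by lra.
move=> s /andP[s0 st] vs.
have Ms : M < w s by apply: (lt_le_trans Mt); apply: dini_nonincreasing => //; exact: ltW.
have [|d d0 Hd] := dini s0 _ Ms; first exact: lt_le_trans tT.
exists d => // h h0 hd; have := Hd h h0 hd.
have : c * h <= A s * h by rewrite ler_wpM2r// cA// s0 ltW.
by rewrite mulrDr; lra.
Qed.

End Decay.

(** * An explicit KL bound *)

Section KLBound.
Variables (R : realType) (alpha psi1 psi2 : R -> R).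
Hypothesis Pal : isPD alpha.
Hypothesis I1 : isKinf psi1.
Hypothesis I2 : isKinf psi2.

Let J (a b : R) : R := inf [set alpha t / 2 | t in [set t | a <= t <= b]].

Let J_lb a b : 0 < a -> a <= b ->
  exists2 c, 0 < c & lbound [set alpha t / 2 | t in [set t | a <= t <= b]] c.
Proof.
move=> a0 ab; have [c c0 Hc] := isPD_lower Pal a0 ab; exists (c / 2); first by rewrite divr_gt0.
by move=> _ [t tab <-]; rewrite ler_pM2r ?invr_gt0// Hc.
Qed.

Let J_le a b t : 0 < a -> a <= t -> t <= b -> J a b <= alpha t / 2.
Proof.
move=> a0 at_ tb; apply: ge_inf; last by exists t => //=; rewrite at_.
by have [c _ Hc] := J_lb a0 (le_trans at_ tb); exists c.
Qed.

Let J_gt0 a b : 0 < a -> a <= b -> 0 < J a b.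
Proof.
move=> a0 ab; have [c c0 Hc] := J_lb a0 ab; apply: (lt_le_trans c0).
by apply: lb_le_inf => //; exists (alpha a / 2), a => //=; rewrite lexx.
Qed.

Let J_mono a b a' b' : 0 < a -> a <= a' -> a' <= b' -> b' <= b -> J a b <= J a' b'.
Proof.
move=> a0 aa ab bb; apply: lb_le_inf; first by exists (alpha a' / 2), a' => //=; rewrite lexx.
move=> _ [t /= /andP[h1 h2] <-]; apply: J_le => //; first exact: le_trans h1.
exact: le_trans h2 bb.
Qed.

(** The range is split at [1]: [kap] lies below the infimum of [alpha / 2] over [[s, 1]], and [lam]
    below its infimum over [[1, r]] divided by [alpha 1 / 2]. For [z <= 1] the first factor
    suffices; for [z >= 1] it is at most [alpha 1 / 2], which the division cancels. *)
Lemma PD_separation : exists kap lam : R -> R, [/\ isK kap, continuous lam,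
  (forall r, 0 <= r -> 0 < lam r <= 1),
  (forall r s, 0 <= r -> r <= s -> lam s <= lam r) &
  forall s z r, 0 < s -> s <= z -> z <= r -> kap s * lam r <= alpha z / 2].
Proof.
pose A : R := J 1 1; have A0 : 0 < A by exact: J_gt0.
have mn (t : R) : 0 < t -> 0 < Num.min t 1 by move=> t0; rewrite lt_min t0 ltr01.
have mn1 (t : R) : Num.min t 1 <= 1 by rewrite ge_min lexx orbT.
have mx1 (t : R) : 1 <= Num.max t 1 by rewrite le_max lexx orbT.
have [||kap Kk Hk] := @isK_minorant R (fun t => J (Num.min t 1) 1).
- by move=> t t0; apply: J_gt0 => //; exact: mn.
- move=> a b a0 ab; apply: J_mono => //; first exact: mn.
  by rewrite le_min mn1 ge_min ab.
pose l0 (t : R) : R := J 1 (Num.max t 1) / A.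
have l0p t : 0 < l0 t by rewrite divr_gt0// J_gt0.
have l0n s t : s <= t -> l0 t <= l0 s.
  move=> st; rewrite ler_pM2r ?invr_gt0//; apply: J_mono => //.
  by rewrite ge_max mx1 le_max st.
have l01 t : l0 t <= 1 by rewrite ler_pdivrMr// mul1r; apply: J_mono.
have m0 t : 0 < t -> 0 <= l0 t by move=> _; exact: ltW.
(* The shift keeps the regularised factor positive at [0]. *)
pose lam r := infconv l0 (r + 1).
have lamle r : 0 <= r -> lam r <= l0 r.
  move=> r0; have r1 : 0 < r + 1 by rewrite ltr_wpDl.
  apply: (le_trans (infconv_le m0 (r + 1) r1)); rewrite subrr normr0 addr0.
  by apply: l0n; rewrite lerDl.
exists kap, lam; split => //.
- move=> r; apply: (@continuous_comp _ _ _ (fun r : R => r + 1) (infconv l0)).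
    by apply: cvgD; [exact: cvg_id|exact: cvg_cst].
  exact: infconv_continuous.
- move=> r r0; rewrite (le_trans (lamle r r0) (l01 r)) andbT.
  apply: infconv_gt0 => //; first by rewrite ltr_wpDl.
  by move=> a b a0 ab; exists (l0 b) => // t /andP[_ tb]; exact: l0n.
- move=> r s r0 rs; apply: infconv_nonincr => //; last by rewrite lerD2r.
    by rewrite ltr_wpDl// (le_trans r0).
  by move=> a b _; exact: l0n.
- move=> s z r s0 sz zr; have z0 : 0 < z by exact: lt_le_trans sz.
  have r0 : 0 <= r by rewrite (le_trans (ltW z0)).
  have ks : 0 <= kap s by exact: isK_ge0 Kk (ltW s0).
  have kz : kap s <= kap z by exact: isK_le Kk (ltW s0) sz.
  have lz : lam r <= l0 z by apply: (le_trans (lamle r r0)); exact: l0n.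
  apply: (@le_trans _ _ (kap z * l0 z)).
    by apply: ler_pM => //; exact: infconv_ge0.
  have kJ := Hk z z0; have [z1|/ltW z1] := leP z 1.
    apply: (@le_trans _ _ (kap z)).
      by rewrite ler_piMr// (le_trans ks).
    by apply: (le_trans kJ); apply: J_le; rewrite ?min_l.
  rewrite /l0 mulrA mulrAC; apply: (@le_trans _ _ (1 * J 1 (Num.max z 1))).
    rewrite ler_wpM2r//; first by exact/ltW/J_gt0.
    by rewrite ler_pdivrMr// mul1r (le_trans kJ)//; rewrite min_r.
  by rewrite mul1r; apply: J_le => //; rewrite max_l.
Qed.

(** Taking [c = K2 wt * lh w0] and dividing by [lh w0 <= 1] gives [wt + t * K2 wt <= rho w0]. So
    [wt] is at most the inverse of [s + t * K2 s] at [rho w0], which decreases to [0] in [t] and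
    plays the part of the flow of a comparison equation. *)
Lemma KL_of_decay : exists2 beta, isKL beta & forall r0 w0 wt y t : R,
  0 <= t -> 0 <= r0 -> 0 <= y -> psi1 y <= wt -> w0 <= psi2 r0 -> 0 < wt -> wt <= w0 ->
  (forall c, (forall z, 0 <= z -> wt <= psi2 z -> psi1 z <= w0 -> c <= alpha z / 2) ->
     wt + c * t <= w0) ->
  y <= beta r0 t.
Proof.
have [kap [lam [Kk lc lp ln Hkl]]] := PD_separation.
have [q1 J1 q1P] := isKinf_inv I1; have [q2 J2 q2P] := isKinf_inv I2.
pose lh r := lam (q1 r).
have q10 r : 0 <= r -> 0 <= q1 r by exact: isK_ge0 J1.1.
have lhp r : 0 <= r -> 0 < lh r <= 1 by move=> r0; apply: lp; exact: q10.
have lhn r s : 0 <= r -> r <= s -> lh s <= lh r.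
  by move=> r0 rs; apply: ln; [exact: q10|exact: isK_le J1.1 r0 rs].
pose rho r := r / lh r.
have rho_ge r : 0 <= r -> r <= rho r.
  move=> r0; have /andP[h1 h2] := lhp r r0.
  by rewrite /rho ler_pdivlMr// ler_piMr.
have Irho : isKinf rho.
  split; last first.
    move=> M; exists (Num.max M 0); first by rewrite le_max lexx orbT.
    by apply: le_trans (rho_ge _ _); rewrite le_max lexx ?orbT.
  split.
  - by rewrite /rho mul0r.
  - apply/within_RnnP => x; rewrite /rho.
    have xm : 0 <= Num.max x 0 by rewrite le_max lexx orbT.
    apply: cvgM; first by apply: continuous_max; [exact: cvg_id|exact: cvg_cst].
    apply: cvgV; first by have /andP[h _] := lhp _ xm; rewrite gt_eqF.
    apply: (@continuous_comp _ _ _ (fun x : R => q1 (Num.max x 0)) lam); last exact: lc.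
    exact: (isK_continuous_max J1.1).
  - by move=> r r0; apply: le_trans (rho_ge r r0).
  - move=> a b a0 ab; have b0 : 0 <= b by exact: le_trans (ltW ab).
    have /andP[hb _] := lhp b b0; have /andP[ha _] := lhp a a0.
    apply: (@le_lt_trans _ _ (a / lh b)); last by rewrite /rho ltr_pM2r ?invr_gt0.
    by rewrite /rho ler_wpM2l// lef_pV2 ?posrE// lhn// ltW.
pose K2 := kap \o q2.
have KK2 : isK K2 by apply: isK_comp => //; exact: J2.1.
have IZ t : 0 <= t -> isKinf (fun s => s + t * K2 s).
  rewrite le_eqVlt => /predU1P[<-|t0].
    by apply: (@eq_isKinf R _ id) (isKinf_id R) => s _; rewrite mul0r addr0.
  apply: isKinfDl; first exact: isKinf_id.
  have := isK_comp (isKinf_scale t0).1 KK2; exact.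
have /choice[Z ZP] : forall t, exists z : R -> R, 0 <= t -> isKinf z /\
    forall s, 0 <= s -> z (s + t * K2 s) = s /\ z s + t * K2 (z s) = s.
  move=> t; have [t0|t0] := leP 0 t; last by exists id.
  by have [z Iz zP] := isKinf_inv (IZ t t0); exists z.
have rp r : 0 <= r -> 0 <= rho (psi2 r).
  by move=> r0; apply: isK_ge0 Irho.1 (isK_ge0 I2.1 r0).
have Z0 t s : 0 <= t -> 0 <= s -> 0 <= Z t s.
  by move=> t0 s0; apply: isK_ge0 s0; case: (ZP t t0) => -[].
exists (fun r t => q1 (Z t (rho (psi2 r)))).
  split.
    move=> t t0; have [Iz _] := ZP t t0.
    exact: (isK_comp J1.1 (isK_comp Iz.1 (isK_comp Irho.1 I2.1))).
  move=> r r0; set y := rho _; have y0 : 0 <= y by exact: rp.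
  split.
    move=> t1 t2 t10 t12; have t20 := le_trans t10 t12.
    apply: (isK_le J1.1 (Z0 _ _ t20 y0)); rewrite leNgt; apply/negP => h.
    have [_ /(_ _ y0)[_ e1]] := ZP t1 t10; have [_ /(_ _ y0)[_ e2]] := ZP t2 t20.
    have k12 := isK_le KK2 (Z0 _ _ t10 y0) (ltW h).
    have k1 := isK_ge0 KK2 (Z0 _ _ t10 y0).
    have := ler_pM t10 k1 t12 k12.
    by move: h e1 e2; lra.
  apply/cvgrPdist_lt => e e0; near=> t.
  have t0 : 0 <= t by near: t; exact: nbhs_pinfty_ge.
  rewrite sub0r normrN ger0_norm; last exact/q10/Z0.
  rewrite -[ltRHS](q1P _ (ltW e0)).1 (isK_lt J1.1 (Z0 _ _ t0 y0) (isK_ge0 I1.1 (ltW e0))).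
  have pe := isK_gt0 I1.1 e0; rewrite ltNge; apply/negP => h.
  have [_ /(_ _ y0)[_ e1]] := ZP t t0.
  have k12 := isK_le KK2 (ltW pe) h; have kp := isK_gt0 KK2 pe.
  have : y / K2 (psi1 e) < t by near: t; apply: nbhs_pinfty_gt; exact: num_real.
  rewrite ltr_pdivrMr//; have := ler_wpM2l t0 k12.
  by have := Z0 _ _ t0 y0; move: e1; lra.
move=> r0 w0 wt y t t0 r00 y0 py wp wt0 ww H.
have w00 : 0 <= w0 by exact: le_trans (ltW wt0) ww.
have c0 := H (K2 wt * lh w0).
have {}c0 : wt + K2 wt * lh w0 * t <= w0.
  apply: c0 => z z0 wz zw; apply: Hkl.
  - exact: isK_gt0 J2.1 wt0.
  - by rewrite -[leRHS](q2P _ z0).1; apply: isK_le J2.1 (ltW wt0) wz.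
  - rewrite -[leLHS](q1P _ z0).1; apply: (isK_le J1.1) => //.
    exact: isK_ge0 I1.1 z0.
have /andP[l1 l2] := lhp w0 w00.
have c1 : wt + t * K2 wt <= rho w0.
  rewrite /rho ler_pdivlMr// mulrDl; apply: le_trans c0; apply: lerD.
    by rewrite ler_piMr// ltW.
  by rewrite mulrAC [_ * t]mulrC mulrA mulrAC.
have [Iz zP] := ZP t t0.
have wtZ : wt <= Z t (rho (psi2 r0)).
  rewrite -[leLHS](zP _ (ltW wt0)).1; apply: (isK_le Iz.1).
    by rewrite addr_ge0 ?(ltW wt0)// mulr_ge0// isK_ge0// ltW.
  by apply: (le_trans c1); apply: isK_le Irho.1 w00 wp.
rewrite -[leLHS](q1P _ y0).1; apply: (isK_le J1.1); first exact: isK_ge0 I1.1 y0.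
exact: le_trans py wtZ.
Unshelve. all: by end_near.
Qed.

End KLBound.

(** * Existence of solutions *)

Section IntegralBounds.
Variable R : realType.
Local Notation mu := (@lebesgue_measure R).
Implicit Types (a b c t s T B C e : R).

Lemma bounded_integrable (G : R -> R) B a b : measurable_fun setT G ->
  (forall s, `|G s| <= B) -> mu.-integrable `[a, b] (EFin \o G).
Proof.
move=> mG GB; have fin : (mu [set` `[a, b]] < +oo)%E.
  by rewrite lebesgue_measure_itv /=; case: ifP => _; rewrite -?EFinB ltry.
apply: (measurable_bounded_integrable _ fin) => //.
  exact: measurable_funTS.
exists B; split; first exact: num_real.
by move=> M cM s _ /=; exact: le_trans (GB s) (ltW cM).
Qed.

Lemma normr_Rintegral_le (G H : R -> R) a b : mu.-integrable `[a, b] (EFin \o G) ->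
  mu.-integrable `[a, b] (EFin \o H) -> (forall s, a <= s <= b -> `|G s| <= H s) ->
  `|\int[mu]_(s in `[a, b]) G s| <= \int[mu]_(s in `[a, b]) H s.
Proof.
move=> iG iH GH; apply: (le_trans (le_normr_Rintegral _ iG)) => //.
by apply: le_Rintegral => //; exact: integrable_norm.
Qed.

(** With this convention the Picard iterates are defined and Lipschitz on the whole line, constant
    at negative times. *)
Lemma Rintegral_neg (G : R -> R) t : t <= 0 -> \int[mu]_(s in `[0, t]) G s = 0.
Proof.
rewrite le_eqVlt => /predU1P[->|t0]; first by rewrite set_itv1 Rintegral_set1.
by rewrite set_itv_ge ?Rintegral_set0// bnd_simp -ltNge.
Qed.

Lemma Rintegral_lip (G : R -> R) B s t : measurable_fun setT G -> (forall s, `|G s| <= B) ->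
  `|\int[mu]_(z in `[0, t]) G z - \int[mu]_(z in `[0, s]) G z| <= B * `|t - s|.
Proof.
move=> mG GB; have B0 : 0 <= B by exact: le_trans (normr_ge0 _) (GB 0).
have iG a b := bounded_integrable a b mG GB.
wlog st : s t / s <= t => [H|].
  have [st|/ltW ts] := leP s t; first exact: H.
  by rewrite distrC [`|t - s|]distrC; exact: H.
have pos (a b : R) : 0 <= a -> a <= b ->
    `|\int[mu]_(z in `[0, b]) G z - \int[mu]_(z in `[0, a]) G z| <= B * (b - a).
  move=> a0 ab; rewrite (Rintegral_increment (iG 0 b) a0 ab (lexx b)).
  apply: (le_trans (normr_Rintegral_le (iG a b) (integrable_cst_itv a b B) _)) => //.
  by rewrite Rintegral_cst//= lebesgue_measure_cc.
rewrite [X in B * X]ger0_norm ?subr_ge0//; have [s0|/ltW s0] := leP 0 s; first exact: pos.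
rewrite (Rintegral_neg G s0); have [t0|/ltW t0] := leP 0 t; last first.
  by rewrite Rintegral_neg// subrr normr0 mulr_ge0// subr_ge0.
have := pos 0 t (lexx 0) t0; rewrite (Rintegral_neg G (lexx 0)) => /le_trans; apply.
by rewrite ler_wpM2l// lerD2l lerN2.
Qed.

Lemma Rintegral_expR c t : 0 < c -> 0 <= t ->
  \int[mu]_(s in `[0, t]) (c * expR (c * s)) = expR (c * t) - 1.
Proof.
move=> c0; rewrite le_eqVlt => /predU1P[<-|t0].
  by rewrite Rintegral_neg// mulr0 expR0 subrr.
have ce : continuous (fun s : R => expR (c * s)).
  move=> s; apply: (@continuous_comp _ _ _ (fun s : R => c * s) expR).
    exact: mulrl_continuous.
  exact: continuous_expR.
have dz (z : R) : is_derive z 1 (fun s : R => expR (c * s)) (c * expR (c * z)).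
  by apply: is_derive_eq; rewrite mulrC; congr (_ * _); exact: mulr1.
rewrite /Rintegral (@continuous_FTC2 _ (fun s => c * expR (c * s)) (fun s => expR (c * s)))//.
- by rewrite mulr0 expR0.
- apply: continuous_subspaceT => s; apply: cvgM; [exact: cvg_cst|exact: ce].
- split.
  + by move=> z _; exact: ex_derive.
  + by apply/cvg_at_right_filter; exact: ce.
  + by apply/cvg_at_left_filter; exact: ce.
- by move=> z _; rewrite derive1E derive_val.
Qed.

Lemma pow2_small e : 0 < e -> exists n : nat, 2^-1 ^+ n <= e.
Proof.
move=> e0; have ev : 0 < e^-1 by rewrite invr_gt0.
exists (Num.bound e^-1); rewrite exprVn -[leRHS]invrK lef_pV2 ?posrE ?exprn_gt0//.
apply: (le_trans (ltW (archi_boundP (ltW ev)))).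
by rewrite -natrX ler_nat ltnW// ltn_expl.
Qed.

Lemma pow_half_small C e : 0 < e -> exists n : nat, C * 2^-1 ^+ n <= e.
Proof.
move=> e0; have [C0|C0] := leP C 0.
  by exists 0%N; rewrite expr0 mulr1 (le_trans C0)// ltW.
have [n Hn] := pow2_small (divr_gt0 e0 C0).
by exists n; rewrite mulrC -ler_pdivlMr.
Qed.

(** The intervals of radius [2 * C * 2^-1 ^+ n] around [u n] are nested. *)
Lemma geometric_limit (u : nat -> R) C : 0 <= C ->
  (forall n, `|u n.+1 - u n| <= C * 2^-1 ^+ n) ->
  exists l, forall n, `|l - u n| <= 2 * C * 2^-1 ^+ n.
Proof.
move=> C0 H; pose a n := u n - 2 * C * 2^-1 ^+ n; pose b n := u n + 2 * C * 2^-1 ^+ n.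
have q0 n : 0 <= 2 * C * 2^-1 ^+ n.
  by rewrite mulr_ge0 ?exprn_ge0 ?invr_ge0// mulr_ge0.
have st n : a n <= a n.+1 /\ b n.+1 <= b n.
  rewrite /a /b exprS; have := H n; rewrite ler_norml => /andP[].
  by move: (2^-1 ^+ n) => q h1 h2; split; lra.
have an (n d : nat) : a n <= a (n + d)%N /\ b (n + d)%N <= b n.
  elim: d => [|d [IH1 IH2]]; first by rewrite addn0.
  rewrite addnS; have [h1 h2] := st (n + d)%N.
  by split; [exact: le_trans IH1 h1|exact: le_trans h2 IH2].
have ab n p : a n <= b p.
  have [np|/ltnW pn] := leqP n p.
    have [h _] := an n (p - n)%N; rewrite subnKC// in h; apply: (le_trans h).
    by rewrite /a /b; have := q0 p; lra.
  have [_ h] := an p (n - p)%N; rewrite subnKC// in h; apply: le_trans h.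
  by rewrite /a /b; have := q0 n; lra.
exists (sup (range a)) => n.
have h1 : a n <= sup (range a).
  by apply: ub_le_sup; [exists (b 0%N) => _ [p _ <-]|exists n].
have h2 : sup (range a) <= b n.
  by apply: ge_sup; [exists (a 0%N), 0%N|move=> _ [p _ <-]].
by rewrite ler_norml; rewrite /a /b in h1 h2; apply/andP; split; lra.
Qed.

End IntegralBounds.

(** * Picard iteration for a bounded, globally Lipschitz right-hand side *)

Section Picard.
Variables (R : realType) (k : nat) (Phi : 'rV[R]_k -> R -> 'rV[R]_k) (B Lam : R).
Local Notation mu := (@lebesgue_measure R).
Hypothesis Phi_bound : forall x s j, `|Phi x s 0 j| <= B.
Hypothesis Phi_lip : forall x y s, enorm (Phi x s - Phi y s) <= Lam * enorm (x - y).
Hypothesis Phi_meas : forall X : R -> 'rV[R]_k,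
  (forall j, measurable_fun setT (fun s => X s 0 j)) ->
  forall j, measurable_fun setT (fun s => Phi (X s) s 0 j).
Hypothesis B0 : 0 <= B.
Hypothesis Lam0 : 0 <= Lam.
Variable x0 : 'rV[R]_k.

Fixpoint picard (n : nat) : R -> 'rV[R]_k :=
  if n is p.+1 then
    fun t => \row_j (x0 0 j + \int[mu]_(s in `[0, t]) Phi (picard p s) s 0 j)
  else fun=> x0.

Lemma lipschitz_measurable (h : R -> R) (C : R) : (forall s t, `|h t - h s| <= C * `|t - s|) ->
  measurable_fun setT h.
Proof.
move=> hL; apply: continuous_measurable_fun.
by apply: (@lipschitz_continuous _ _ C) => s t; exact: hL.
Qed.

Lemma picard_measurable n j : measurable_fun setT (fun s => picard n s 0 j).
Proof.
elim: n j => [|n IH] j /=; first exact: measurable_cst.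
apply: (@lipschitz_measurable _ B) => s t; rewrite !mxE opprD addrACA subrr add0r.
by apply: Rintegral_lip => //; exact: Phi_meas.
Qed.

Lemma picard_lip n s t j : `|picard n t 0 j - picard n s 0 j| <= B * `|t - s|.
Proof.
case: n => [|n] /=; first by rewrite subrr normr0 mulr_ge0.
rewrite !mxE opprD addrACA subrr add0r; apply: Rintegral_lip => //; apply: Phi_meas => i.
exact: picard_measurable.
Qed.

(* With the weight [expR (c * t)], each integration halves the distance of iterates. *)
Let K : R := k%:R * Lam + 1.
Let c : R := 2 * K.
Let C : R := B / c.
Let K0 : 0 < K. Proof. by rewrite ltr_wpDl// mulr_ge0. Qed.
Let c0 : 0 < c. Proof. by rewrite mulr_gt0. Qed.
Let C0 : 0 <= C. Proof. by rewrite divr_ge0// ltW. Qed.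

Lemma Phi_lip_coord (x y : 'rV[R]_k) s j (e : R) : 0 <= e -> (forall i, `|x 0 i - y 0 i| <= e) ->
  `|Phi x s 0 j - Phi y s 0 j| <= K * e.
Proof.
move=> e0 H.
have -> : Phi x s 0 j - Phi y s 0 j = (Phi x s - Phi y s) 0 j by rewrite !mxE.
apply: (le_trans (coord_le_enorm _ _)); apply: (le_trans (Phi_lip _ _ _)).
have : enorm (x - y) <= k%:R * e.
  apply: (le_trans (enorm_le_sum _)).
  apply: (@le_trans _ _ (\sum_(i < k) e)); first by apply: ler_sum => i _; rewrite !mxE.
  by rewrite sumr_const card_ord -[_ *+ k]mulr_natl.
move=> /(ler_wpM2l Lam0)/le_trans; apply.
by rewrite /K mulrDl mul1r mulrA [Lam * _]mulrC lerDl.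
Qed.

Lemma picard_step n t j : 0 <= t ->
  `|picard n.+1 t 0 j - picard n t 0 j| <= C * 2^-1 ^+ n * expR (c * t).
Proof.
have mP p i : measurable_fun setT (fun s => Phi (picard p s) s 0 i).
  by apply: Phi_meas => l; exact: picard_measurable.
have iP p i a b : mu.-integrable `[a, b] (EFin \o (fun s => Phi (picard p s) s 0 i)).
  exact: (bounded_integrable (B := B)).
elim: n t j => [|n IH] t j t0.
  rewrite expr0 mulr1 /= mxE addrAC subrr add0r.
  apply: (le_trans (normr_Rintegral_le (iP 0%N j 0 t) (integrable_cst_itv 0 t B) _)) => //.
  rewrite Rintegral_cst//= lebesgue_measure_cc//= subr0 /C mulrAC ler_pdivlMr// -mulrA.
  by rewrite ler_wpM2l// mulrC (le_trans _ (expR_ge1Dx _))// lerDr.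
have q0 : 0 <= C * 2^-1 ^+ n by rewrite mulr_ge0// exprn_ge0// invr_ge0.
have rowE p : picard p.+1 t 0 j = x0 0 j + \int[mu]_(s in `[0, t]) Phi (picard p s) s 0 j.
  by rewrite [LHS]mxE.
rewrite !rowE opprD addrACA subrr add0r.
rewrite -(@RintegralB _ _ _ mu `[0, t]%classic _ _ (ltac:(exact: measurable_itv))
  (iP n.+1 j 0 t) (iP n j 0 t)).
pose D := C * 2^-1 ^+ n * K / c.
have iE : mu.-integrable `[0, t] (EFin \o (fun s => c * expR (c * s))).
  apply: continuous_compact_integrable; first exact: segment_compact.
  apply: continuous_subspaceT => s; apply: cvgM; first exact: cvg_cst.
  apply: (@continuous_comp _ _ _ (fun s : R => c * s) expR); first exact: mulrl_continuous.
  exact: continuous_expR.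
apply: (@le_trans _ _ (\int[mu]_(s in `[0, t]) (D * (c * expR (c * s))))).
  apply: normr_Rintegral_le.
  - have := @integrableB _ _ _ mu `[0, t]%classic (ltac:(exact: measurable_itv)) _ _ (iP n.+1 j 0 t) (iP n j 0 t).
    exact.
  - have := @integrableZl _ _ _ mu `[0, t]%classic (ltac:(exact: measurable_itv)) D _ iE.
    exact.
  - move=> s /andP[s0 st].
    have es : 0 <= C * 2^-1 ^+ n * expR (c * s) by rewrite mulr_ge0// expR_ge0.
    apply: (le_trans (Phi_lip_coord s j es (fun i => IH s i s0))).
    by rewrite [leRHS]mulrA /D divfK ?gt_eqF// [leLHS]mulrC mulrAC.
rewrite RintegralZl// Rintegral_expR//.
have D0 : 0 <= D by rewrite divr_ge0 ?(ltW c0)// mulr_ge0// ltW.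
apply: (@le_trans _ _ (D * expR (c * t))); first by rewrite ler_wpM2l// gerBl.
rewrite ler_wpM2r ?expR_ge0// /D /c exprS invfM; have := gt_eqF K0.
by move: (2^-1 ^+ n) => q Kn; rewrite le_eqVlt; apply/orP; left; apply/eqP; field; rewrite Kn.
Qed.

Lemma picard_neg n t j : t <= 0 -> picard n t 0 j = x0 0 j.
Proof. by case: n => //= n t0; rewrite mxE Rintegral_neg// addr0. Qed.

Lemma picard_solution : exists x : R -> 'rV[R]_k,
  [/\ x 0 = x0, (forall j s t, `|x t 0 j - x s 0 j| <= B * `|t - s|) &
      forall t j, 0 <= t -> x t 0 j = x0 0 j + \int[mu]_(s in `[0, t]) Phi (x s) s 0 j].
Proof.
pose E t : R := expR (c * Num.max t 0).
have /choice[X XP] : forall p : R * 'I_k, exists l : R, forall n,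
    `|l - picard n p.1 0 p.2| <= 2 * (C * E p.1) * 2^-1 ^+ n.
  move=> [t j] /=; apply: geometric_limit; first by rewrite mulr_ge0// expR_ge0.
  move=> n; have [t0|/ltW t0] := leP 0 t; last first.
    rewrite !picard_neg// subrr normr0 mulr_ge0 ?exprn_ge0 ?invr_ge0//.
    by rewrite mulr_ge0// expR_ge0.
  by rewrite mulrAC; have := picard_step n j t0; rewrite /E max_l.
pose x t : 'rV[R]_k := \row_j X (t, j).
have xP t j n : `|x t 0 j - picard n t 0 j| <= 2 * (C * E t) * 2^-1 ^+ n.
  by rewrite mxE; exact: XP (t, j) n.
have xlip j s t : `|x t 0 j - x s 0 j| <= B * `|t - s|.
  apply/ler_addgt0Pr => e e0.
  have [n Hn] := pow_half_small (2 * (C * E t) + 2 * (C * E s)) e0.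
  have h1 := xP t j n; have h2 := xP s j n; have h3 := picard_lip n s t j.
  rewrite (_ : _ - _ = (x t 0 j - picard n t 0 j) + (picard n t 0 j - picard n s 0 j)
    - (x s 0 j - picard n s 0 j)); last by ring.
  apply: (le_trans (ler_normB _ _)).
  have h4 := ler_normD (x t 0 j - picard n t 0 j) (picard n t 0 j - picard n s 0 j).
  by rewrite mulrDl in Hn; lra.
have xm j : measurable_fun setT (fun s => x s 0 j).
  by apply: (@lipschitz_measurable _ B) => s t; exact: xlip.
exists x; split => //.
  apply/rowP => j; apply/eqP; rewrite -subr_eq0 -normr_le0; apply/ler_addgt0Pr => e e0.
  have [n Hn] := pow_half_small (2 * (C * E 0)) e0.
  rewrite add0r; apply: le_trans Hn; rewrite -(picard_neg n j (lexx 0)); exact: xP.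
move=> t j t0; apply/eqP; rewrite -subr_eq0 -normr_le0; apply/ler_addgt0Pr => e e0.
rewrite add0r.
have [n Hn] := pow_half_small (2 * (C * E t) + K * (2 * (C * E t)) * t) e0.
have iX : mu.-integrable `[0, t] (EFin \o (fun s => Phi (x s) s 0 j)).
  by apply: (bounded_integrable (B := B)) => //; exact: Phi_meas.
have iP : mu.-integrable `[0, t] (EFin \o (fun s => Phi (picard n s) s 0 j)).
  by apply: (bounded_integrable (B := B)) => //; apply: Phi_meas => l; exact: picard_measurable.
have h1 := xP t j n.+1; rewrite /= mxE in h1.
pose q : R := 2^-1 ^+ n; have q0 : 0 <= q by rewrite exprn_ge0// invr_ge0.
have E0 s : 0 <= E s by exact: expR_ge0.
(* The weight increases with time, so the error bound at [t] holds on all of [[0, t]]. *)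
have h2 : `|\int[mu]_(s in `[0, t]) (Phi (picard n s) s 0 j - Phi (x s) s 0 j)| <=
    K * (2 * (C * E t) * q) * t.
  have -> : K * (2 * (C * E t) * q) * t = \int[mu]_(s in `[0, t]) (K * (2 * (C * E t) * q)).
    by rewrite Rintegral_cst//= lebesgue_measure_cc//= subr0.
  apply: normr_Rintegral_le; [|exact: integrable_cst_itv|].
    have := @integrableB _ _ _ mu `[0, t]%classic (ltac:(exact: measurable_itv)) _ _ iP iX.
    exact.
  move=> s /andP[s0 st]; apply: Phi_lip_coord.
    by rewrite mulr_ge0// mulr_ge0// mulr_ge0.
  move=> i; rewrite distrC; apply: (le_trans (xP s i n)).
  rewrite ler_wpM2r// ler_wpM2l// ler_wpM2l// /E !max_l// ler_expR.
  by rewrite ler_wpM2l// ltW.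
rewrite RintegralB// in h2.
move: h1 h2; set I1 := (X in x0 0 j + X); set I2 := \int[mu]_(s in _) Phi (x s) s 0 j => h1 h2.
have h3 : `|x t 0 j - (x0 0 j + I2)| <= `|x t 0 j - (x0 0 j + I1)| + `|I1 - I2|.
  by apply: le_trans (ler_normD _ _); rewrite le_eqVlt; apply/orP; left; apply/eqP; congr (`|_|); ring.
apply: (le_trans h3); apply: le_trans Hn; rewrite mulrDl; apply: lerD.
  have hq : 2^-1 * q <= q by rewrite ler_piMl// invf_le1// ler1n.
  apply: (le_trans h1); rewrite ?exprS -/q; apply: ler_wpM2l; last by [].
  by rewrite mulr_ge0//; exact: mulr_ge0 C0 (E0 t).
by apply: (le_trans h2); rewrite -/q le_eqVlt; apply/orP; left; apply/eqP; ring.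
Qed.

End Picard.

(** * Inputs up to almost everywhere equality, and continuity on intervals *)

Section InputTruncation.
Variable R : realType.
Local Notation mu := (@lebesgue_measure R).

(** An admissible input obeys its bound only almost everywhere and is measurable only on nonnegative
    times. Setting it to [0] elsewhere repairs both, and integrals along solutions do not see the
    change. *)
Lemma input_truncation m (u : R -> 'rV[R]_m) : admissible u ->
  0 <= fine (Linf_norm u) /\ exists ut : R -> 'rV[R]_m,
  [/\ (forall s, enorm (ut s) <= fine (Linf_norm u)),
      (forall j, measurable_fun setT (fun s => ut s 0 j)) &
      {ae mu, forall s, 0 <= s -> u s = ut s}].
Proof.
move=> [um ufin].
have muT : (0 < mu [set: R])%E.
  apply: (@lt_le_trans _ _ (mu `[(0 : R), 1]%classic)).
    by rewrite lebesgue_measure_cc// subr0 lte_fin.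
  by apply: le_measure => //; rewrite inE.
have N0 : (0 <= Linf_norm u)%E.
  apply: ess_sup_gee => //; apply: nearW => t; case: ifP => // _.
  by rewrite lee_fin enorm_ge0.
have Nfin : (Linf_norm u) \is a fin_num by rewrite ge0_fin_numE.
have r0 : 0 <= fine (Linf_norm u) by exact: fine_ge0.
split=> //; set r := fine _ in r0 *.
pose D : set R := [set t | 0 <= t].
have mD : measurable D.
  by rewrite (_ : D = `[0, +oo[%classic)//; apply/seteqP; split=> t /=; rewrite in_itv /= andbT.
pose S : set R := D `&` [set s | enorm (u s) <= r].
have mS : measurable S.
  have h := measurable_fun_continuous_comp mD um (@continuous_enorm R m).
  rewrite (_ : S = D `&` (fun t => enorm (u t)) @^-1` `]-oo, r]%classic); first exact: h.
  by apply/seteqP; split=> t [h1 h2]; split=> //; move: h2; rewrite /= in_itv.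
pose ut s := if s \in S then u s else 0.
exists ut; split.
- move=> s; rewrite /ut; case: ifPn => [|_]; last by rewrite enorm0.
  by rewrite inE => -[].
- move=> j; rewrite (_ : (fun s => ut s 0 j) = (fun s => u s 0 j) \_ S).
    apply/(measurable_restrict _ mS measurableT).
    by rewrite setTI; apply: measurable_funS (um j) => //; exact: subIsetl.
  by apply/funext => s; rewrite patchE /ut; case: ifP => // _; rewrite mxE.
- have F := ae_filter_ringOfSetsType mu.
  apply: filterS (ess_sup_ge mu (fun t => if 0 <= t then ((enorm (u t))%:E)%E else 0%E)) => s.
  move=> H s0; rewrite /ut mem_set//; split => //=.
  by move: H; rewrite s0 -/(Linf_norm u) -(fineK Nfin) lee_fin.
Qed.

Lemma ae_transfer (g h : R -> R) (T : R) :
  measurable_fun `[0, T] g -> measurable_fun `[0, T] h ->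
  {ae mu, forall s, 0 <= s -> g s = h s} ->
  (mu.-integrable `[0, T] (EFin \o h) -> mu.-integrable `[0, T] (EFin \o g)) /\
  forall t, t <= T -> \int[mu]_(s in `[0, t]) g s = \int[mu]_(s in `[0, t]) h s.
Proof.
move=> mg mh gh; have F := ae_filter_ringOfSetsType mu; split.
  move=> /integrableP[_ hfin]; apply/integrableP; split; first exact/measurable_EFinP.
  apply: le_lt_trans hfin; rewrite le_eqVlt; apply/orP; left; apply/eqP.
  apply: ae_eq_integral => //.
  - by apply: measurableT_comp => //; exact/measurable_EFinP.
  - by apply: measurableT_comp => //; exact/measurable_EFinP.
  - by apply: filterS gh => s H /=; rewrite in_itv /= => /andP[s0 _]; rewrite H.
move=> t tT; rewrite /Rintegral; congr fine.
have sub : `[0, t] `<=` `[0, T].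
  by move=> s /=; rewrite !in_itv /= => /andP[-> /= /le_trans]; apply.
apply: ae_eq_integral => //.
- by apply/measurable_EFinP; apply: measurable_funS mg.
- by apply/measurable_EFinP; apply: measurable_funS mh.
- by apply: filterS gh => s H /=; rewrite in_itv /= => /andP[s0 _]; rewrite H.
Qed.

Lemma within_continuous_on_cc (f : R -> R) (a b : R) :
  {within `[a, b], continuous f} -> continuous_on_cc f a b.
Proof.
move=> /subspace_continuousP fc t e tab e0.
have := fc t; rewrite /= in_itv /= => /(_ tab)/cvgrPdist_lt/(_ e e0).
rewrite near_withinE => /nbhs_ballP[d /= d0 Hd]; exists d => // s sab sd.
rewrite distrC; apply: (Hd s); last by rewrite /= in_itv.
by rewrite /ball /= distrC.
Qed.

Lemma Rintegral_within_continuous (G : R -> R) (T : R) : 0 <= T ->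
  mu.-integrable `[0, T] (EFin \o G) ->
  {within `[0, T], continuous (fun t => \int[mu]_(s in `[0, t]) G s)}.
Proof. by move=> T0 iG; apply: parameterized_integral_continuous. Qed.

Lemma coord_continuous_on_cc k (x : R -> 'rV[R]_k) (a b : R) :
  (forall j, continuous_on_cc (fun s => x s 0 j) a b) ->
  forall t e, a <= t <= b -> 0 < e ->
  exists2 d, 0 < d & forall s, a <= s <= b -> `|s - t| < d -> enorm (x s - x t) < e.
Proof.
move=> xc t e tab e0; have ek : 0 < e / k.+1%:R by rewrite divr_gt0.
have /choice[d dP] : forall j, exists d : R, 0 < d /\ forall s, a <= s <= b -> `|s - t| < d ->
    `|x s 0 j - x t 0 j| < e / k.+1%:R.
  by move=> j; have [d d0 Hd] := xc j t _ tab ek; exists d.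
have [d' d'0 Hd'] := finite_pos_min (fun j => (dP j).1).
exists d' => // s sab sd; apply: (le_lt_trans (enorm_le_sum _)).
apply: (@le_lt_trans _ _ (\sum_(j < k) e / k.+1%:R)).
  apply: ler_sum => j _; rewrite !mxE ltW//; apply: (dP j).2 => //.
  exact: lt_le_trans sd (Hd' j).
rewrite sumr_const card_ord -[_ *+ k]mulr_natl mulrCA gtr_pMr//.
by rewrite ltr_pdivrMr// mul1r ltr_nat.
Qed.

End InputTruncation.

(** * Uniform bounds and measurability of the right-hand side *)

Section RightHandSide.
Variables (R : realType) (k m : nat) (F : 'rV[R]_k -> 'rV[R]_m -> 'rV[R]_k).
Hypothesis Fc : continuous (fun p : 'rV[R]_k * 'rV[R]_m => F p.1 p.2).
Hypothesis Floc : loclip_unif F.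

Lemma rhs_bounded (rho r : R) : exists2 B, 0 <= B & forall x u,
  enorm x <= rho -> enorm u <= r -> enorm (F x u) <= B.
Proof.
pose A := [set x : 'rV[R]_k | enorm x <= rho] `*` [set u : 'rV[R]_m | enorm u <= r].
have cA : compact A by apply: compact_setX; exact: enorm_ball_compact.
have c2 : continuous (fun p : 'rV[R]_k * 'rV[R]_m => enorm (F p.1 p.2)).
  move=> p; apply: (@continuous_comp _ _ _ (fun p : 'rV[R]_k * 'rV[R]_m => F p.1 p.2) (@enorm R k)).
    exact: Fc.
  exact: continuous_enorm.
have := continuous_compact (continuous_subspaceT c2) cA.
move=> /compact_bounded[M [_ HM]].
exists (`|M| + 1); first by rewrite addr_ge0.
move=> x u xr ur; apply: (le_trans (ler_norm _)).
have ML : M < `|M| + 1 by rewrite (le_lt_trans (ler_norm M))// ltrDl.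
by apply: (HM _ ML); exists (x, u).
Qed.

(** Compactness makes the local radius and constant uniform; pairs at distance at least [d] are
    handled by boundedness. *)
Lemma rhs_lipschitz (rho r : R) : exists2 Lam, 0 <= Lam & forall x y u,
  enorm x <= rho -> enorm y <= rho -> enorm u <= r ->
  enorm (F x u - F y u) <= Lam * enorm (x - y).
Proof.
pose A := [set x : 'rV[R]_k | enorm x <= rho].
(* One parameter serves as radius and as inverse Lipschitz constant; both relax as [d] decreases,
   which suits a covering argument with [d] tending to [0]. *)
pose P (d : R) (x : 'rV[R]_k) := forall y u, enorm (y - x) < d -> enorm u <= r ->
  enorm (F x u - F y u) <= d^-1 * enorm (x - y).
have cA : near_covering A by rewrite -compact_near_coveringP; exact: enorm_ball_compact.
have [d d0 Pd] : exists2 d, 0 < d & A `<=` P d.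
  have near0 : \forall d \near (0 : R)^'+, A `<=` P d.
    apply: (cA _ (0 : R)^'+ P) => c _.
    have [e [L [e0 HL]]] := Floc r c.
    exists ([set x | enorm (x - c) < e / 2], [set d | 0 < d < Num.min (e / 2) (`|L| + 1)^-1]).
      split => /=; first by apply/nbhs_enormP; exists (e / 2) => //; rewrite divr_gt0.
      near=> d; apply/andP; split; first by near: d; exact: nbhs_right_gt.
      by near: d; apply: nbhs_right_lt; rewrite lt_min divr_gt0//= invr_gt0 ltr_wpDl.
    move=> [x d] [/= xc /andP[d0]]; rewrite lt_min => /andP[de dL] y u yx ur.
    apply: (le_trans (HL x y u _ _ ur)); first by lra.
      by apply: (le_lt_trans (enorm_dist _ x _)); lra.
    rewrite ler_wpM2r ?enorm_ge0//; apply: (le_trans (ler_norm L)).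
    apply: (@le_trans _ _ (`|L| + 1)); first by rewrite lerDl.
    by rewrite -[leLHS]invrK lef_pV2 ?posrE ?invr_gt0 ?ltr_wpDl// ltW.
  near (0 : R)^'+ => d; exists d; first by near: d; exact: nbhs_right_gt.
  by near: d.
have [B B0 HB] := rhs_bounded rho r.
exists (Num.max d^-1 (2 * B / d)); first by rewrite le_max invr_ge0 (ltW d0).
move=> x y u xr yr ur; have [yx|yx] := ltP (enorm (y - x)) d.
  apply: (le_trans (Pd x xr y u yx ur)).
  by rewrite ler_wpM2r ?enorm_ge0// le_max lexx.
apply: (@le_trans _ _ (2 * B / d * enorm (x - y))); last first.
  by rewrite ler_wpM2r ?enorm_ge0// le_max lexx orbT.
apply: (le_trans (enorm_triangle _ _)); rewrite enormN.
have h1 := HB x u xr ur; have h2 := HB y u yr ur.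
have : 2 * B <= 2 * B / d * enorm (x - y).
  by rewrite -mulrA ler_peMr ?mulr_ge0// mulrC ler_pdivlMr// mul1r enormBC.
by lra.
Unshelve. all: by end_near.
Qed.

Local Notation mu := (@lebesgue_measure R).

Lemma continuous_subrow p q (h : 'I_p -> 'I_q) :
  continuous (fun z : 'rV[R]_q => \row_j z 0 (h j) : 'rV[R]_p).
Proof.
move=> z; apply/enorm_continuousP => e e0; exists (e / p.+1%:R); first by rewrite divr_gt0.
move=> y yz; apply: (le_lt_trans (enorm_le_sum _)).
apply: (@le_lt_trans _ _ (\sum_(j < p) enorm (y - z))).
  apply: ler_sum => j _; rewrite !mxE.
  by have := coord_le_enorm (y - z) (h j); rewrite !mxE.
rewrite sumr_const card_ord -[_ *+ p]mulr_natl.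
apply: (@le_lt_trans _ _ (p.+1%:R * enorm (y - z))).
  by rewrite ler_wpM2r ?enorm_ge0// ler_nat.
by rewrite mulrC -ltr_pdivlMr.
Qed.

(** State and input are packed into one row vector, so that composition with a continuous function
    of a single vector applies. *)
Lemma rhs_measurable (D : set R) (X : R -> 'rV[R]_k) (U : R -> 'rV[R]_m) : measurable D ->
  (forall j, measurable_fun D (fun s => X s 0 j)) ->
  (forall j, measurable_fun D (fun s => U s 0 j)) ->
  forall j, measurable_fun D (fun s => F (X s) (U s) 0 j).
Proof.
move=> mD mX mU j.
pose Y s := row_mx (X s) (U s).
pose fl (z : 'rV[R]_(k + m)) : 'rV[R]_k := \row_i z 0 (lshift m i).
pose fr (z : 'rV[R]_(k + m)) : 'rV[R]_m := \row_i z 0 (rshift k i).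
have e : (fun s => F (X s) (U s) 0 j) = (fun s => F (fl (Y s)) (fr (Y s)) 0 j).
  apply/funext => s; congr ((F _ _) 0 j); apply/rowP => i; rewrite mxE.
    by rewrite /Y row_mxEl.
  by rewrite /Y row_mxEr.
rewrite e; apply: (@measurable_fun_continuous_comp R _ _ _ Y D (fun z => F (fl z) (fr z) 0 j)) => //.
  move=> i; case: (split_ordP i) => l ->.
    by rewrite (_ : (fun t => _) = (fun t => X t 0 l))//; apply/funext => t; rewrite row_mxEl.
  by rewrite (_ : (fun t => _) = (fun t => U t 0 l))//; apply/funext => t; rewrite row_mxEr.
move=> z.
have P : (fun z => (fl z, fr z)) @ z --> (fl z, fr z).
  apply: (@cvg_pair _ _ _ (nbhs z) (nbhs (fl z)) (nbhs (fr z))).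
    exact: continuous_subrow.
  exact: continuous_subrow.
have Q := cvg_comp _ _ P (@Fc (fl z, fr z)).
exact: (cvg_comp _ _ Q (@coord_continuous _ _ _ 0 j (F (fl z) (fr z)))).
Qed.

End RightHandSide.

(** * Input-to-state stability *)

Section LyapunovImpliesISS.
Variables (R : realType) (k m : nat) (F : 'rV[R]_k -> 'rV[R]_m -> 'rV[R]_k) (V : 'rV[R]_k -> R).
Hypothesis Fc : continuous (fun p : 'rV[R]_k * 'rV[R]_m => F p.1 p.2).
Hypothesis Floc : loclip_unif F.
Variables (gam alpha psi1 psi2 q1 : R -> R).
Hypothesis Vc : continuous V.
Hypothesis Vl : loclip_nz V.
Hypothesis I1 : isKinf psi1.
Hypothesis I2 : isKinf psi2.
Hypothesis Vpsi : forall x, psi1 (enorm x) <= V x /\ V x <= psi2 (enorm x).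
Hypothesis J1 : isKinf q1.
Hypothesis q1P : forall r, 0 <= r -> q1 (psi1 r) = r /\ psi1 (q1 r) = r.
Hypothesis Kgam : isK gam.
Hypothesis Pal : isPD alpha.
Hypothesis Vdec : forall x u, differentiable V x -> gam (enorm u) <= V x ->
  'd V x (F x u) <= - alpha (enorm x).
Local Notation mu := (@lebesgue_measure R).

Let Vp : proper_pd V. Proof. by exists psi1, psi2. Qed.

Lemma enorm_le_level y l : V y <= l -> enorm y <= q1 l.
Proof.
move=> yl; rewrite -[leLHS](q1P (enorm_ge0 y)).1; apply: (isK_le J1.1).
  exact: isK_ge0 I1.1 (enorm_ge0 y).
exact: le_trans (Vpsi y).1 yl.
Qed.

(** * Estimates along a trajectory *)

Section Trajectory.
Variables (x G : R -> 'rV[R]_k) (ut : R -> 'rV[R]_m) (r T : R).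
Hypothesis r0 : 0 <= r.
Hypothesis utr : forall s, enorm (ut s) <= r.
Hypothesis T0 : 0 <= T.
Hypothesis iG : forall j, mu.-integrable `[0, T] (EFin \o (fun s => G s 0 j)).
Hypothesis xE : forall t j, 0 <= t <= T ->
  x t 0 j = x 0 0 j + \int[mu]_(s in `[0, t]) G s 0 j.

Lemma trajectory_within j : {within `[0, T], continuous (fun s => x s 0 j)}.
Proof.
have c1 := Rintegral_within_continuous T0 (iG j).
have c2 : {within `[0, T], continuous (fun t => x 0 0 j + \int[mu]_(s in `[0, t]) G s 0 j)}.
  by move=> t; apply: cvgD; [exact: cvg_cst|exact: c1].
apply: subspace_eq_continuous c2 => t; rewrite inE /= in_itv /= => t0T.
exact: esym (xE j t0T).
Qed.

Lemma trajectory_continuous t e : 0 <= t <= T -> 0 < e ->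
  exists2 d, 0 < d & forall s, 0 <= s <= T -> `|s - t| < d -> enorm (x s - x t) < e.
Proof.
apply: coord_continuous_on_cc => j; apply: within_continuous_on_cc.
exact: trajectory_within.
Qed.

Lemma lyapunov_continuous_on_cc : continuous_on_cc (fun s => V (x s)) 0 T.
Proof.
move=> t e t0T e0; have [d d0 Hd] := enorm_cvgP (@Vc (x t)) e0.
have [d' d'0 Hd'] := trajectory_continuous t0T d0.
by exists d' => // s s0T sd; rewrite distrC; apply: Hd; exact: Hd'.
Qed.

Lemma trajectory_dini t dl : 0 <= t -> t < T -> 0 < dl ->
  (forall s, t <= s -> s < t + dl -> s <= T -> G s = F (x s) (ut s)) ->
  gam r < V (x t) ->
  exists2 d, 0 < d & forall h, 0 <= h -> h < d ->
    V (x (t + h)) + alpha (enorm (x t)) / 2 * h <= V (x t).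
Proof.
move=> t0 tT dl0 GF Vt.
have [|||d d0 Hd] := @lyapunov_dini R k m F V gam alpha Floc Vc Vp Vl Kgam Pal Vdec
    x G ut r t T dl r0 tT dl0 utr _ _ _ GF Vt.
- move=> j; apply: integrableS (iG j) => //.
  by move=> s /=; rewrite !in_itv /= => /andP[/(le_trans t0) -> ->].
- move=> s /andP[ts sT] j.
  have h1 : 0 <= s <= T by rewrite (le_trans t0 ts).
  have h2 : 0 <= t <= T by rewrite t0 ltW.
  rewrite (xE j h1) (xE j h2) opprD addrACA subrr add0r.
  exact: (Rintegral_increment (iG j) t0 ts sT).
- move=> e e0; have h2 : 0 <= t <= T by rewrite t0 ltW.
  have [d d0 Hd] := trajectory_continuous h2 e0; exists d => // s ts sd sT.
  by apply: Hd; [rewrite (le_trans t0 ts)|rewrite ger0_norm ?subr_ge0//; lra].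
by exists d => // h h0 hd; have [] := Hd h h0 hd.
Qed.

(** Either [V] is at most [gam r] at time [t], which gives the gain term, or it has been above since
    time [0], because it cannot rise to a value above [gam r]; the decay was then never
    interrupted. *)
Lemma trajectory_estimate (beta : R -> R -> R) : isKL beta ->
  (forall r0 w0 wt y t : R,
    0 <= t -> 0 <= r0 -> 0 <= y -> psi1 y <= wt -> w0 <= psi2 r0 -> 0 < wt -> wt <= w0 ->
    (forall c, (forall z, 0 <= z -> wt <= psi2 z -> psi1 z <= w0 -> c <= alpha z / 2) ->
       wt + c * t <= w0) ->
    y <= beta r0 t) ->
  (forall s, 0 <= s <= T -> G s = F (x s) (ut s)) ->
  forall t, 0 <= t <= T -> enorm (x t) <= beta (enorm (x 0)) t + q1 (gam r).
Proof.
move=> Kb Hb GF t /andP[t0 tT].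
have b0 : 0 <= beta (enorm (x 0)) t.
  by have [/(_ t t0) Kt _] := Kb; exact: isK_ge0 Kt (enorm_ge0 _).
have g0 : 0 <= gam r by exact: isK_ge0 Kgam r0.
have q0 : 0 <= q1 (gam r) by exact: isK_ge0 J1.1 g0.
have [Vt|Vt] := leP (V (x t)) (gam r).
  by apply: (le_trans (enorm_le_level Vt)); rewrite lerDr.
apply: (@le_trans _ _ (beta (enorm (x 0)) t)); last by rewrite lerDl.
pose w s := V (x s); pose A s := alpha (enorm (x s)) / 2.
have A0 s : 0 <= A s by rewrite divr_ge0//; case: Pal => _ /(_ _ (enorm_ge0 (x s)))[].
have dini s : 0 <= s -> s < T -> gam r < w s ->
    exists2 d, 0 < d & forall h, 0 <= h -> h < d -> w (s + h) + A s * h <= w s.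
  move=> s0 sT ws; apply: (@trajectory_dini s 1) => // z sz _ zT.
  by apply: GF; rewrite (le_trans s0 sz).
have wc := lyapunov_continuous_on_cc.
have mono s s' := @dini_nonincreasing R w A (gam r) T wc A0 dini s s'.
have w0t : w t <= w 0 by apply: mono.
apply: (Hb (enorm (x 0)) (w 0) (w t)) => //; try exact: enorm_ge0.
- exact: (Vpsi _).1.
- exact: (Vpsi _).2.
- exact: le_lt_trans Vt.
move=> c Hc; apply: (@dini_decay R w A (gam r) T wc A0 dini) => // s /andP[s0 st].
have wts : w t <= w s by apply: mono.
apply: Hc; first exact: enorm_ge0.
  exact: le_trans wts (Vpsi _).2.
apply: (le_trans (Vpsi _).1); apply: mono => //; first exact: le_trans st tT.
exact: lt_le_trans wts.
Qed.

End Trajectory.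

Lemma solution_exists (x0 : 'rV[R]_k) (ut : R -> 'rV[R]_m) (r : R) : 0 <= r ->
  (forall s, enorm (ut s) <= r) -> (forall j, measurable_fun setT (fun s => ut s 0 j)) ->
  exists x : R -> 'rV[R]_k, [/\ x 0 = x0,
    (forall j, measurable_fun setT (fun s => x s 0 j)),
    (forall j T, mu.-integrable `[0, T] (EFin \o (fun s => F (x s) (ut s) 0 j))) &
    forall t j, 0 <= t ->
      x t 0 j = x0 0 j + \int[mu]_(s in `[0, t]) F (x s) (ut s) 0 j].
Proof.
move=> r0 utr mut.
pose l : R := Num.max (V x0) (gam r) + 1.
have [l1 l2] : V x0 < l /\ gam r < l.
  have : V x0 <= Num.max (V x0) (gam r) by rewrite le_max lexx.
  have : gam r <= Num.max (V x0) (gam r) by rewrite le_max lexx orbT.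
  by rewrite /l; split; lra.
have l0 : 0 <= l by rewrite (le_trans _ (ltW l2))// isK_ge0.
(* The margin [1] keeps a trajectory that reaches the level [l] inside the ball for a short time.
   Since [l] exceeds [gam r], the Dini inequality of the true system then applies. *)
pose rho : R := q1 l + 1.
have ql : 0 <= q1 l by exact: isK_ge0 J1.1 l0.
have rho0 : 0 <= rho by rewrite /rho addr_ge0.
have [B B0 HB] := rhs_bounded Fc rho r.
have [Lam Lam0 HL] := rhs_lipschitz Fc Floc rho r.
(* Solve the system cut off outside the ball of radius [rho]; the level set [V <= l] is a
   barrier inside this ball, so the cut-off is never active. *)
pose Phi (x : 'rV[R]_k) (s : R) := F (retract rho x) (ut s).
have Pb x s j : `|Phi x s 0 j| <= B.
  by apply: (le_trans (coord_le_enorm _ _)); apply: HB => //; exact: retract_le.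
have Pl x y s : enorm (Phi x s - Phi y s) <= Lam * 2 * enorm (x - y).
  apply: (@le_trans _ _ (Lam * enorm (retract rho x - retract rho y))).
    by apply: HL => //; exact: retract_le.
  by rewrite -mulrA ler_wpM2l// retract_lip.
have rc : continuous (@retract R k rho).
  move=> y; apply/enorm_continuousP => e e0; exists (e / 2); first by rewrite divr_gt0.
  by move=> z zy; apply: (le_lt_trans (retract_lip _ _ rho0)); lra.
have Pm (X : R -> 'rV[R]_k) : (forall j, measurable_fun setT (fun s => X s 0 j)) ->
    forall j, measurable_fun setT (fun s => Phi (X s) s 0 j).
  move=> mX; apply: rhs_measurable => // j.
  apply: (@measurable_fun_continuous_comp R _ _ _ X setT (fun y => retract rho y 0 j)) => // y.
  exact: (cvg_comp _ _ (@rc y) (@coord_continuous _ _ _ 0 j (retract rho y))).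
have [x [xx0 xlip xE]] := picard_solution Pb Pl Pm B0 (mulr_ge0 Lam0 (ler0n _ 2)) x0.
have mx j : measurable_fun setT (fun s => x s 0 j).
  by apply: (@lipschitz_measurable _ _ B) => s t; exact: xlip.
pose G s := Phi (x s) s.
have iG j T : mu.-integrable `[0, T] (EFin \o (fun s => G s 0 j)).
  have mG : measurable_fun setT (fun s => G s 0 j) by exact: (Pm x mx j).
  by apply: (bounded_integrable (B := B)) => // s; exact: Pb.
have xE' T t j : 0 <= t <= T -> x t 0 j = x 0 0 j + \int[mu]_(s in `[0, t]) G s 0 j.
  by move=> /andP[t0 _]; rewrite xx0; exact: xE.
have Vle t : 0 <= t -> V (x t) <= l.
  move=> t0; apply: (@level_barrier R (fun s => V (x s)) 0 t l t0).
  - by rewrite xx0 ltW.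
  - exact: (lyapunov_continuous_on_cc t0 (fun j => iG j t) (xE' t)).
  move=> s /andP[s0 st] Vs.
  have xs : enorm (x s) <= q1 l by apply: enorm_le_level; rewrite Vs.
  have h2 : 0 <= s <= t by rewrite s0 ltW.
  have [dl dl0 Hdl] := trajectory_continuous t0 (fun j => iG j t) (xE' t) h2 ltr01.
  have [||d d0 Hd] := @trajectory_dini x G ut r t r0 utr t0 (fun j => iG j t) (xE' t) s dl s0 st dl0.
  - move=> z sz zd zt; rewrite /G /Phi retract_id//.
    have : enorm (x z - x s) < 1.
      by apply: Hdl; [rewrite (le_trans s0 sz)|rewrite ger0_norm ?subr_ge0//; lra].
    have := enorm_triangle (x z - x s) (x s); rewrite subrK /rho; lra.
  - by rewrite Vs.
  exists d => // h h0 hd; have := Hd h h0 hd; rewrite Vs.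
  have a0 : 0 <= alpha (enorm (x s)) / 2 * h.
    by rewrite mulr_ge0// divr_ge0//; case: Pal => _ /(_ _ (enorm_ge0 (x s)))[].
  by lra.
have GF s : 0 <= s -> G s = F (x s) (ut s).
  move=> s0; rewrite /G /Phi retract_id//.
  by apply: (le_trans (enorm_le_level (Vle s s0))); rewrite /rho lerDl.
exists x; split => //.
  move=> j T; apply: eq_integrable (iG j T) => // s.
  by rewrite inE /= in_itv /= => /andP[s0 _]; rewrite GF.
move=> t j t0; rewrite xE//; congr (_ + _); apply: eq_Rintegral => s.
by rewrite inE /= in_itv /= => /andP[s0 _]; rewrite -/(G s) GF.
Qed.

(** The input is exchanged for its truncation both in the existence part and in the estimate: the
    integrands agree almost everywhere, so both inputs have the same solutions. *)
Lemma Lyapunov_ISS : ISS F.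
Proof.
have [beta Kb Hb] := KL_of_decay Pal I1 I2.
exists beta, (q1 \o gam); split => //; first exact: isK_comp J1.1 Kgam.
move=> x0 u uadm; have [r0 [ut [utr mut uut]]] := input_truncation uadm.
set r := fine _ in r0 utr *; have [um _] := uadm.
have Fae (x : R -> 'rV[R]_k) j : {ae mu, forall s, 0 <= s -> F (x s) (u s) 0 j = F (x s) (ut s) 0 j}.
  have fl := ae_filter_ringOfSetsType mu.
  by apply: filterS uut => s H s0; rewrite H.
have umT (T : R) j : measurable_fun `[0, T] (fun s => u s 0 j).
  have mD : measurable [set t : R | 0 <= t].
    rewrite (_ : [set t | _] = `[0, +oo[%classic)//.
    by apply/seteqP; split=> t /=; rewrite in_itv /= andbT.
  by apply: measurable_funS (um j) => // s /=; rewrite in_itv /= => /andP[].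
have utmT (T : R) j : measurable_fun `[0, T] (fun s => ut s 0 j) by exact: measurable_funTS.
split.
  have [x [xx0 mx ix xE]] := solution_exists x0 r0 utr mut; exists x; split => // T T0 j.
  have mxT i : measurable_fun `[0, T] (fun s => x s 0 i) by exact: measurable_funTS.
  have [A1 A2] := ae_transfer
    (rhs_measurable Fc (measurable_itv _) mxT (umT T) j)
    (rhs_measurable Fc (measurable_itv _) mxT (utmT T) j) (Fae x j).
  split; first exact: A1.
  by move=> t /andP[t0 tT]; rewrite A2// xx0; exact: xE.
move=> x T T0 xx0 sol t tT; rewrite -xx0 /=.
have mxT i : measurable_fun `[0, T] (fun s => x s 0 i).
  apply: subspace_continuous_measurable_fun => //.
  exact: (@trajectory_within x (fun s => F (x s) (u s)) T T0 (fun j => (sol j).1)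
    (fun t j => (sol j).2 t) i).
have tr j := ae_transfer
  (rhs_measurable Fc (measurable_itv _) mxT (utmT T) j)
  (rhs_measurable Fc (measurable_itv _) mxT (umT T) j)
  (ltac:(have fl := ae_filter_ringOfSetsType mu;
    by apply: filterS (Fae x j) => s H s0; rewrite H)).
apply: (@trajectory_estimate x (fun s => F (x s) (ut s)) ut r T r0 utr T0) => //.
- by move=> j; apply: (tr j).1; exact: (sol j).1.
- by move=> s j /andP[s0 sT]; rewrite (tr j).2// (sol j).2// s0.
Qed.

End LyapunovImpliesISS.

(** * Regularity of the interconnection, and conclusion *)

Section InterconnectRegularity.
Variables (R : realType) (n : nat) (N m : 'I_n -> nat).
Variable f : forall i, 'rV[R]_(\sum_(j < n) N j) -> 'rV[R]_(m i) -> 'rV[R]_(N i).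
Arguments f : clear implicits.

Lemma interconnectB_le x y u w : enorm (interconnect f x u - interconnect f y w) <=
  \sum_i enorm (f i x (submxrow u i) - f i y (submxrow w i)).
Proof.
apply: (le_trans (enorm_le_blocks _)); apply: ler_sum => i _.
by rewrite submxrowB /interconnect !mxrowK.
Qed.

Lemma interconnect_continuous :
  (forall i, continuous (fun p : 'rV[R]_(\sum_(j < n) N j) * 'rV[R]_(m i) => f i p.1 p.2)) ->
  continuous (fun p : 'rV[R]_(\sum_(j < n) N j) * 'rV[R]_(\sum_(j < n) m j) =>
    interconnect f p.1 p.2).
Proof.
move=> fc [x u] A /nbhs_enormP[e e0 He].
have en : 0 < e / n.+1%:R by rewrite divr_gt0.
have H i : \forall p \near (x, u),
    enorm (f i p.1 (submxrow p.2 i) - f i x (submxrow u i)) < e / n.+1%:R.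
  have P : (fun p : 'rV[R]_(\sum_(j < n) N j) * 'rV[R]_(\sum_(j < n) m j) =>
      (p.1, submxrow p.2 i)) @ (x, u) --> (x, submxrow u i).
    apply: (@cvg_pair _ _ _ (nbhs (x, u)) (nbhs x) (nbhs (submxrow u i))); first exact: cvg_fst.
    exact: (cvg_comp _ _ (@cvg_snd _ _ (nbhs x) (nbhs u) _) (@continuous_submxrow R n m i u)).
  have Q := cvg_comp _ _ P (@fc i (x, submxrow u i)).
  apply: (Q [set z | enorm (z - f i x (submxrow u i)) < e / n.+1%:R]).
  by apply/nbhs_enormP; exists (e / n.+1%:R).
have := @filter_forall _ _ _ (nbhs (x, u)) (nbhs_filter (x, u)) H.
apply: (@filterS _ (nbhs (x, u)) (nbhs_filter _)) => p Hp; apply: He.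
apply: (le_lt_trans (interconnectB_le _ _ _ _)).
apply: (@le_lt_trans _ _ (\sum_(i < n) e / n.+1%:R)).
  by apply: ler_sum => i _; exact: ltW (Hp i).
rewrite sumr_const card_ord -[_ *+ n]mulr_natl mulrCA gtr_pMr//.
by rewrite ltr_pdivrMr// mul1r ltr_nat.
Qed.

Lemma interconnect_loclip : (forall i, loclip_unif (f i)) -> loclip_unif (interconnect f).
Proof.
move=> fl r x0.
have /choice[p pP] : forall i, exists p : R * R, 0 < p.1 /\
    forall x y u, enorm (x - x0) < p.1 -> enorm (y - x0) < p.1 -> enorm u <= r ->
      enorm (f i x u - f i y u) <= p.2 * enorm (x - y).
  by move=> i; have [d [L H]] := fl i r x0; exists (d, L).
have [d d0 Hd] := finite_pos_min (fun i => (pP i).1).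
exists d, (\sum_i (p i).2); split => // x y u xd yd ur.
apply: (le_trans (interconnectB_le _ _ _ _)); rewrite mulr_suml; apply: ler_sum => i _.
apply: (pP i).2; [exact: lt_le_trans xd (Hd i)|exact: lt_le_trans yd (Hd i)|].
exact: le_trans (enorm_block_le _ _) ur.
Qed.

End InterconnectRegularity.

Theorem theorem6 (R : realType) (n : nat) (N m : 'I_n -> nat)
  (f : forall i, 'rV[R]_(\sum_(j < n) N j) -> 'rV[R]_(m i) -> 'rV[R]_(N i))
  (isSum : pred 'I_n)
  (V : forall i, 'rV[R]_(N i) -> R)
  (g : 'I_n -> 'I_n -> R -> R) (gi : 'I_n -> R -> R) (alphai : 'I_n -> R -> R) :
  (* regularity of the right-hand sides *)
  (forall i, continuous (fun p : 'rV[R]_(\sum_(j < n) N j) * 'rV[R]_(m i) =>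
                            f i p.1 p.2)) ->
  (forall i, loclip_unif (f i)) ->
  (* V_i are ISS Lyapunov functions of the subsystems (mixed sum/max form) *)
  (forall i, [/\ continuous (V i), proper_pd (V i) & loclip_nz (V i)]) ->
  (forall i j, isKinf0 (g i j)) ->
  (forall i r, 0 <= r -> g i i r = 0) ->
  (forall i, isK (gi i)) ->
  (forall i, isPD (alphai i)) ->
  (forall i x u, differentiable (V i) (submxrow x i) ->
     (if isSum i then
        \sum_(j < n) g i j (V j (submxrow x j)) + gi i (enorm u)
          <= V i (submxrow x i)
      else
        Num.max (\big[Num.max/0]_(j < n) g i j (V j (submxrow x j)))
                (gi i (enorm u)) <= V i (submxrow x i)) ->
     'd (V i) (submxrow x i) (f i x (submxrow u i))
        <= - alphai i (enorm (submxrow x i))) ->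
  (* small-gain condition *)
  (exists2 alpha, isKinf alpha &
     forall s : 'I_n -> R, (forall i, 0 <= s i) -> (exists i, s i != 0) ->
       exists i, Gam isSum g (Dalpha isSum alpha s) i < s i) ->
  ISS (interconnect f) /\
  exists sigma sigmainv phi,
    [/\ Omega_path isSum g sigma sigmainv, isKinf phi,
        (forall r, 0 < r -> forall i,
           Gambar isSum g gi (fun j => sigma j r) (phi r) i < sigma i r) &
        ISS_Lyapunov (interconnect f)
          (fun x => \big[Num.max/0]_(i < n) sigmainv i (V i (submxrow x i)))].
Proof.
move=> fc fl Vreg hg hgii hgi hal decr sg.
have [sigma [sigmainv [phi [OP Iphi Gs Iv slope]]]] := omega_path_exists hg hgi sg.
have [Is sK _ _ _] := OP.
have decr' i x u : differentiable (V i) (submxrow x i) ->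
    Gambar isSum g gi (fun j => V j (submxrow x j)) (enorm u) i <= V i (submxrow x i) ->
    'd (V i) (submxrow x i) (f i x (submxrow u i)) <= - alphai i (enorm (submxrow x i)).
  by move=> dV GV; apply: decr => //; move: GV; rewrite /Gambar; case: ifP.
have LW := max_ISS_Lyapunov fc Vreg hg hgii hgi hal decr' Is Iv sK Iphi Gs slope.
split; last by exists sigma, sigmainv, phi; split.
have [Vc [psi1 [psi2 [I1 I2 Vpsi]]] Vl [gam [al [Kg Pal Vdec]]]] := LW.
have [q1 J1 q1P] := isKinf_inv I1.
exact: (Lyapunov_ISS (interconnect_continuous fc) (interconnect_loclip fl) Vc Vl I1 I2 Vpsi
  J1 q1P Kg Pal Vdec).
Qed.
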